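(* Let $G$ be a finite group, $F$ an algebraically closed field of characteristic zero and $\tau$ an involution of $G$. Let $\mathcal{V}=\operatorname{var}^{\sharp}(A)$ be a $(G,* )$-variety generated by a finite-dimensional $(G,* )$-algebra $A$ over $F$, where $*$ is a $\tau$-involution on $A$. Then $\mathcal{V}$ has polynomial growth if and only if $Q\notin \operatorname{var}^{\sharp}(A)$ for all $Q\in\mathcal{I}$, where $\mathcal{I}$ is the set of $(G,* )$-algebras defined in the context.
   Context: $G$ is a finite group (not necessarily abelian) with identity $1$, and $\tau:G\to G$ is a fixed involution of $G$: $\tau(gh)=\tau(h)\tau(g)$ and $\tau(\tau(g))=g$. Algebras are associative over $F$. A $G$-graded algebra is $A=\bigoplus_{g\in G}A_g$ with $A_gA_h\subseteq A_{gh}$. An involution on $A$ is an $F$-linear map $*$ with $(ab)^*=b^*a^*$, $(a^* )^*=a$. It is a $\tau$-involution (homogeneous with respect to $\tau$) if $(A_g)^*\subseteq A_{\tau(g)}$ for all $g$. A $(G,* )$-algebra is a $G$-graded algebra with a $\tau$-involution. Isomorphisms of $(G,* )$-algebras are degree-preserving algebra isomorphisms commuting with $*$. Identities and codimensions: let $\mathcal{F}$ be the free associative algebra on variables $x_{k,g},x_{k,g}^*$ ($k\in\mathbb{N}$, $g\in G$), graded by $\deg x_{k,g}=g$, $\deg x_{k,g}^*=\tau(g)$ (extended multiplicatively to monomials), with the involution exchanging $x_{k,g}$ and $x_{k,g}^*$. $f\in\mathcal{F}$ is a $(G,* )$-identity of $A$ if it vanishes whenever each $x_{k,g}$ is replaced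 by an element $a\in A_g$ and $x_{k,g}^*$ by $a^*$. $\operatorname{Id}^\sharp(A)$ is the set of all $(G,* )$-identities of $A$, and $\operatorname{var}^\sharp(A)$ is the class of all $(G,* )$-algebras $B$ with $\operatorname{Id}^\sharp(A)\subseteq \operatorname{Id}^\sharp(B)$. Let $P_n^\sharp$ be the span of all monomials $x_{\sigma(1),g_1}^{\epsilon_1}\cdots x_{\sigma(n),g_n}^{\epsilon_n}$ with $\sigma\in S_n$, $g_i\in G$, $\epsilon_i\in\{\emptyset,*\}$. Put $c_n^\sharp(A)=\dim_F P_n^\sharp/(P_n^\sharp\cap\operatorname{Id}^\sharp(A))$ and $c_n^\sharp(\mathcal V)=c_n^\sharp(A)$ if $\mathcal V=\operatorname{var}^\sharp(A)$. Polynomial growth means $c_n^\sharp(\mathcal V)\le \alpha n^t$ for all $n\ge1$, for some constants $\alpha,t\geq 0$. The algebras: - $FC_{2,*}$ is the group algebra of the cyclic group $C_2=\{1,c\}$ of order 2 with trivial $G$-grading (everything in degree $1$) and involution $(\alpha 1+\beta c)^*=\alpha1-\beta c$. - For $s\in G$ with $|s|=2$ and $\tau(s)=s$, $FC_{2,*}^s$ is the group algebra of $\langle s\rangle$ with canonical grading (the group element $s^i$ has degree $s^i$) and involution $(\alpha1+\beta s)^*=\alpha1-\beta s$. - For $h\in G$ of prime order $p$ with $\tau(h)\in\{h,h^{-1}\}$, $FC_{p,\tau}^h$ is the group algebra of $C_p=\langle h\rangle$ with canonical grading and the involution determined by $h^*=\tau(h)$. - For $g\in G$, $M_{\rho,\tau}^g$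 is the algebra $M=F(e_{11}+e_{44})+F(e_{22}+e_{33})+Fe_{12}+Fe_{34}$ of upper triangular $4\times4$ matrices ($e_{ij}$ matrix units), with involution $\rho$ (reflection along the secondary diagonal) fixing $e_{11}+e_{44}$ and $e_{22}+e_{33}$ and exchanging $e_{12}$ and $e_{34}$, graded so that $e_{11}+e_{44}$, $e_{22}+e_{33}$ have degree $1$, $e_{12}$ has degree $g$, $e_{34}$ has degree $\tau(g)$. The set $\mathcal{I}$ consists of: $FC_{2,*}$; $M_{\rho,\tau}^g$ for all $g\in G$; $FC_{p,\tau}^h$ for all primes $p$ dividing $|G|$ and all $h\in G$ with $|h|=p$ and $\tau(h)\in\{h,h^{-1}\}$; and, if $|G|$ is even, $FC_{2,*}^s$ for all $s\in G$ with $|s|=2$ and $\tau(s)=s$. *)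

(* Defs.v *)
From Stdlib Require Import Reals ClassicalEpsilon.
From HB Require Import structures.
From mathcomp Require Import all_boot all_order all_fingroup all_algebra.
From mathcomp Require Import finmap monalg.
Set Implicit Arguments.
Unset Strict Implicit.
Unset Printing Implicit Defensive.
Import GRing.Theory.
Local Open Scope ring_scope.

Record group_involution (gT : finGroupType) := GroupInvolution {
  ginvol :> gT -> gT;
  ginvolM : forall x y, ginvol (x * y)%g = (ginvol y * ginvol x)%g;
  ginvolK : involutive ginvol
}.

(* G-graded algebras with a tau-involution on the vector space V, where G is
   the whole of gT.  No unit is assumed. *)
Record gstar_alg (F : fieldType) (gT : finGroupType)
    (tau : group_involution gT) (V : lmodType F) := GStarAlg {
  gmul : V -> V -> V;
  gstar : V -> V;
  gcomp : gT -> V -> Prop;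
  gmulA : associative gmul;
  gmul_linl : forall b, linear (gmul^~ b);
  gmul_linr : forall a, linear (gmul a);
  gstar_lin : linear gstar;
  gstarM : forall a b, gstar (gmul a b) = gmul (gstar b) (gstar a);
  gstarK : involutive gstar;
  gcomp0 : forall g, gcomp g 0;
  gcompZD : forall g c u v, gcomp g u -> gcomp g v -> gcomp g (c *: u + v);
  gcomp_direct : forall v, exists! u : {ffun gT -> V},
    (forall g, gcomp g (u g)) /\ v = \sum_g u g;
  gcompM : forall g h a b, gcomp g a -> gcomp h b -> gcomp (g * h)%g (gmul a b);
  gcomp_star : forall g a, gcomp g a -> gcomp (tau g) (gstar a)
}.

(* (k, g, false) is the variable x_{k,g} and (k, g, true) is x_{k,g}^*. *)
Definition gvar (gT : finGroupType) : Type := (nat * gT * bool)%type.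

Notation free_alg F gT := {malg F[{fmonom gvar gT}]}.

Section Multilinear.
Context (F : fieldType) (gT : finGroupType).

Definition mlin_monom n (s : 'S_n) (g : {ffun 'I_n -> gT})
    (e : {ffun 'I_n -> bool}) : {fmonom gvar gT} :=
  \big[mmul/mone]_(i < n) fmu ((s i : nat), g i, e i).

(* The space P_n. *)
Definition mlin n (f : free_alg F gT) : Prop :=
  exists c : 'S_n * {ffun 'I_n -> gT} * {ffun 'I_n -> bool} -> F,
    f = \sum_m c m *: << mlin_monom m.1.1 m.1.2 m.2 >>.

End Multilinear.

Section Identities.
Context (F : fieldType) (gT : finGroupType) (tau : group_involution gT).
Context (V : lmodType F) (A : gstar_alg tau V).

Definition gvar_eval (phi : nat -> gT -> V) (x : gvar gT) : V :=
  if x.2 then gstar A (phi x.1.1 x.1.2) else phi x.1.1 x.1.2.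

(* As A need not have a unit, the empty word has no meaningful value; it is
   excluded from identities in [gstar_id]. *)
Definition gword_eval (phi : nat -> gT -> V) (w : seq (gvar gT)) : V :=
  if w is x :: w' then
    foldl (gmul A) (gvar_eval phi x) [seq gvar_eval phi y | y <- w']
  else 0.

Definition geval (phi : nat -> gT -> V) (f : free_alg F gT) : V :=
  \sum_(w <- msupp f) f@_w *: gword_eval phi w.

Definition gstar_id (f : free_alg F gT) : Prop :=
  f@_mone = 0 /\
  forall phi : nat -> gT -> V,
    (forall k g, gcomp A g (phi k g)) -> geval phi f = 0.

Lemma geval_lin phi : linear (geval phi).
Proof.
have sub (d : {fset {fmonom gvar gT}}) f : (msupp f `<=` d)%fset ->
    geval phi f = \sum_(w <- d) f@_w *: gword_eval phi w.
  move=> le; rewrite /geval; apply: big_fset_incl => // w _ /mcoeff_outdom ->.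
  by rewrite scale0r.
move=> c f g.
pose d := (msupp f `|` msupp g `|` msupp (c *: f + g))%fset.
rewrite !(sub d) /d; last first.
- by rewrite fsubsetUr.
- by rewrite -fsetUA fsubsetUl.
- by rewrite fsetUAC fsubsetUr.
rewrite scaler_sumr -big_split /=; apply: eq_bigr => w _.
by rewrite mcoeffD mcoeffZ scalerDl scalerA.
Qed.

Lemma gstar_id0 : gstar_id 0.
Proof.
split; first by rewrite mcoeff0.
by move=> phi _; rewrite /geval msupp0 big_seq_fset0.
Qed.

Lemma gstar_idZD c f g : gstar_id f -> gstar_id g -> gstar_id (c *: f + g).
Proof.
move=> [f0 fE] [g0 gE]; split.
  by rewrite mcoeffD mcoeffZ f0 g0 mulr0 addr0.
by move=> phi Hphi; rewrite geval_lin fE // gE // scaler0 addr0.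
Qed.

End Identities.

(* B belongs to the variety var(A). *)
Definition in_gstar_var (F : fieldType) (gT : finGroupType)
    (tau : group_involution gT) (V W : lmodType F)
    (A : gstar_alg tau V) (B : gstar_alg tau W) : Prop :=
  forall f, gstar_id A f -> gstar_id B f.

Section QuotientDimension.
Context (F : fieldType) (V : lmodType F).

(* For subspaces P, I of V: the classes of b form a basis of P / (P \cap I). *)
Definition quot_basis (P I : V -> Prop) d (b : 'I_d -> V) : Prop :=
  (forall i, P (b i)) /\
  forall v, P v ->
    exists! c : {ffun 'I_d -> F}, I (v - \sum_i c i *: b i).

Definition has_quot_dim (P I : V -> Prop) d : Prop :=
  exists b : 'I_d -> V, quot_basis P I b.

Lemma has_quot_dim_exists (T : finType) (m : T -> V) (P I : V -> Prop) :
    (forall v, P v <-> exists c : T -> F, v = \sum_t c t *: m t) ->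
    I 0 -> (forall c u v, I u -> I v -> I (c *: u + v)) ->
  exists d, has_quot_dim P I d.
Proof.
move=> PE I0 IZD.
pose L := {ffun T -> F^o}.
pose phi (x : L) := \sum_t x t *: m t.
have phiL : linear phi.
  move=> c x y; rewrite /phi scaler_sumr -big_split /=; apply: eq_bigr => t _.
  by rewrite !ffunE scalerDl scalerA.
pose fphi : {linear L -> V} := HB.pack phi (GRing.isLinear.Build F L V _ phi phiL).
have phi0 : phi 0 = 0 by exact: (linear0 fphi).
have phiB x y : phi (x - y) = phi x - phi y by exact: (linearB fphi).
have phiP x : P (phi x) by apply/PE; exists x.
have [U UE] : exists U : {vspace L}, forall x, x \in U <-> I (phi x).
  have step k : (exists U : {vspace L}, forall x, x \in U <-> I (phi x)) \/
      exists U : {vspace L}, (forall x, x \in U -> I (phi x)) /\ (k <= \dim U)%N.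
    elim: k => [|k [|[U [UI kU]]]]; [|by left|].
      right; exists 0%VS; split=> // x; rewrite memv0 => /eqP ->.
      by rewrite phi0.
    have [|nUE] := classic (forall x, I (phi x) -> x \in U).
      by left; exists U => x; split; auto.
    have [x nx] := not_all_ex_not _ _ nUE.
    have [Ix /negP xU] := imply_to_and _ _ nx.
    right; exists (U + <[x]>)%VS; split.
      move=> y /memv_addP [u uU [w /vlineP [c ->] ->]].
      by rewrite addrC (phiL c x u); apply: IZD => //; apply: UI.
    apply: leq_ltn_trans kU _; rewrite (ltn_leqif (dimv_leqif_sup (addvSl _ _))).
    by rewrite subv_add subvv /= -memvE; apply/negP.
  have [//|[U [_]]] := step (\dim {:L}).+1.
  by move=> /leq_trans /(_ (dimvS (subvf U))); rewrite ltnn.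
pose W := (U^C)%VS; pose b i := phi (vbasis W)`_i.
exists (\dim W), b; split=> [i|v /PE [c0 vE]]; first exact: phiP.
pose x : L := [ffun t => c0 t].
have vx : v = phi x.
  by rewrite vE; apply: eq_bigr => t _; rewrite ffunE.
have bE (c : 'I_(\dim W) -> F) :
    \sum_i c i *: b i = phi (\sum_i c i *: (vbasis W)`_i).
  by rewrite -[phi _]/(fphi _) linear_sum; apply: eq_bigr => i _; rewrite linearZ.
have : x \in (U + W)%VS by rewrite addv_complf memvf.
move=> /memv_addP [u uU [w wW xE]].
have IE (c : 'I_(\dim W) -> F) : I (v - \sum_i c i *: b i) <->
    x - \sum_i c i *: (vbasis W)`_i \in U.
  by rewrite UE bE vx phiB.
have wE := coord_vbasis wW.
exists [ffun i => coord (vbasis W) i w]; split.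
  apply/IE; under eq_bigr do rewrite ffunE.
  by rewrite -wE xE addrK.
move=> c /IE; rewrite xE -addrA => H.
have : w - \sum_i c i *: (vbasis W)`_i \in (U :&: W)%VS.
  rewrite memv_cap; apply/andP; split.
    by move: H; rewrite rpredDl.
  rewrite rpredB // rpred_sum // => i _; rewrite rpredZ //.
  by apply: (basis_mem (vbasisP W)); apply: mem_nth; rewrite size_tuple.
rewrite capv_compl memv0 subr_eq0 => /eqP ->.
by apply/ffunP => i; rewrite ffunE coord_sum_free // (basis_free (vbasisP W)).
Qed.

Lemma has_quot_dim_leq (P I : V -> Prop) d d' :
    I 0 -> (forall c u v, I u -> I v -> I (c *: u + v)) ->
    (forall c u v, P u -> P v -> P (c *: u + v)) -> P 0 ->
  has_quot_dim P I d -> has_quot_dim P I d' -> (d <= d')%N.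
Proof.
move=> I0 IZD PZD P0 [b [bP bU]] [b' [b'P b'U]].
have Isum (k : nat) (u : 'I_k -> F) (x : 'I_k -> V) :
    (forall i, I (x i)) -> I (\sum_i u i *: x i).
  by move=> Ix; elim/big_rec: _ => // i y _; apply: IZD.
pose c i := proj1_sig (constructive_indefinite_description _ (b'U _ (bP i))).
have cE i : I (b i - \sum_j c i j *: b' j).
  by rewrite /c; case: constructive_indefinite_description => /= ? [].
pose M := \matrix_(i < d, j < d') c i j.
rewrite leqNgt; apply/negP => lt.
have : kermx M != 0.
  rewrite kermx_eq0 /row_free; apply/eqP => rM.
  by have := rank_leq_col M; rewrite rM leqNgt lt.
move=> /rowV0Pn [u /sub_kermxP uM /negP]; apply; apply/eqP/rowP => i.
have : I (0 - \sum_i (- u 0 i) *: b i).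
  rewrite sub0r -sumrN.
  suff -> : \sum_i - (- u 0 i *: b i) = \sum_i u 0 i *: (b i - \sum_j c i j *: b' j).
    exact: Isum.
  under [RHS]eq_bigr do rewrite scalerBr.
  rewrite sumrB [X in _ = _ - X](_ : _ = 0) ?subr0.
    by apply: eq_bigr => k _; rewrite scaleNr opprK.
  under eq_bigr do rewrite scaler_sumr.
  rewrite exchange_big big1 //= => j _.
  under eq_bigr do rewrite scalerA.
  rewrite -scaler_suml [X in X *: _](_ : _ = (u *m M) 0 j).
    by rewrite uM mxE scale0r.
  by rewrite mxE; apply: eq_bigr => k _; rewrite mxE.
have [c0 [_ c0U]] := bU 0 P0.
have z0 : c0 = [ffun=> 0].
  apply: c0U; rewrite big1 ?subr0 // => k _; rewrite ffunE scale0r //.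
move=> H; have := c0U [ffun k => - u 0 k].
under eq_bigr do rewrite ffunE.
move=> /(_ H); rewrite z0 => /ffunP /(_ i); rewrite !ffunE mxE.
by move/eqP; rewrite eq_sym oppr_eq0 => /eqP.
Qed.

End QuotientDimension.

Section Codimension.
Context (F : fieldType) (gT : finGroupType) (tau : group_involution gT).
Context (V : lmodType F) (A : gstar_alg tau V).

(* c_n(A) = dim P_n / (P_n \cap Id(A)). *)
Definition gstar_codim (n : nat) : nat :=
  epsilon (inhabits 0%N) (has_quot_dim (@mlin F gT n) (gstar_id A)).

Lemma gstar_codimP n :
  has_quot_dim (@mlin F gT n) (gstar_id A) (gstar_codim n).
Proof.
apply: epsilon_spec; apply: has_quot_dim_exists.
- by move=> v; split; exact.
- exact: gstar_id0.
- exact: gstar_idZD.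
Qed.

Lemma gstar_codim_unique n d :
  has_quot_dim (@mlin F gT n) (gstar_id A) d -> d = gstar_codim n.
Proof.
have P0 : @mlin F gT n 0.
  by exists (fun=> 0); rewrite big1 // => m _; rewrite scale0r.
have PZD c u v : @mlin F gT n u -> @mlin F gT n v -> mlin n (c *: u + v).
  move=> [x ->] [y ->]; exists (fun m => c * x m + y m).
  rewrite scaler_sumr -big_split; apply: eq_bigr => m _ /=.
  by rewrite scalerA scalerDl.
move=> dP; apply/eqP; rewrite eqn_leq.
by apply/andP; split;
  apply: has_quot_dim_leq PZD P0 _ _; eauto using gstar_codimP;
  [exact: gstar_id0 | exact: gstar_idZD | exact: gstar_id0 | exact: gstar_idZD].
Qed.

Definition polynomial_growth : Prop :=
  exists alpha t : R, Rle 0 alpha /\ Rle 0 t /\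
    forall n, (0 < n)%N ->
      Rle (INR (gstar_codim n)) (Rmult alpha (Rpower (INR n) t)).

End Codimension.

Section GroupAlgebra.
Context (F : fieldType) (gT : finGroupType) (tau : group_involution gT).
(* The group algebra of H, where x has degree [deg x] and
   x^* = [chi x] [theta x]. *)
Context (H : finGroupType) (deg : H -> gT) (theta : H -> H) (chi : H -> F).

Record galg_data : Prop := GalgData {
  galg_degM : forall x y, deg (x * y)%g = (deg x * deg y)%g;
  galg_thetaM : forall x y, theta (x * y)%g = (theta y * theta x)%g;
  galg_thetaK : involutive theta;
  galg_chiM : forall x y, chi (x * y)%g = chi x * chi y;
  galg_chi_theta : forall x, chi (theta x) = chi x;
  galg_chi2 : forall x, chi x * chi x = 1;
  galg_deg_theta : forall x, deg (theta x) = tau (deg x)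
}.

Definition galg_mul (a b : {ffun H -> F^o}) : {ffun H -> F^o} :=
  [ffun x => \sum_y a y * b (y^-1 * x)%g].
(* The coefficient of x = theta (theta x) in
   \sum_y a y * chi y * (theta y). *)
Definition galg_star (a : {ffun H -> F^o}) : {ffun H -> F^o} :=
  [ffun x => chi (theta x) * a (theta x)].
Definition galg_comp (g : gT) (a : {ffun H -> F^o}) : Prop :=
  forall x, deg x != g -> a x = 0.

Context (D : galg_data).

Lemma galg_mulA : associative galg_mul.
Proof.
move=> a b c; apply/ffunP => x; rewrite !ffunE.
under eq_bigr do rewrite ffunE mulr_sumr.
under [RHS]eq_bigr do rewrite ffunE mulr_suml.
rewrite [RHS]exchange_big /=; apply: eq_bigr => y _.
rewrite (reindex_inj (mulgI y^-1%g)) /=; apply: eq_bigr => z _.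
by rewrite invMg invgK mulrA mulgA mulgK.
Qed.

Lemma galg_mul_linl b : linear (galg_mul^~ b).
Proof.
move=> c u v; apply/ffunP => x; rewrite !ffunE.
rewrite scaler_sumr -big_split; apply: eq_bigr => y _ /=.
by rewrite !ffunE mulrDl -[_ *: u y]/(c * u y) -mulrA.
Qed.

Lemma galg_mul_linr a : linear (galg_mul a).
Proof.
move=> c u v; apply/ffunP => x; rewrite !ffunE.
rewrite scaler_sumr -big_split; apply: eq_bigr => y _ /=.
by rewrite !ffunE mulrDr -[_ *: u _]/(c * u _) mulrCA.
Qed.

Lemma galg_star_lin : linear galg_star.
Proof.
move=> c u v; apply/ffunP => x; rewrite !ffunE mulrDr.
by rewrite -[_ *: u _]/(c * u _) mulrCA.
Qed.

Lemma galg_starM a b :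
  galg_star (galg_mul a b) = galg_mul (galg_star b) (galg_star a).
Proof.
have [dM tM tK cM ct c2 dt] := D.
apply/ffunP => x; rewrite !ffunE mulr_sumr.
rewrite (reindex_inj (h := fun y => theta x * (theta y)^-1)%g); last first.
  by move=> y z /mulgI /invg_inj /(can_inj tK).
apply: eq_bigr => y _ /=; rewrite !ffunE.
have t1 : theta 1%g = 1%g.
  by apply: (mulgI (theta 1%g)); rewrite -tM !mulg1.
have tV z : theta z^-1%g = (theta z)^-1%g.
  by apply: (mulgI (theta z)); rewrite -tM mulVg t1 mulgV.
rewrite tM tV invMg invgK mulgKV.
have -> : chi (theta x) = chi (theta x * (theta y)^-1)%g * chi (theta y).
  by rewrite -cM mulgKV.
by rewrite mulrACA mulrC.
Qed.

Lemma galg_starK : involutive galg_star.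
Proof.
have [dM tM tK cM ct c2 dt] := D.
by move=> a; apply/ffunP => x; rewrite !ffunE !tK ct mulrA c2 mul1r.
Qed.

Lemma galg_comp0 g : galg_comp g 0.
Proof. by move=> x _; rewrite ffunE. Qed.

Lemma galg_compZD g c u v :
  galg_comp g u -> galg_comp g v -> galg_comp g (c *: u + v).
Proof.
by move=> gu gv x gx; rewrite !ffunE gu // gv // scaler0 addr0.
Qed.

Lemma galg_comp_direct v : exists! u : {ffun gT -> {ffun H -> F^o}},
  (forall g, galg_comp g (u g)) /\ v = \sum_g u g.
Proof.
exists [ffun g => [ffun x => if deg x == g then v x else 0]]; split.
  split=> [g x /negbTE gx|]; first by rewrite !ffunE gx.
  apply/ffunP => x; rewrite sum_ffunE (bigD1 (deg x)) //= !ffunE eqxx.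
  rewrite big1 ?addr0 // => g /negbTE gx.
  by rewrite !ffunE eq_sym gx.
move=> u [uP ->]; apply/ffunP => g; apply/ffunP => x; rewrite !ffunE.
case: eqP => [<-|/eqP ne]; last by rewrite uP.
rewrite sum_ffunE (bigD1 (deg x)) //= big1 ?addr0 // => h hx.
by rewrite uP // eq_sym.
Qed.

Lemma galg_compM g h a b : galg_comp g a -> galg_comp h b ->
  galg_comp (g * h)%g (galg_mul a b).
Proof.
have [dM tM tK cM ct c2 dt] := D.
move=> ga hb x gx; rewrite ffunE big1 // => y _.
have [yg|/ga ->] := eqVneq (deg y) g; last by rewrite mul0r.
rewrite hb ?mulr0 //; apply: contra_neq gx => <-.
by rewrite -yg -dM mulKVg.
Qed.

Lemma galg_comp_star g a : galg_comp g a -> galg_comp (tau g) (galg_star a).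
Proof.
have [dM tM tK cM ct c2 dt] := D.
move=> ga x gx; rewrite ffunE ga ?mulr0 // dt.
by apply: contra_neq gx => <-; rewrite (ginvolK tau).
Qed.

Definition galg : gstar_alg tau {ffun H -> F^o} :=
  GStarAlg galg_mulA galg_mul_linl galg_mul_linr galg_star_lin galg_starM
    galg_starK galg_comp0 galg_compZD galg_comp_direct galg_compM galg_comp_star.

End GroupAlgebra.

Section CyclicGroupAlgebras.
Context (F : fieldType) (gT : finGroupType) (tau : group_involution gT).

Definition sgn2 (H : finGroupType) (x : H) : F := if x == 1%g then 1 else -1.

Lemma sgn2_galg_data (H : finGroupType) (deg : H -> gT) :
    #|[set: H]| = 2%N ->
    (forall x y, deg (x * y)%g = (deg x * deg y)%g) ->
    (forall x, deg x = tau (deg x)) ->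
  galg_data tau deg id (@sgn2 H).
Proof.
move=> H2 dM dt.
have le2 (A : {set H}) : (#|A| <= 2)%N.
  by rewrite -H2 subset_leq_card // subsetT.
have two (x y : H) : x != 1%g -> y != 1%g -> (x * y)%g = 1%g.
  move=> x1 y1; have <- : x = y.
    apply/eqP; have := le2 [set 1%g; x; y].
    rewrite -setUA cardsU1 cards2 !inE negb_or ![1%g == _]eq_sym x1 y1.
    by case: eqP.
  have := le2 [set 1%g; x; (x * x)%g].
  rewrite -setUA cardsU1 cards2 !inE negb_or ![1%g == _]eq_sym x1 /=.
  have -> : x != (x * x)%g 
    by apply: contra_neq x1 => xx; apply: (mulgI x); rewrite -xx mulg1.
  by case: eqP.
have HC (x y : H) : (x * y = y * x)%g.
  have [->|x1] := eqVneq x 1%g; first by rewrite mul1g mulg1.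
  have [->|y1] := eqVneq y 1%g; first by rewrite mul1g mulg1.
  by rewrite !two.
split=> //.
- move=> x y; have [->|x1] := eqVneq x 1%g.
    by rewrite mul1g /sgn2 eqxx mul1r.
  have [->|y1] := eqVneq y 1%g; first by rewrite mulg1 /sgn2 eqxx mulr1.
  by rewrite two // /sgn2 eqxx (negbTE x1) (negbTE y1) mulrNN mulr1.
- by move=> x; rewrite /sgn2; case: eqP => _; rewrite ?mulrNN mulr1.
Qed.

Lemma FC2_star_data : galg_data tau (fun _ : 'Z_2 => 1%g) id (@sgn2 'Z_2).
Proof.
apply: sgn2_galg_data => [|x y|_]; first by rewrite cardsT card_ord.
  by rewrite mulg1.
by apply: (mulgI (tau 1%g)); rewrite -ginvolM !mulg1.
Qed.

(* 'Z_2, as a group, is the cyclic group C_2. *)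
Definition FC2_star : gstar_alg tau {ffun 'Z_2 -> F^o} := galg FC2_star_data.

Lemma FC2_star_s_data (s : gT) (os : #[s]%g = 2%N) (ts : tau s = s) :
  galg_data tau (sgval : subg_of <[s]>%G -> gT) id (@sgn2 (subg_of <[s]>%G)).
Proof.
apply: sgn2_galg_data => [|x y|x]; first by rewrite cardsT card_sub.
  by [].
have /cyclePmin [i] := subgP x; rewrite os => + ->.
case: i => [|[|//]] _; last by rewrite expg1 ts.
by rewrite expg0; apply: (mulgI (tau 1%g)); rewrite -ginvolM !mulg1.
Qed.

Definition FC2_star_s (s : gT) (os : #[s]%g = 2%N) (ts : tau s = s) :
    gstar_alg tau {ffun subg_of <[s]>%G -> F^o} :=
  galg (FC2_star_s_data os ts).

Lemma ginvol_cycle (h : gT) : tau h = h \/ tau h = h^-1%g ->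
  forall x, x \in <[h]>%g -> tau x \in <[h]>%g.
Proof.
move=> th _ /cycleP [i ->]; elim: i => [|i IHi].
  rewrite expg0 (_ : tau 1%g = 1%g) ?group1 //.
  by apply: (mulgI (tau 1%g)); rewrite -ginvolM !mulg1.
rewrite expgS ginvolM groupM //; case: th => ->; rewrite ?groupV; exact: cycle_id.
Qed.

Definition FC_theta (h : gT) (x : subg_of <[h]>%G) : subg_of <[h]>%G :=
  subg <[h]>%G (tau (sgval x)).

Lemma FC_tau_data (h : gT) (th : tau h = h \/ tau h = h^-1%g) :
  galg_data tau (sgval : subg_of <[h]>%G -> gT) (@FC_theta h) (fun=> 1 : F).
Proof.
have tE x : sgval (@FC_theta h x) = tau (sgval x).
  by rewrite subgK // (ginvol_cycle th) // subgP.
split=> //; try by move=> *; rewrite mulr1.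
- by move=> x y; apply: val_inj; rewrite /= !tE /= ginvolM.
- by move=> x; apply: val_inj; rewrite /= !tE ginvolK.
Qed.

Definition FC_tau (h : gT) (th : tau h = h \/ tau h = h^-1%g) :
    gstar_alg tau {ffun subg_of <[h]>%G -> F^o} :=
  galg (FC_tau_data th).

End CyclicGroupAlgebras.

Section MatrixAlgebra.
Context (F : fieldType) (gT : finGroupType) (tau : group_involution gT).
Context (g : gT).

Definition unit4 (i j : nat) : 'M[F]_4 := delta_mx (inord i) (inord j).
Local Notation E := unit4.

(* The spanning family of M with degrees; the e_ij are numbered from 0. *)
Definition Mrho_basis : seq (gT * 'M[F]_4) :=
  [:: (1%g, E 0 0 + E 3 3); (1%g, E 1 1 + E 2 2); (g, E 0 1); (tau g, E 2 3)].

Definition Mrho_space : {vspace 'M[F]_4} := <<[seq x.2 | x <- Mrho_basis]>>%VS.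

Notation Mrho := (subvs_of Mrho_space).

Definition Mrho_mul (u v : Mrho) : Mrho :=
  vsproj Mrho_space (vsval u *m vsval v).

(* Reflection along the secondary diagonal. *)
Definition refl_mx (m : 'M[F]_4) : 'M[F]_4 :=
  \matrix_(i, j) m (rev_ord j) (rev_ord i).

Definition Mrho_star (u : Mrho) : Mrho := vsproj Mrho_space (refl_mx (vsval u)).

Definition Mrho_comp (k : gT) (u : Mrho) : Prop :=
  vsval u \in <<[seq x.2 | x <- Mrho_basis & x.1 == k]>>%VS.

Definition Mmx (a b c d : F) : 'M[F]_4 :=
  a *: (E 0 0 + E 3 3) + (b *: (E 1 1 + E 2 2) + (c *: E 0 1 + (d *: E 2 3 + 0))).

Lemma mem_span_filter_cons (P : pred gT) x (s : seq (gT * 'M[F]_4)) m :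
  m \in <<[seq y.2 | y <- x :: s & P y.1]>>%VS <->
  exists a m', [/\ ~~ P x.1 -> a = 0, m' \in <<[seq y.2 | y <- s & P y.1]>>%VS
    & m = a *: x.2 + m'].
Proof.
rewrite /=; case: ifP => Px; last first.
  split=> [ms|[a [m' [a0 m's ->]]]]; last by rewrite a0 // scale0r add0r.
  by exists 0, m; rewrite scale0r add0r.
rewrite /= span_cons; split.
  by move=> /memv_addP [_ /vlineP [a ->] [m' m's ->]]; exists a, m'.
move=> [a [m' [_ m's ->]]]; apply: memv_add => //.
by apply/vlineP; exists a.
Qed.

Lemma mem_Mrho_filter (P : pred gT) m :
  m \in <<[seq y.2 | y <- Mrho_basis & P y.1]>>%VS <->
  exists a b c d, [/\ ~~ P 1%g -> a = 0 /\ b = 0, ~~ P g -> c = 0,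
    ~~ P (tau g) -> d = 0 & m = Mmx a b c d].
Proof.
split.
  move=> /mem_span_filter_cons [a [m1 [Pa /mem_span_filter_cons H ->]]].
  move: H => [b [m2 [Pb /mem_span_filter_cons H ->]]].
  move: H => [c [m3 [Pc /mem_span_filter_cons H ->]]].
  move: H => [d [m4 [Pd]]].
  rewrite /= span_nil memv0 => /eqP -> ->.
  by exists a, b, c, d; split=> // nP; split; auto.
move=> [a [b [c [d [Pab Pc Pd ->]]]]].
apply/mem_span_filter_cons.
exists a, (b *: (E 1 1 + E 2 2) + (c *: E 0 1 + (d *: E 2 3 + 0))).
split=> [/Pab []|| //] //; apply/mem_span_filter_cons.
exists b, (c *: E 0 1 + (d *: E 2 3 + 0)).
split=> [/Pab []|| //] //; apply/mem_span_filter_cons.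
exists c, (d *: E 2 3 + 0); split=> //; apply/mem_span_filter_cons.
exists d, 0; split=> //=.
exact: mem0v.
Qed.

Lemma mem_Mrho m : m \in Mrho_space <-> exists a b c d, m = Mmx a b c d.
Proof.
have -> : Mrho_space = <<[seq y.2 | y <- Mrho_basis & predT y.1]>>%VS.
  by rewrite /Mrho_space filter_predT.
rewrite mem_Mrho_filter; split; first by move=> [a [b [c [d []]]]]; eauto 6.
by move=> [a [b [c [d ->]]]]; exists a, b, c, d.
Qed.

Lemma MmxE a b c d i j : Mmx a b c d i j =
  match val i, val j with
  | 0, 0 | 3, 3 => a | 1, 1 | 2, 2 => b | 0, 1 => c | 2, 3 => d | _, _ => 0
  end.
Proof.
rewrite /Mmx !mxE -!val_eqE /= !inordK //.
case: i j => [[|[|[|[|//]]]] ?] [[|[|[|[|//]]]] ?] /=;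
  by rewrite ?(mulr0, mulr1, addr0, add0r).
Qed.

Lemma MmxM a b c d a' b' c' d' : Mmx a b c d *m Mmx a' b' c' d' =
  Mmx (a * a') (b * b') (a * c' + c * b') (b * d' + d * a').
Proof.
apply/matrixP => i j; rewrite MmxE mxE !big_ord_recl big_ord0 !MmxE.
case: i j => [[|[|[|[|//]]]] ?] [[|[|[|[|//]]]] ?] /=;
  by rewrite ?(mulr0, mul0r, addr0, add0r).
Qed.

Lemma refl_Mmx a b c d : refl_mx (Mmx a b c d) = Mmx a b d c.
Proof.
apply/matrixP => i j; rewrite mxE !MmxE.
by case: i j => [[|[|[|[|//]]]] ?] [[|[|[|[|//]]]] ?].
Qed.

Lemma vsval_Mrho (u : Mrho) : exists a b c d, vsval u = Mmx a b c d.
Proof. by apply/mem_Mrho; exact: subvsP. Qed.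

Lemma Mmx_mem a b c d : Mmx a b c d \in Mrho_space.
Proof. by apply/mem_Mrho; exists a, b, c, d. Qed.

Lemma vsval_Mrho_mul u v : vsval (Mrho_mul u v) = vsval u *m vsval v.
Proof.
rewrite vsprojK //.
have [a [b [c [d ->]]]] := vsval_Mrho u.
have [a' [b' [c' [d' ->]]]] := vsval_Mrho v.
by rewrite MmxM Mmx_mem.
Qed.

Lemma vsval_Mrho_star u : vsval (Mrho_star u) = refl_mx (vsval u).
Proof.
rewrite vsprojK //; have [a [b [c [d ->]]]] := vsval_Mrho u.
by rewrite refl_Mmx Mmx_mem.
Qed.

Lemma Mmx_inj a b c d a' b' c' d' : Mmx a b c d = Mmx a' b' c' d' ->
  [/\ a = a', b = b', c = c' & d = d'].
Proof.
move=> /matrixP H; split.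
- by move: (H (inord 0) (inord 0)); rewrite !MmxE /= !inordK.
- by move: (H (inord 1) (inord 1)); rewrite !MmxE /= !inordK.
- by move: (H (inord 0) (inord 1)); rewrite !MmxE /= !inordK.
- by move: (H (inord 2) (inord 3)); rewrite !MmxE /= !inordK.
Qed.

Lemma Mrho_compE k u a b c d : vsval u = Mmx a b c d ->
  Mrho_comp k u <->
  [/\ 1%g != k -> a = 0 /\ b = 0, g != k -> c = 0 & tau g != k -> d = 0].
Proof.
move=> uE; rewrite /Mrho_comp (mem_Mrho_filter (fun x => x == k)) uE; split.
  by move=> [a' [b' [c' [d' [Pab Pc Pd /Mmx_inj [-> -> -> ->]]]]]].
by move=> [Pab Pc Pd]; exists a, b, c, d.
Qed.

Lemma vsval_MrhoZD x (u v : Mrho) :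
  vsval (x *: u + v) = x *: vsval u + vsval v.
Proof. exact: linearP. Qed.

Lemma vsval_Mrho_inj (u v : Mrho) : vsval u = vsval v -> u = v.
Proof. exact: val_inj. Qed.

Lemma Mrho_mulA : associative Mrho_mul.
Proof. by move=> u v w; apply: vsval_Mrho_inj; rewrite /= !vsval_Mrho_mul mulmxA. Qed.

Lemma Mrho_mul_linl v : linear (Mrho_mul^~ v).
Proof.
move=> x u w; apply: vsval_Mrho_inj.
by rewrite vsval_MrhoZD !vsval_Mrho_mul vsval_MrhoZD mulmxDl scalemxAl.
Qed.

Lemma Mrho_mul_linr u : linear (Mrho_mul u).
Proof.
move=> x v w; apply: vsval_Mrho_inj.
by rewrite vsval_MrhoZD !vsval_Mrho_mul vsval_MrhoZD mulmxDr scalemxAr.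
Qed.

Lemma Mrho_star_lin : linear Mrho_star.
Proof.
move=> x u v; apply: vsval_Mrho_inj.
rewrite vsval_MrhoZD !vsval_Mrho_star vsval_MrhoZD.
by apply/matrixP => i j; rewrite !mxE.
Qed.

Lemma Mrho_starM u v : Mrho_star (Mrho_mul u v) = Mrho_mul (Mrho_star v) (Mrho_star u).
Proof.
apply: vsval_Mrho_inj; rewrite vsval_Mrho_mul !vsval_Mrho_star vsval_Mrho_mul.
have [a [b [c [d ->]]]] := vsval_Mrho u.
have [a' [b' [c' [d' ->]]]] := vsval_Mrho v.
rewrite MmxM !refl_Mmx MmxM; congr Mmx; rewrite 1?[LHS]addrC.
- exact: mulrC.
- exact: mulrC.
- by rewrite mulrC [X in _ + X]mulrC.
- by rewrite mulrC [X in _ + X]mulrC.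
Qed.

Lemma Mrho_starK : involutive Mrho_star.
Proof.
move=> u; apply: vsval_Mrho_inj; rewrite !vsval_Mrho_star.
by apply/matrixP => i j; rewrite !mxE !rev_ordK.
Qed.

Lemma Mrho_comp0 k : Mrho_comp k 0.
Proof. by rewrite /Mrho_comp linear0 mem0v. Qed.

Lemma Mrho_compZD k x u v :
  Mrho_comp k u -> Mrho_comp k v -> Mrho_comp k (x *: u + v).
Proof. by rewrite /Mrho_comp vsval_MrhoZD => uk vk; rewrite memvD // memvZ. Qed.

Lemma Mrho_comp_direct v : exists! u : {ffun gT -> Mrho},
  (forall k, Mrho_comp k (u k)) /\ v = \sum_k u k.
Proof.
have [a [b [c [d vE]]]] := vsval_Mrho v.
pose w := [ffun k => vsproj Mrho_space (Mmx (a *+ (1%g == k)) (b *+ (1%g == k))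
  (c *+ (g == k)) (d *+ (tau g == k)))].
have wE k : vsval (w k) = Mmx (a *+ (1%g == k)) (b *+ (1%g == k))
  (c *+ (g == k)) (d *+ (tau g == k)) by rewrite ffunE vsprojK // Mmx_mem.
have sumE (f : gT -> Mrho) i j :
    vsval (\sum_k f k) i j = \sum_k vsval (f k) i j.
  by rewrite linear_sum /= summxE.
have sumb (x : F) h : \sum_k x *+ (h == k) = x.
  rewrite (bigD1 h) //= eqxx big1 ?addr0 // => k /negbTE kh.
  by rewrite eq_sym kh.
have comp_eq (u1 u2 : {ffun gT -> Mrho}) :
    (forall k, Mrho_comp k (u1 k)) -> (forall k, Mrho_comp k (u2 k)) ->
    \sum_k u1 k = \sum_k u2 k -> u1 = u2.
  move=> c1 c2 e; apply/ffunP => k; apply: vsval_Mrho_inj.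
  pose z h := u1 h - u2 h.
  have zc h : Mrho_comp h (z h).
    by rewrite /z addrC -scaleN1r; apply: Mrho_compZD.
  have z0 : \sum_h z h = 0 by rewrite sumrB e subrr.
  apply/eqP; rewrite -subr_eq0 -linearB; apply/eqP.
  have z0E i j : \sum_h vsval (z h) i j = 0.
    by rewrite -sumE z0 linear0 mxE.
  have one h0 i j : (forall h, h0 != h -> vsval (z h) i j = 0) ->
      forall h, vsval (z h) i j = 0.
    move=> H h; have [<-|/H //] := eqVneq h0 h.
    have := z0E i j; rewrite (bigD1 h0) //= big1 ?addr0 // => h' h'h.
    by rewrite H // eq_sym.
  have zP h h0 i j : (forall a b c d, vsval (z h) = Mmx a b c d ->
      h0 != h -> Mmx a b c d i j = 0) -> h0 != h -> vsval (z h) i j = 0.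
    move=> H nh; have [a1 [b1 [c1' [d1 zE]]]] := vsval_Mrho (z h).
    by rewrite zE; apply: H.
  apply/matrixP => i j; rewrite -/(z k) [RHS]mxE.
  pose h0 := match val i, val j with 0, 1 => g | 2, 3 => tau g | _, _ => 1%g end.
  apply: (one h0) => h; apply: zP => a1 b1 c1' d1 zE.
  have /(Mrho_compE _ zE) [Pab Pc Pd] := zc h.
  rewrite MmxE /h0; case: i j {h0} => [[|[|[|[|//]]]] ?] [[|[|[|[|//]]]] ?] //=;
  by [move=> /Pab [] | move=> /Pc | move=> /Pd].
exists w; split.
  split=> [k|].
    apply/(Mrho_compE _ (wE k)); split; do ?by move=> /negbTE ->.
  apply: vsval_Mrho_inj; apply/matrixP => i j; rewrite sumE vE MmxE.
  under eq_bigr do rewrite wE MmxE.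
  by case: i j => [[|[|[|[|//]]]] ?] [[|[|[|[|//]]]] ?] //=;
    rewrite ?sumb // big1.
move=> u [uc vu]; apply: comp_eq => //; last rewrite -vu.
  by move=> k; apply/(Mrho_compE _ (wE k)); split; do ?by move=> /negbTE ->.
apply: vsval_Mrho_inj; apply/matrixP => i j; rewrite sumE vE MmxE.
under eq_bigr do rewrite wE MmxE.
by case: i j => [[|[|[|[|//]]]] ?] [[|[|[|[|//]]]] ?] //=;
  rewrite ?sumb // big1.
Qed.

Lemma Mrho_compM h k u v :
  Mrho_comp h u -> Mrho_comp k v -> Mrho_comp (h * k)%g (Mrho_mul u v).
Proof.
have [a [b [c [d uE]]]] := vsval_Mrho u.
have [a' [b' [c' [d' vE]]]] := vsval_Mrho v.
move=> /(Mrho_compE _ uE) [Pab Pc Pd] /(Mrho_compE _ vE) [Pab' Pc' Pd'].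
have uvE := vsval_Mrho_mul u v; rewrite uE vE MmxM in uvE.
apply/(Mrho_compE _ uvE).
have prod0 (x y : F) r (H : 1%g != h -> x = 0) (K : r != k -> y = 0) :
    r != (h * k)%g -> x * y = 0.
  have [<-|/H -> _] := eqVneq 1%g h; last by rewrite mul0r.
  by rewrite mul1g => /K ->; rewrite mulr0.
have prod0' (x y : F) r (H : r != h -> x = 0) (K : 1%g != k -> y = 0) :
    r != (h * k)%g -> x * y = 0.
  have [<-|/K -> _] := eqVneq 1%g k; last by rewrite mulr0.
  by rewrite mulg1 => /H ->; rewrite mul0r.
have Ha nh := (Pab nh).1; have Hb nh := (Pab nh).2.
have Ha' nh := (Pab' nh).1; have Hb' nh := (Pab' nh).2.
split=> nhk.
- by split; [apply: prod0 Ha Ha' nhk | apply: prod0 Hb Hb' nhk].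
- by rewrite (prod0 _ _ _ Ha Pc' nhk) (prod0' _ _ _ Pc Hb' nhk) addr0.
- by rewrite (prod0 _ _ _ Hb Pd' nhk) (prod0' _ _ _ Pd Ha' nhk) addr0.
Qed.

Lemma Mrho_comp_star h u : Mrho_comp h u -> Mrho_comp (tau h) (Mrho_star u).
Proof.
have [a [b [c [d uE]]]] := vsval_Mrho u.
move=> /(Mrho_compE _ uE) [Pab Pc Pd].
have suE := vsval_Mrho_star u; rewrite uE refl_Mmx in suE.
have t1 : tau 1%g = 1%g.
  by apply: (mulgI (tau 1%g)); rewrite -ginvolM !mulg1.
apply/(Mrho_compE _ suE); split.
- by rewrite -{1}t1 (inj_eq (can_inj (ginvolK tau))).
- by rewrite -{1}(ginvolK tau g) (inj_eq (can_inj (ginvolK tau))).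
- by rewrite (inj_eq (can_inj (ginvolK tau))).
Qed.

Definition Mrho_alg : gstar_alg tau Mrho :=
  GStarAlg Mrho_mulA Mrho_mul_linl Mrho_mul_linr Mrho_star_lin Mrho_starM
    Mrho_starK Mrho_comp0 Mrho_compZD Mrho_comp_direct Mrho_compM
    Mrho_comp_star.

End MatrixAlgebra.

Inductive excluded_alg (F : fieldType) (gT : finGroupType)
    (tau : group_involution gT) :
    forall W : lmodType F, gstar_alg tau W -> Prop :=
| Excl_FC2_star : excluded_alg (FC2_star F tau)
| Excl_Mrho g : excluded_alg (Mrho_alg F tau g)
| Excl_FC_tau p h (p_pr : prime p) (p_dvd : (p %| #|[set: gT]|)%N)
    (oh : #[h]%g = p) (th : tau h = h \/ tau h = h^-1%g) :
    excluded_alg (FC_tau F th)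
| Excl_FC2_star_s s (G_even : ~~ odd #|[set: gT]|)
    (os : #[s]%g = 2%N) (ts : tau s = s) :
    excluded_alg (FC2_star_s F os ts).

(* Main.v *)
Require Import Defs.
From Stdlib Require Import Reals Lra Classical ClassicalEpsilon.
From HB Require Import structures.
From mathcomp Require Import all_boot all_order all_fingroup all_algebra.
From mathcomp Require Import all_solvable all_field finmap monalg zify.

Set Implicit Arguments.
Unset Strict Implicit.
Unset Printing Implicit Defensive.
Import GRing.Theory VectorInternalTheory.
Local Open Scope ring_scope.

(** Let [R] be [A] with a unit adjoined.  The arguments rest on the linear form
    [atr x], the trace of left plus right multiplication by [x] on [R], and on
    its radical, the [x] with [atr (x * y) = 0] for all [y].  The form is
    invariant under the involution and vanishes on components of degree other
    than 1, so the radical is a star-stable ideal; in characteristic 0 an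
    idempotent of trace 0 is 0, and by Fitting's lemma an element that is not
    nilpotent has a nonzero idempotent among its polynomials without constant
    term.  Hence the radical is nil, and therefore nilpotent.

    If no excluded algebra is in the variety, take a maximal family of
    orthogonal symmetric idempotents [e i] of degree 1.
    - Some [x != 0] in [e i * A * e j] with [i != j] would give an algebra
      [Mrho_alg]: over the dual numbers, [e i], [e j], [t x] and [t x^*] have
      its multiplication table ([Mrho_in_var]).
    - By maximality the symmetric elements of degree 1 are nilpotent in the
      corner of [1 - \sum_i e i], and are a scalar plus a nilpotent in the
      corner of [e i].  Skew elements have trace 0.  As the trace is linear,
      this puts the first corner into the radical ([compl_mul_in_rad]), and, by
      polarizing squares, the elements of degree 1 of the second into the sum
      of [F *: e i] and the radical ([corner1_scalar]); the only obstruction is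
      a skew [k] with [k * k] a nonzero scalar, that is, [FC2_star].
    - An element [x] of degree [g != 1] in the corner of [e i] that is not
      radical is invertible modulo the radical.  A power of [x^* * x], or of [x]
      when [tau g = g^-1], then has prime order in the group and generates a
      copy of [FC_tau] or [FC2_star_s] ([corner_neq1_in_rad]).

    So [A] is spanned by the [e i] modulo the radical
    ([excluded_free_structure]).

    A word evaluated at such elements vanishes as soon as it contains many
    radical letters or two distinct [e i].  Identities of degree [n] are
    therefore tested on polynomially many evaluations, and these bound the
    codimension ([polynomial_codim_bound]).

    Conversely, every excluded algebra carries [2 ^ n] multilinear monomials of
    degree [n.+1] that suitable valuations tell apart ([excluded_growth]): each
    variable stores one bit, in its star, in its degree, or in its position
    relative to a distinguished variable.  If the variety contains one of them,
    the codimensions of [A] are at least as large. *)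

(** * Trace, idempotents and radical of a finite-dimensional algebra *)

(** All eigenvalues are 0, so the characteristic polynomial is a power of ['X],
    and the trace is one of its coefficients up to sign. *)
Lemma mxtrace_nilpotent (F : closedFieldType) n (M : 'M[F]_n) k :
  M ^+ k = 0 -> \tr M = 0.
Proof.
case: n M => [M _|n M Mk]; first by rewrite /mxtrace big_ord0.
have [r rE] := closed_field_poly_normal (char_poly M).
rewrite (monicP (char_poly_monic M)) scale1r in rE.
have r0 x : x \in r -> x = 0.
  move=> xr; have : root (char_poly M) x by rewrite rE root_prod_XsubC.
  rewrite -eigenvalue_root_char => /eigenvalueP [v vM v0].
  have : v *m M ^+ k = x ^+ k *: v.
    elim: (k) => [|j IHj]; first by rewrite !expr0 mulmx1 scale1r.
    by rewrite !exprS mulmxA vM -scalemxAl IHj scalerA.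
  rewrite Mk mulmx0 => /esym /eqP; rewrite scaler_eq0 (negPf v0) orbF.
  by rewrite expf_eq0 => /andP [_ /eqP].
have {}rE : char_poly M = 'X^(size r).
  rewrite rE big_seq (eq_bigr (fun=> 'X)) ?polyC0 => [|x /r0 ->]; last first.
    by rewrite polyC0 subr0.
  by rewrite -big_seq big_const_seq count_predT iter_mulr_1.
have sr : size r = n.+1.
  by have := size_char_poly M; rewrite rE size_polyXn => -[].
apply/eqP; rewrite -oppr_eq0 -char_poly_trace // rE coefXn sr /=.
by rewrite (ltn_eqF (ltnSn n)).
Qed.

(** In a full rank factorization [M = C *m B] of an idempotent, [B *m C] is the
    identity matrix of size the rank. *)
Lemma mxtrace_idempotent (F : fieldType) n (M : 'M[F]_n) :
  M *m M = M -> \tr M = (\rank M)%:R.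
Proof.
move=> MM; rewrite -{1}(mulmx_base M) mxtrace_mulC.
suff -> : row_base M *m col_base M = 1%:M by rewrite mxtrace1.
have /row_freeP [C rC] := row_base_free M.
have /row_fullP [D cD] := col_base_full M.
move: MM; rewrite -{1 2 3}(mulmx_base M).
move: (col_base M) (row_base M) cD rC => cM rM cD rC.
move=> /(congr1 (fun X => D *m X *m C)).
by rewrite !mulmxA cD mul1mx -!mulmxA rC !mulmx1.
Qed.

Section RegularTrace.
Context (F : closedFieldType) (R : falgType F).
Implicit Types (a b : R) (f g : 'End(R)).

Definition ltr f : F := \tr (f2mx f).

Lemma f2mxE f u : v2r (f u) = v2r u *m f2mx f.
Proof. by rewrite unlock /= r2vK. Qed.

Lemma f2mx_comp f g : f2mx (g \o f)%VF = f2mx f *m f2mx g.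
Proof.
apply/row_matrixP => i; rewrite !rowE mulmxA.
by rewrite -[delta_mx _ _]r2vK -!f2mxE comp_lfunE.
Qed.

Lemma ltrC f g : ltr (f \o g)%VF = ltr (g \o f)%VF.
Proof. by rewrite /ltr !f2mx_comp mxtrace_mulC. Qed.

Lemma ltr_is_linear : scalar ltr.
Proof.
move=> c f g; rewrite /ltr -mxtraceZ -mxtraceD; congr (\tr _).
apply/row_matrixP => i; rewrite linearP /= !rowE -[delta_mx _ _]r2vK -!f2mxE.
by rewrite add_lfunE scale_lfunE linearP.
Qed.
HB.instance Definition _ := GRing.isLinear.Build F 'End(R) F *%R ltr
  ltr_is_linear.

(** Left and right multiplications are added up so that an involution of [R],
    which exchanges them, preserves the trace. *)
Definition atr a : F := ltr (amull a) + ltr (amulr a).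

Lemma atr_is_linear : scalar atr.
Proof.
move=> c a b; rewrite /atr !linearP /= addrACA.
by rewrite -mulrDr.
Qed.
HB.instance Definition _ := GRing.isLinear.Build F R F *%R atr atr_is_linear.

Lemma amull_comp a b : amull (a * b) = (amull a \o amull b)%VF.
Proof. by apply/lfunP => u; rewrite comp_lfunE !lfunE /= mulrA. Qed.

Lemma amulr_comp a b : amulr (a * b) = (amulr b \o amulr a)%VF.
Proof. by apply/lfunP => u; rewrite comp_lfunE !lfunE /= mulrA. Qed.

Lemma atrC a b : atr (a * b) = atr (b * a).
Proof.
by rewrite /atr !amull_comp !amulr_comp ltrC [ltr (amulr b \o _)]ltrC.
Qed.

Lemma f2mx_amullX a k : f2mx (amull (a ^+ k.+1)) = f2mx (amull a) ^+ k.+1.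
Proof.
elim: k => [|k IHk] //.
by rewrite [RHS]exprS -IHk exprSr amull_comp f2mx_comp.
Qed.

Lemma f2mx_amulrX a k : f2mx (amulr (a ^+ k.+1)) = f2mx (amulr a) ^+ k.+1.
Proof.
elim: k => [|k IHk] //.
by rewrite [RHS]exprS -IHk exprS amulr_comp f2mx_comp.
Qed.

Lemma atr_nilpotent a k : a ^+ k = 0 -> atr a = 0.
Proof.
move=> ak; have ak1 : a ^+ k.+1 = 0 by rewrite exprS ak mulr0.
have f0 : f2mx (0 : 'End(R)) = 0.
  by apply/row_matrixP => i;
    rewrite !rowE -[delta_mx _ _]r2vK -f2mxE !(lfunE, linear0) ?mulmx0 ?linear0.
have Lk := f2mx_amullX a k; have Rk := f2mx_amulrX a k.
rewrite /atr /ltr (mxtrace_nilpotent (k := k.+1)).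
  by rewrite add0r (mxtrace_nilpotent (k := k.+1)) // -Rk ak1 linear0 f0.
by rewrite -Lk ak1 linear0 f0.
Qed.

Lemma atr_idempotent a : [pchar F] =i pred0 ->
  a * a = a -> a != 0 -> atr a != 0.
Proof.
move=> F0 aa a0; rewrite /atr /ltr.
have Ll : f2mx (amull a) *m f2mx (amull a) = f2mx (amull a).
  by rewrite -f2mx_comp -amull_comp aa.
have Lr : f2mx (amulr a) *m f2mx (amulr a) = f2mx (amulr a).
  by rewrite -f2mx_comp -amulr_comp aa.
rewrite !mxtrace_idempotent // -natrD (proj1 (pcharf0P F) F0) addn_eq0
  mxrank_eq0.
apply: contra_neqN a0 => /andP [/eqP L0 _].
have := f2mxE (amull a) 1; rewrite L0 mulmx0 lfunE /= mulr1 => va.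
by apply: (can_inj v2rK); rewrite va linear0.
Qed.

End RegularTrace.

Lemma dependent_family (F : fieldType) (V : vectType F) (X : finType)
    (v : X -> V) : (\dim {:V} < #|X|)%N ->
  exists c : X -> F, \sum_x c x *: v x = 0 /\ exists x, c x != 0.
Proof.
move=> lt; pose s := [tuple v (enum_val i) | i < #|X|].
have sE (i : 'I_#|X|) : s`_i = v (enum_val i) by rewrite -tnth_nth tnth_mktuple.
apply: NNPP => nc; suff : free s.
  rewrite /free size_tuple => /eqP sd.
  by have := dimvS (subvf <<s>>%VS); rewrite sd leqNgt lt.
apply/freeP => c cs i; apply/eqP; apply: contra_notT nc => ci.
exists (c \o enum_rank); split; last by exists (enum_val i);
  rewrite /= enum_valK.
rewrite -[RHS]cs (reindex _ (onW_bij _ (@enum_val_bij X))) /=.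
by apply: eq_bigr => j _; rewrite /= enum_valK sE.
Qed.

Lemma exists_annihilator (F : fieldType) (R : falgType F) (a : R) :
  exists2 m : {poly F}, m != 0 & horner_alg a m = 0.
Proof.
pose n := (\dim {:R}).+1.
have [|c [cs [i ci]]] := @dependent_family _ _ 'I_n (fun i => a ^+ i).
  by rewrite card_ord.
exists (\poly_(i < n) c (inord i)).
  apply/eqP => /polyP /(_ i); rewrite coef_poly ltn_ord inord_val coef0.
  exact/eqP.
rewrite poly_def linear_sum -[RHS]cs; apply: eq_bigr => j _ /=.
by rewrite linearZ /= rmorphXn /= horner_algX inord_val mulr_algl.
Qed.

(** Fitting's lemma: if ['X^k * q] annihilates [a] and [q 0 != 0], then a
    Bezout relation between ['X^(k.+1)] and [q] yields a polynomial that is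
    idempotent at [a], and whose vanishing at [a] forces [a ^+ k = 0]. *)
Lemma fitting_idempotent (F : fieldType) (R : falgType F) (a : R) :
  (exists k, a ^+ k = 0) \/
  exists p : {poly F}, let f := a * horner_alg a p in f * f = f /\ f != 0.
Proof.
have [m m0 ma] := exists_annihilator a.
have [k [q q0 mE]] := multiplicity_XsubC m 0.
rewrite m0 /= in q0; rewrite polyC0 subr0 in mE.
have cop : coprimep 'X^(k.+1) q.
  by rewrite coprimep_expl // coprimep_sym coprimepX.
have /Bezout_eq1_coprimepP [[u v] /= uv] := cop.
pose f := horner_alg a (u * 'X^(k.+1)).
have aX n : horner_alg a ('X^n) = a ^+ n by rewrite rmorphXn /= horner_algX.
have qa : horner_alg a (q * 'X^k) = 0 by rewrite -mE.
have fE : a * horner_alg a (u * 'X^k) = f.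
  rewrite -[X in X * _](horner_algX a) -rmorphM /= /f exprS.
  by rewrite mulrCA.
have f1 : 1 - f = horner_alg a (v * q).
  by rewrite -[1](rmorph1 (horner_alg a)) -uv rmorphD /= addrAC subrr add0r.
have ff : f * (1 - f) = 0.
  rewrite f1 -rmorphM /= exprSr.
  have -> : u * ('X^k * 'X) * (v * q) = (u * 'X * v) * (q * 'X^k).
    by rewrite -!mulrA; congr (u * _); rewrite mulrC -!mulrA; congr ('X * _);
       rewrite -!mulrA.
  by rewrite rmorphM /= qa mulr0.
have [f0|f0] := eqVneq f 0; [left; exists k | right; exists (u * 'X^k)].
  have : a ^+ k * (1 - f) = 0.
    by rewrite f1 -aX -rmorphM mulrCA [_ * q]mulrC rmorphM /= qa mulr0.
  by rewrite f0 subr0 mulr1.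
rewrite /= fE; split=> //; apply/eqP; rewrite -subr_eq0 -oppr_eq0 opprB.
by rewrite -{1}[f]mulr1 -mulrBr ff.
Qed.

(** Subspaces given by a proposition, such as homogeneous components, are
    reached by enlarging a subspace until the dimension blocks. *)
Lemma vspace_of_closed (F : fieldType) (V : vectType F) (P : V -> Prop) :
    P 0 -> (forall c u v, P u -> P v -> P (c *: u + v)) ->
  exists U : {vspace V}, forall x, x \in U <-> P x.
Proof.
move=> P0 PZD.
have step k : (exists U : {vspace V}, forall x, x \in U <-> P x) \/
    exists U : {vspace V}, (forall x, x \in U -> P x) /\ (k <= \dim U)%N.
  elim: k => [|k [|[U [UP kU]]]]; [|by left|].
    by right; exists 0%VS; split=> // x; rewrite memv0 => /eqP ->.
  have [|nUE] := classic (forall x, P x -> x \in U).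
    by left; exists U => x; split; auto.
  have [x nx] := not_all_ex_not _ _ nUE.
  have [Px /negP xU] := imply_to_and _ _ nx.
  right; exists (U + <[x]>)%VS; split.
    by move=> _ /memv_addP [u /UP Pu [_ /vlineP [c ->] ->]]; rewrite addrC;
      auto.
  apply: leq_ltn_trans kU _; rewrite (ltn_leqif (dimv_leqif_sup (addvSl _ _))).
  by rewrite subv_add subvv -memvE.
have [//|[U [_ le]]] := step (\dim {:V}).+1.
by have := leq_trans le (dimvS (subvf U)); rewrite ltnn.
Qed.

(** The powers of [J] stabilize at some [I] with [I * I = I].  Unless [I = 0],
    take [u] with [I * u] nonzero of least dimension: some [w] in [I * u] has
    [I * w = I * u], so [w = a * w] for a nilpotent [a], and [w = 0]. *)
Lemma nil_ideal_nilpotent (F : fieldType) (R : falgType F) (J : {vspace R}) :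
    (J * J <= J)%VS -> (forall a, a \in J -> exists k, a ^+ k = 0) ->
  exists k, (J ^+ k.+1 = 0)%VS.
Proof.
move=> JJ nilJ.
have leS k : (J ^+ k.+2 <= J ^+ k.+1)%VS.
  elim: k => [|k IHk]; first by rewrite expv2 expv1.
  by rewrite expvSl [X in (_ <= X)%VS]expvSl prodvSr.
have [k kE] : exists k, (J ^+ k.+2 = J ^+ k.+1)%VS.
  apply: NNPP => nE.
  have lt k : (\dim (J ^+ k.+1)%VS + k <= \dim J)%N.
    elim: k => [|k IHk]; first by rewrite expv1 addn0.
    apply: leq_trans IHk; rewrite addnS ltn_add2r ltn_neqAle dimvS // andbT.
    apply/negP => /eqP dE; apply: nE; exists k; apply/eqP.
    by rewrite eqEdim leS dE leqnn.
  by have := lt (\dim J).+1; rewrite addnS ltnNge leq_addl.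
pose I := (J ^+ k.+1)%VS.
have IE m : (J ^+ (k.+1 + m) = I)%VS.
  elim: m => [|m IHm]; first by rewrite addn0.
  by rewrite addnS expvSl IHm -expvSl kE.
have II : (I * I = I)%VS by rewrite -expvD IE.
have IJ : (I <= J)%VS.
  rewrite /I; elim: (k) => [|m IHm]; first by rewrite expv1.
  exact: subv_trans (leS m) IHm.
exists k; apply/eqP; rewrite -/I; apply/negPn/negP => I0.
have ne0 (U : {vspace R}) : (I * U != 0)%VS ->
    exists2 u, u \in U & (I * <[u]> != 0)%VS.
  move=> IU; apply: NNPP => nu; case/negP: IU; rewrite -subv0.
  apply/prodvP => a u aI uU; apply: contra_notT nu; rewrite memv0 => au0.
  exists u => //; apply: contra_neqN au0 => /eqP Iu; apply/eqP.
  by rewrite -memv0 -Iu memv_mul // memv_line.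
have [u Iu min] : exists2 u, (I * <[u]> != 0)%VS & forall w,
    (I * <[w]> != 0)%VS -> (\dim (I * <[u]>)%VS <= \dim (I * <[w]>)%VS)%N.
  apply: NNPP => nmin.
  have big n w : (I * <[w]> != 0)%VS -> (n <= \dim (I * <[w]>)%VS)%N.
    elim: n w => [//|n IHn] w Iw; rewrite ltnNge; apply/negP => le.
    apply: nmin; exists w => // v Iv; apply: leq_trans le _; exact: IHn.
  have /ne0 [w _ Iw] : (I * I != 0)%VS by rewrite II.
  by have := big (\dim {:R}).+1 w Iw; rewrite ltnNge dimvS ?subvf.
have /ne0 [w wU Iw] : (I * (I * <[u]>) != 0)%VS by rewrite prodvA II.
have wE : (I * <[w]> = I * <[u]>)%VS.
  apply/eqP; rewrite eqEdim min // andbT.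
  by rewrite -[X in (_ <= X * _)%VS]II -prodvA prodvSr // -memvE.
have : w \in (amulr w @: I)%VS.
  have /subvP : (I * <[w]> <= amulr w @: I)%VS; last by apply; rewrite wE.
  apply/prodvP => a v aI /vlineP [c ->]; apply/memv_imgP.
  by exists (c *: a); rewrite ?memvZ // lfunE /= -scalerAl -scalerAr.
move=> /memv_imgP [a aI]; rewrite lfunE /= => waw.
have [n an] := nilJ a (subvP IJ a aI).
have w0 : w = 0.
  have wn m : w = a ^+ m * w.
    by elim: m => [|m IHm]; rewrite ?mul1r // exprS -mulrA -IHm.
  by rewrite (wn n) an mul0r.
case/negP: Iw; rewrite w0 -subv0; apply/prodvP => b v _ /vlineP [c ->].
by rewrite scaler0 mulr0 mem0v.
Qed.

Section TraceRadical.
Context (F : closedFieldType) (F0 : [pchar F] =i pred0) (R : falgType F).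
Implicit Types (a b : R).

Definition in_rad a : Prop := forall b, atr (a * b) = 0.

Lemma in_rad0 : in_rad 0.
Proof. by move=> b; rewrite mul0r linear0. Qed.

Lemma in_radZD c a b : in_rad a -> in_rad b -> in_rad (c *: a + b).
Proof.
by move=> ra rb d; rewrite mulrDl -scalerAl linearP /= ra rb mulr0 addr0.
Qed.

Lemma in_radMr a b : in_rad a -> in_rad (a * b).
Proof. by move=> ra d; rewrite -mulrA. Qed.

Lemma in_radMl a b : in_rad b -> in_rad (a * b).
Proof. by move=> rb d; rewrite -mulrA atrC -mulrA. Qed.

Lemma in_rad_atr a : in_rad a -> atr a = 0.
Proof. by move=> ra; rewrite -[a]mulr1. Qed.

(** The Fitting idempotent of [a] is a multiple of [a], so its trace is 0. *)
Lemma in_rad_nilpotent a : in_rad a -> exists k, a ^+ k = 0.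
Proof.
move=> ra; have [//|[p [pp p0]]] := fitting_idempotent a.
by have := atr_idempotent F0 pp p0; rewrite ra eqxx.
Qed.

(** The radical is a nilpotent ideal [U], and a product with [m] factors marked
    by [P] lies in [fullv * U ^+ m]. *)
Lemma in_rad_prod : exists q, forall (T : Type) (x : T -> R) (P : pred T) s,
  (forall t, P t -> in_rad (x t)) -> (q <= count P s)%N ->
  \prod_(t <- s) x t = 0.
Proof.
have [U UE] := vspace_of_closed in_rad0 in_radZD.
have [q Uq] : exists q, (U ^+ q.+1 = 0)%VS.
  apply: nil_ideal_nilpotent => [|a /UE]; last exact: in_rad_nilpotent.
  by apply/prodvP => a b _ /UE rb; apply/UE; apply: in_radMl.
exists q.+1 => T x P s xU qs.
suff : \prod_(t <- s) x t \in (fullv * U ^+ (count P s))%VS.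
  by rewrite -(subnKC qs) expvD Uq prod0v prodv0 memv0 => /eqP.
elim: s {qs} => [|t s IHs].
  by rewrite big_nil -[1]mulr1 /= expv0 memv_mul ?memvf ?memv_line.
(* the ideal U absorbs the factors of the product that are not marked *)
rewrite big_cons /=; case: (boolP (P t)) => [/xU /UE tU|_]; last first.
  have /subvP : (fullv * (fullv * U ^+ count P s) <= fullv * U ^+ count P s)%VS.
    by rewrite prodvA prodvSl ?subvf.
  by rewrite add0n; apply; rewrite memv_mul ?memvf.
have /subvP : (U * (fullv * U ^+ count P s) <= fullv * U ^+ (count P s).+1)%VS.
  rewrite expvSl 2!prodvA prodvSl //.
  have UU : (U * fullv <= U)%VS.
    by apply/prodvP => a b /UE ra _; apply/UE; apply: in_radMr.
  apply: (subv_trans UU).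
  by apply/subvP => a aU; rewrite -[a]mul1r memv_mul ?memvf.
by rewrite add1n; apply; rewrite memv_mul.
Qed.

End TraceRadical.

(** * Adjoining a unit *)

Section GStarTheory.
Context (F : fieldType) (gT : finGroupType) (tau : group_involution gT).
Context (V : lmodType F) (A : gstar_alg tau V).

Lemma gmulDl u v w : gmul A (u + v) w = gmul A u w + gmul A v w.
Proof. by have := gmul_linl A w 1 u v; rewrite !scale1r. Qed.

Lemma gmul0l w : gmul A 0 w = 0.
Proof. by apply: (addIr (gmul A 0 w)); rewrite -gmulDl !add0r. Qed.

Lemma gmulZl c u w : gmul A (c *: u) w = c *: gmul A u w.
Proof. by have := gmul_linl A w c u 0; rewrite gmul0l !addr0. Qed.

Lemma gmulDr u v w : gmul A w (u + v) = gmul A w u + gmul A w v.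
Proof. by have := gmul_linr A w 1 u v; rewrite !scale1r. Qed.

Lemma gmul0r w : gmul A w 0 = 0.
Proof. by apply: (addIr (gmul A w 0)); rewrite -gmulDr !add0r. Qed.

Lemma gmulZr c u w : gmul A w (c *: u) = c *: gmul A w u.
Proof. by have := gmul_linr A w c u 0; rewrite gmul0r !addr0. Qed.

Lemma gstarD u v : gstar A (u + v) = gstar A u + gstar A v.
Proof. by have := gstar_lin A 1 u v; rewrite !scale1r. Qed.

Lemma gstar0 : gstar A 0 = 0.
Proof. by apply: (addIr (gstar A 0)); rewrite -gstarD !add0r. Qed.

Lemma gstarZ c u : gstar A (c *: u) = c *: gstar A u.
Proof. by have := gstar_lin A c u 0; rewrite gstar0 !addr0. Qed.

Lemma ginvol1 : tau 1%g = 1%g.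
Proof. by apply: (mulgI (tau 1%g)); rewrite -ginvolM !mulg1. Qed.

End GStarTheory.

(** The algebra with a unit adjoined: all computations of products take place
    there, and [A] is the ideal of the pairs with first component 0. *)
Definition unitz (F : fieldType) (gT : finGroupType) (tau : group_involution gT)
  (V : vectType F) (A : gstar_alg tau V) : Type := (F^o * V)%type.

Section Unitization.
Context (F : fieldType) (gT : finGroupType) (tau : group_involution gT).
Context (V : vectType F) (A : gstar_alg tau V).

HB.instance Definition _ := Vector.copy (unitz A) (F^o * V)%type.

Definition unitz_one : unitz A := (1, 0).
Definition unitz_mul (x y : unitz A) : unitz A :=
  (x.1 * y.1, x.1 *: y.2 + y.1 *: x.2 + gmul A x.2 y.2).

Lemma unitz_mulA : associative unitz_mul.
Proof.
move=> [a u] [b v] [c w]; rewrite /unitz_mul /= mulrA; congr (_, _).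
rewrite !scalerDr !(gmulDl, gmulDr, gmulZl, gmulZr) gmulA !scalerA.
rewrite -!addrA [c * a]mulrC [c * b]mulrC; congr (_ + (_ + _)).
rewrite [LHS]addrCA; congr (_ + _).
by rewrite [RHS]addrCA; congr (_ + _); rewrite addrCA.
Qed.

Lemma unitz_mul1l : left_id unitz_one unitz_mul.
Proof.
move=> [a u]; rewrite /unitz_mul /= mul1r scale1r scaler0 gmul0l.
by rewrite !addr0.
Qed.

Lemma unitz_mul1r : right_id unitz_one unitz_mul.
Proof.
move=> [a u]; rewrite /unitz_mul /= mulr1 scale1r scaler0 gmul0r.
by rewrite add0r addr0.
Qed.

Lemma unitz_mulDl : left_distributive unitz_mul +%R.
Proof.
move=> [a u] [b v] [c w]; rewrite /unitz_mul /=; congr (_, _) => /=.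
  by rewrite mulrDl.
rewrite gmulDl scalerDl scalerDr.
by rewrite [RHS]addrACA; congr (_ + _); rewrite addrACA.
Qed.

Lemma unitz_mulDr : right_distributive unitz_mul +%R.
Proof.
move=> [a u] [b v] [c w]; rewrite /unitz_mul /=; congr (_, _) => /=.
  by rewrite mulrDr.
rewrite gmulDr scalerDl scalerDr.
by rewrite [RHS]addrACA; congr (_ + _); rewrite addrACA.
Qed.

Lemma unitz_one_neq0 : unitz_one != 0.
Proof. by rewrite xpair_eqE negb_and oner_eq0. Qed.

HB.instance Definition _ := GRing.Zmodule_isNzRing.Build (unitz A)
  unitz_mulA unitz_mul1l unitz_mul1r unitz_mulDl unitz_mulDr unitz_one_neq0.

Lemma unitz_scaleAl (c : F) (x y : unitz A) : c *: (x * y) = (c *: x) * y.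
Proof.
case: x y => [a u] [b v]; congr (_, _) => /=; first by rewrite scalerAl.
by rewrite !scalerDr !scalerA gmulZl [c * b]mulrC.
Qed.
HB.instance Definition _ := GRing.Lmodule_isLalgebra.Build F (unitz A)
  unitz_scaleAl.

Lemma unitz_scaleAr (c : F) (x y : unitz A) : c *: (x * y) = x * (c *: y).
Proof.
case: x y => [a u] [b v]; congr (_, _) => /=; first by rewrite scalerAr.
by rewrite !scalerDr !scalerA gmulZr [c * a]mulrC.
Qed.
HB.instance Definition _ := GRing.Lalgebra_isAlgebra.Build F (unitz A)
  unitz_scaleAr.
HB.instance Definition _ := Algebra_isFalgebra.Build F (unitz A).

Implicit Types (x y : unitz A) (u v : V).

Definition uinj u : unitz A := (0, u).

Lemma uinj_linear : linear uinj.
Proof. by move=> c u v; congr (_, _) => /=; rewrite scaler0 addr0. Qed.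
HB.instance Definition _ := GRing.isLinear.Build F V (unitz A) *:%R uinj
  uinj_linear.

Lemma uinjM u v : uinj (gmul A u v) = uinj u * uinj v.
Proof. by congr (_, _) => /=; rewrite ?mulr0 // !scale0r !add0r. Qed.

Lemma uinj_inj : injective uinj.
Proof. by move=> u v []. Qed.

Definition ustar x : unitz A := (x.1, gstar A x.2).

Lemma ustar_linear : linear ustar.
Proof. by move=> c x y; congr (_, _); rewrite /= gstarD gstarZ. Qed.
HB.instance Definition _ := GRing.isLinear.Build F (unitz A) (unitz A) *:%R
  ustar
  ustar_linear.

Lemma ustarM x y : ustar (x * y) = ustar y * ustar x.
Proof.
congr (_, _) => /=; first by rewrite mulrC.
by rewrite !gstarD !gstarZ gstarM [_ *: _ + _ *: _]addrC.
Qed.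

Lemma ustar1 : ustar 1 = 1.
Proof. by congr (_, _); rewrite /= gstar0. Qed.

Lemma ustarK : involutive ustar.
Proof. by case=> a u; rewrite /ustar /= gstarK. Qed.

Lemma ustarX x n : ustar (x ^+ n) = ustar x ^+ n.
Proof. by elim: n => [|n IHn]; rewrite ?ustar1 // exprS ustarM IHn -exprSr. Qed.

Lemma ustar_uinj u : ustar (uinj u) = uinj (gstar A u).
Proof. by []. Qed.

(** The unit is excluded on purpose: degrees are those of [A], whereas 1 is
    only a device for computing. *)
Definition ghom g x : Prop := x.1 = 0 /\ gcomp A g x.2.

Lemma ghom_uinj g u : gcomp A g u -> ghom g (uinj u).
Proof. by []. Qed.

Lemma ghomE g x : ghom g x -> x = uinj x.2.
Proof. by case: x => a u [/= -> _]. Qed.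

Lemma ghom0 g : ghom g 0.
Proof. by split=> //; apply: gcomp0. Qed.

Lemma ghomZD g c x y : ghom g x -> ghom g y -> ghom g (c *: x + y).
Proof.
by move=> [x1 x2] [y1 y2]; split=> /=; rewrite ?x1 ?y1 ?scaler0 ?addr0 //;
  apply: gcompZD.
Qed.

Lemma ghomD g x y : ghom g x -> ghom g y -> ghom g (x + y).
Proof. by rewrite -{2}[x]scale1r; apply: ghomZD. Qed.

Lemma ghomZ g c x : ghom g x -> ghom g (c *: x).
Proof. by move=> hx; rewrite -[_ *: _]addr0; apply: ghomZD hx (ghom0 g). Qed.

Lemma ghomN g x : ghom g x -> ghom g (- x).
Proof. by rewrite -scaleN1r; apply: ghomZ. Qed.

Lemma ghomB g x y : ghom g x -> ghom g y -> ghom g (x - y).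
Proof. by move=> hx hy; apply: ghomD => //; apply: ghomN. Qed.

Lemma ghomM g h x y : ghom g x -> ghom h y -> ghom (g * h)%g (x * y).
Proof.
move=> hx hy; rewrite (ghomE hx) (ghomE hy) -uinjM; apply: ghom_uinj.
by apply: gcompM; [case: hx | case: hy].
Qed.

Lemma ghomX g x n : ghom g x -> ghom (g ^+ n.+1)%g (x ^+ n.+1).
Proof.
move=> hx; elim: n => [|n IHn]; first by rewrite expr1 expg1.
by rewrite expgS exprS; apply: ghomM.
Qed.

Lemma ghom_star g x : ghom g x -> ghom (tau g) (ustar x).
Proof. by move=> [x1 x2]; split=> //; apply: gcomp_star. Qed.

End Unitization.

(** * Trace and grading *)

Section GradedTrace.
Context (F : closedFieldType) (gT : finGroupType) (tau : group_involution gT).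
Context (V : vectType F) (A : gstar_alg tau V).
Local Notation R := (unitz A).
Implicit Types (x y : R) (u v : V) (g h : gT).

Definition gcomps v : {ffun gT -> V} :=
  proj1_sig (constructive_indefinite_description _ (gcomp_direct A v)).

Lemma gcompsP v g : gcomp A g (gcomps v g).
Proof.
by rewrite /gcomps; case: constructive_indefinite_description => w /= [[]].
Qed.

Lemma gcomps_sum v : v = \sum_g gcomps v g.
Proof.
by rewrite /gcomps; case: constructive_indefinite_description => w /= [[]].
Qed.

Lemma gcomps_unique v (w : {ffun gT -> V}) :
  (forall g, gcomp A g (w g)) -> v = \sum_g w g -> gcomps v = w.
Proof.
rewrite /gcomps => wh vE; case: constructive_indefinite_description => w' /=.
by case=> _; apply.
Qed.

Lemma gcomps_linear g : linear (gcomps^~ g).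
Proof.
move=> c u v; rewrite (@gcomps_unique _ [ffun h => c *: gcomps u h + gcomps v
  h]).
- by rewrite ffunE.
- by move=> h; rewrite ffunE; apply: gcompZD; apply: gcompsP.
- rewrite {1}[u]gcomps_sum {1}[v]gcomps_sum scaler_sumr -big_split /=.
  by apply: eq_bigr => h _; rewrite ffunE.
Qed.

Lemma gcomps_ghom g v h : gcomp A g v -> gcomps v h = if h == g then v else 0.
Proof.
move=> gv; rewrite (@gcomps_unique _ [ffun h => if h == g then v else 0]).
- by rewrite ffunE.
- by move=> k; rewrite ffunE; case: eqP => [->|_] //; exact: gcomp0.
- by under eq_bigr do rewrite ffunE; rewrite -big_mkcond big_pred1_eq.
Qed.

Definition uproj h x : R := (if h == 1%g then x.1 else 0, gcomps x.2 h).

Lemma uproj_linear h : linear (uproj h).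
Proof.
move=> c x y; congr (_, _) => /=; last exact: gcomps_linear.
by case: ifP; rewrite // scaler0 addr0.
Qed.
HB.instance Definition _ h :=
  GRing.isLinear.Build F R R *:%R (uproj h) (uproj_linear h).

Lemma uproj_ghom g h x : ghom g x -> h != g -> uproj h x = 0.
Proof.
move=> [x1 x2] /negbTE hg; congr (_, _) => /=; first by rewrite x1 if_same.
by rewrite (gcomps_ghom _ x2) hg.
Qed.

Lemma uproj_sum x : \sum_h uproj h x = x.
Proof.
apply/esym; rewrite {1}[x]surjective_pairing; apply/eqP.
have fE : (\sum_h uproj h x).1 = \sum_h (uproj h x).1 by apply: raddf_sum.
have sE : (\sum_h uproj h x).2 = \sum_h (uproj h x).2 by apply: raddf_sum.
rewrite [eqbRHS]surjective_pairing fE sE /= -gcomps_sum.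
by rewrite -big_mkcond big_pred1_eq.
Qed.

Lemma uproj_id h x : uproj h (uproj h x) = uproj h x.
Proof.
congr (_, _) => /=; first by case: eqP.
by rewrite (gcomps_ghom _ (gcompsP _ _)) eqxx.
Qed.

Lemma uprojMl g h x y : ghom g x -> g != 1%g -> uproj h (x * uproj h y) = 0.
Proof.
move=> hx g1; rewrite [x](ghomE hx).
apply: (@uproj_ghom (g * h));
  last by rewrite eq_sym -{2}[h]mul1g (inj_eq (mulIg _)).
have [h1|h1] := eqVneq h 1%g; last first.
  apply: ghomM; first by rewrite -(ghomE hx).
  by split; [rewrite /= (negbTE h1) | apply: gcompsP].
rewrite h1 mulg1; split; rewrite /= ?mul0r // scale0r add0r.
apply: gcompZD; first by case: hx.
by rewrite -[g in gcomp _ g _]mulg1; apply: gcompM; [case: hx|apply: gcompsP].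
Qed.

Lemma uprojMr g h x y : ghom g x -> g != 1%g -> uproj h (uproj h y * x) = 0.
Proof.
move=> hx g1; rewrite [x](ghomE hx).
apply: (@uproj_ghom (h * g));
  last by rewrite eq_sym -{2}[h]mulg1 (inj_eq (mulgI _)).
have [h1|h1] := eqVneq h 1%g; last first.
  apply: ghomM; last by rewrite -(ghomE hx).
  by split; [rewrite /= (negbTE h1) | apply: gcompsP].
rewrite h1 mul1g; split; rewrite /= ?mulr0 // scale0r addr0.
apply: gcompZD; first by case: hx.
by rewrite -[g in gcomp _ g _]mul1g; apply: gcompM; [apply: gcompsP|case: hx].
Qed.

(** The trace is the sum of the traces of the diagonal blocks. *)
Lemma ltr_off_diagonal (f : 'End(R)) :
  (forall h x, uproj h (f (uproj h x)) = 0) -> ltr f = 0.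
Proof.
move=> f0; pose P h := linfun (uproj h).
have -> : f = \sum_h (P h \o f)%VF.
  apply/lfunP => x; rewrite sum_lfunE -[LHS]uproj_sum; apply: eq_bigr => h _.
  by rewrite comp_lfunE lfunE.
rewrite linear_sum big1 //= => h _.
have -> : (P h \o f = P h \o (P h \o f))%VF.
  by apply/lfunP => x; rewrite !comp_lfunE !lfunE /= uproj_id.
rewrite ltrC (_ : _ \o _ = 0)%VF ?linear0 //.
by apply/lfunP => x; rewrite !comp_lfunE !lfunE /= f0.
Qed.

(** Multiplication by [x] permutes the components without fixing one. *)
Lemma atr_ghom g x : ghom g x -> g != 1%g -> atr x = 0.
Proof.
move=> hx g1; rewrite /atr !ltr_off_diagonal ?addr0 // => h y; rewrite lfunE /=.
  exact: uprojMr hx g1.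
exact: uprojMl hx g1.
Qed.

(** The involution conjugates left multiplication by [x] into right
    multiplication by [ustar x]. *)
Lemma atr_star x : atr (ustar x) = atr x.
Proof.
pose S := linfun (@ustar _ _ _ _ A).
have SS : (S \o S)%VF = \1%VF.
  by apply/lfunP => y; rewrite comp_lfunE !lfunE /= ustarK.
have conj f : ltr (S \o (f \o S))%VF = ltr f.
  by rewrite ltrC -comp_lfunA SS comp_lfun1r.
rewrite /atr addrC -(conj (amull x)) -(conj (amulr x)); congr (_ + _);
  by congr ltr; apply/lfunP => y; rewrite !comp_lfunE !lfunE /= ustarM ustarK.
Qed.

Lemma in_rad_star x : in_rad x -> in_rad (ustar x).
Proof.
by move=> rx y; rewrite -[y]ustarK -ustarM atr_star atrC rx.
Qed.

(** Since the trace vanishes outside the neutral component, being radical can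
    be tested on homogeneous elements of the inverse degree. *)
Lemma in_rad_ghom g x : ghom g x -> atr x = 0 ->
  (forall y, ghom g^-1 y -> atr (x * y) = 0) -> in_rad x.
Proof.
move=> hx x0 xy0; suff rA v : atr (x * uinj A v) = 0.
  move=> y; have -> : y = y.1 *: 1 + uinj A y.2.
    case: y => c v; congr (_, _) => /=; first by rewrite addr0;
      apply/esym/mulr1.
    by rewrite scaler0 add0r.
  by rewrite mulrDr linearD /= rA addr0 -scalerAr mulr1 linearZ /= x0 mulr0.
rewrite [v]gcomps_sum linear_sum mulr_sumr linear_sum big1 //= => h _.
have [->|hg] := eqVneq h g^-1%g; first exact: xy0 (ghom_uinj (gcompsP _ _)).
apply: atr_ghom (ghomM hx (ghom_uinj (gcompsP _ _))) _.
by apply: contra_neq hg => /eqP; rewrite -eq_invg_mul => /eqP <-.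
Qed.

End GradedTrace.

(** * Membership in a variety *)

Section Evaluation.
Context (F : fieldType) (gT : finGroupType) (tau : group_involution gT).
Context (V : vectType F) (A : gstar_alg tau V).

Lemma gword_eval_prod phi (w : seq (gvar gT)) : w != [::] ->
  uinj A (gword_eval A phi w) = \prod_(x <- w) uinj A (gvar_eval A phi x).
Proof.
case: w => [//|x w] _ /=; rewrite big_cons.
elim: w (gvar_eval A phi x) => [|y w IHw] a /=; first by rewrite big_nil mulr1.
by rewrite IHw uinjM big_cons mulrA.
Qed.

Lemma gword_eval_rcons (W : lmodType F) (Q : gstar_alg tau W) phi
    (w : seq (gvar gT)) y : w != [::] ->
  gword_eval Q phi (rcons w y) =
  gmul Q (gword_eval Q phi w) (gvar_eval Q phi y).
Proof. by case: w => [//|x w] _; rewrite /= map_rcons foldl_rcons. Qed.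

Lemma fmonom_neq_nil (m : {fmonom gvar gT}) : m != mone -> (m : seq _) != [::].
Proof. by rewrite -fm1. Qed.

End Evaluation.

Section VarietyMembership.
Context (F : fieldType) (gT : finGroupType) (tau : group_involution gT).
Context (V : vectType F) (A : gstar_alg tau V).
Context (W : lmodType F) (Q : gstar_alg tau W).
Local Notation R := (unitz A).

(** A variety is closed under powers, subalgebras and quotients: here [psi]
    embeds [Q] into the power [A^T], up to an ideal [N] of the subalgebra that
    its image generates. *)
Lemma in_gstar_var_family (T : Type) (psi : T -> W -> R)
    (N : (T -> R) -> Prop) :
    (forall t, linear (psi t)) ->
    (forall t g q, gcomp Q g q -> ghom g (psi t q)) ->
    (forall u v, u =1 v -> N u -> N v) ->
    N (fun=> 0) ->
    (forall c u v, N u -> N v -> N (fun t => c *: u t + v t)) ->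
    (forall u q, N u -> N (fun t => psi t q * u t)) ->
    (forall u q, N u -> N (fun t => u t * psi t q)) ->
    (forall u, N u -> N (fun t => ustar (u t))) ->
    (forall q q', N (fun t => psi t (gmul Q q q') - psi t q * psi t q')) ->
    (forall q, N (fun t => psi t (gstar Q q) - ustar (psi t q))) ->
    (forall q, N (psi^~ q) -> q = 0) ->
  in_gstar_var A Q.
Proof.
move=> psiL psiH Next N0 NZD NMl NMr Nstar psiM psiS psiI f [f0 fA].
have psi0 t : psi t 0 = 0.
  apply: (addIr (psi t 0)); have := psiL t 1 0 0.
  by rewrite !scale1r !addr0 add0r.
split=> // phi phiH; apply: psiI.
pose phi' t k g := (psi t (phi k g)).2.
have phi'E t k g : uinj A (phi' t k g) = psi t (phi k g).
  exact/esym/(ghomE (psiH t _ _ (phiH k g))).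
have ND u v : N u -> N v -> N (fun t => u t + v t).
  by move=> Nu Nv; apply: Next (NZD 1 _ _ Nu Nv) => t; rewrite scale1r.
have letter x : N (fun t =>
    psi t (gvar_eval Q phi x) - uinj A (gvar_eval A (phi' t) x)).
  rewrite /gvar_eval; case: x.2; last first.
    by apply: Next N0 => t; rewrite phi'E subrr.
  by apply: Next (psiS (phi x.1.1 x.1.2)) => t; rewrite -ustar_uinj phi'E.
have NMletter u x : N u -> N (fun t => u t * uinj A (gvar_eval A (phi' t) x)).
  move=> Nu; rewrite /gvar_eval; case: x.2; last first.
    by apply: Next (NMr _ (phi x.1.1 x.1.2) Nu) => t; rewrite phi'E.
  apply: Next (Nstar _ (NMl _ (phi x.1.1 x.1.2) (Nstar _ Nu))) => t.
  by rewrite ustarM ustarK -ustar_uinj phi'E.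
have word w : w != [::] -> N (fun t =>
    psi t (gword_eval Q phi w) - uinj A (gword_eval A (phi' t) w)).
  elim/last_ind: w => [//|w y IHw] _.
  have [->|w0] := eqVneq w [::]; first exact: letter.
  have := ND _ _ (psiM (gword_eval Q phi w) (gvar_eval Q phi y))
    (ND _ _ (NMl _ (gword_eval Q phi w) (letter y)) (NMletter _ y (IHw w0))).
  apply: Next => t; rewrite !gword_eval_rcons // uinjM mulrBr mulrBl.
  by rewrite !addrA !subrK.
have wsum (s : seq {fmonom gvar gT}) (c : {fmonom gvar gT} -> F) :
    (forall w, w \in s -> (w : seq _) != [::]) ->
    N (fun t => psi t (\sum_(w <- s) c w *: gword_eval Q phi w) -
       uinj A (\sum_(w <- s) c w *: gword_eval A (phi' t) w)).
  elim: s => [|w s IHs] sP.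
    by apply: Next N0 => t; rewrite !big_nil psi0 (linear0 (uinj A)) subr0.
  have ws : w \in w :: s by rewrite mem_head.
  have {}IHs := IHs (fun x xs => sP x (mem_behead (s := w :: s) xs)).
  apply: Next (NZD (c w) _ _ (word w (sP w ws)) IHs) => t.
  by rewrite !big_cons psiL linearP /= scalerBr opprD addrACA.
have := wsum (msupp f) (fun w => f@_w).
have ne w : w \in (msupp f : seq _) -> (w : seq _) != [::].
  rewrite -mcoeff_neq0 => fw; apply: fmonom_neq_nil.
  by apply: contra_neq fw => ->.
move=> /(_ ne); apply: Next => t.
rewrite -[\sum_(w <- _) _ *: gword_eval A _ _]/(geval A (phi' t) f) fA.
  by rewrite (linear0 (uinj A)) subr0.
by move=> k g; have [] := psiH t _ _ (phiH k g).
Qed.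

End VarietyMembership.

Section GroupAlgebraMembership.
Context (F : closedFieldType) (gT : finGroupType) (tau : group_involution gT).
Context (V : vectType F) (A : gstar_alg tau V).
Context (H : finGroupType) (deg : H -> gT) (theta : H -> H) (chi : H -> F).
Context (D : galg_data tau deg theta chi).

(** The elements [u y] span a group algebra modulo the radical.  They are
    independent there because the trace recovers each coefficient, as in the
    usual trace of a group algebra. *)
Lemma galg_in_var (u : H -> unitz A) :
    (forall y, ghom (deg y) (u y)) ->
    (forall y z, in_rad (u (y * z)%g - u y * u z)) ->
    (forall y, in_rad (chi y *: u (theta y) - ustar (u y))) ->
    (forall y, y != 1%g -> atr (u y) = 0) -> atr (u 1%g) != 0 ->
  in_gstar_var A (galg D).
Proof.
move=> uH uM uS u0 u1; have [dM tM tK cM ct c2 dt] := D.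
pose psi (_ : unit) (a : {ffun H -> F^o}) := \sum_y a y *: u y.
have rsum (I : finType) (c : I -> F) (x : I -> unitz A) :
    (forall i, in_rad (x i)) -> in_rad (\sum_i c i *: x i).
  move=> rx; elim/big_rec: _ => [|i y _ ry]; first exact: in_rad0.
  exact: in_radZD.
apply: (@in_gstar_var_family _ _ _ _ A _ _ unit psi (fun v => in_rad (v tt))).
- move=> t c a b; rewrite /psi scaler_sumr -big_split; apply: eq_bigr => y _ /=.
  by rewrite !ffunE scalerDl scalerA.
- move=> t g a aH; rewrite /psi; elim/big_rec: _ => [|y z _ hz].
    exact: ghom0.
  have [yg|/aH ay] := eqVneq (deg y) g; first by subst g; apply: ghomZD.
  by rewrite ay scale0r add0r.
- by move=> v w vw; rewrite /= vw.
- exact: in_rad0.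
- by move=> c v w; apply: in_radZD.
- by move=> v q; apply: in_radMl.
- by move=> v q; apply: in_radMr.
- by move=> v; apply: in_rad_star.
- move=> a b; rewrite /psi /=.
  pose v y := \sum_z b z *: (u (y * z)%g - u y * u z).
  have vE y : v y = \sum_z b z *: u (y * z)%g - u y * \sum_z b z *: u z.
    rewrite mulr_sumr -sumrB; apply: eq_bigr => z _.
    by rewrite scalerBr scalerAr.
  suff -> : \sum_y galg_mul a b y *: u y -
      (\sum_y a y *: u y) * (\sum_y b y *: u y) = \sum_y a y *: v y.
    by apply: (rsum) => y; apply: (rsum).
  under [RHS]eq_bigr do rewrite vE scalerBr.
  rewrite sumrB mulr_suml; congr (_ - _); last first.
    by apply: eq_bigr => y _; rewrite -scalerAl.
  under eq_bigr do rewrite ffunE scaler_suml.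
  rewrite exchange_big; apply: eq_bigr => y _ /=.
  rewrite (reindex_inj (mulgI y)) scaler_sumr; apply: eq_bigr => z _ /=.
  by rewrite mulKg scalerA.
- move=> a; rewrite /psi linear_sum /=.
  rewrite (reindex_inj (can_inj tK)) -sumrB.
  have -> : \sum_y (galg_star theta chi a (theta y) *: u (theta y) - ustar (a y
    *: u y)) =
      \sum_y a y *: (chi y *: u (theta y) - ustar (u y)).
    apply: eq_bigr => y _; rewrite ffunE !tK linearZ /= scalerBr scalerA.
    by rewrite mulrC.
  exact: rsum.
- move=> a ra; apply/ffunP => z; rewrite ffunE.
  have := ra (u z^-1%g); rewrite /psi mulr_suml linear_sum (bigD1 z) //=.
  have uE y : atr (u y * u z^-1%g) = atr (u (y * z^-1)%g).
    apply/eqP; rewrite eq_sym -subr_eq0 -linearB; apply/eqP.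
    exact: in_rad_atr.
  rewrite big1 ?addr0 => [|y yz]; last first.
    rewrite -scalerAl linearZ /= uE u0 ?mulr0 //.
    by apply: contra_neq yz => yz1; apply: (mulIg z^-1%g); rewrite yz1 mulgV.
  rewrite -scalerAl linearZ /= uE mulgV => /eqP.
  by rewrite mulf_eq0 (negbTE u1) orbF => /eqP.
Qed.

End GroupAlgebraMembership.

Section VectorPolynomials.
Context (F : fieldType) (V : vectType F).
Implicit Types (s : seq V) (u v : F -> V).

Definition vhorner s (t : F) : V := foldr (fun x acc => x + t *: acc) 0 s.

Definition vpoly u : Prop := exists s, u =1 vhorner s.

Lemma vpolyD c u v : vpoly u -> vpoly v -> vpoly (fun t => c *: u t + v t).
Proof.
move=> [s uE] [s' vE].
have [r rE] : vpoly (fun t => c *: vhorner s t + vhorner s' t); last first.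
  by exists r => t; rewrite uE vE rE.
elim: s s' {uE vE} => [|x s IHs] s'.
  by exists s' => t; rewrite scaler0 add0r.
have [y [s'' yE]] : exists y s'', vhorner s' =1 fun t => y + t *: vhorner s'' t.
  case: s' => [|y s'']; last by exists y, s''.
  by exists 0, [::] => t; rewrite scaler0 addr0.
have [r rE] := IHs s''; exists (c *: x + y :: r) => t /=.
by rewrite yE -rE !scalerDr !scalerA addrACA [c * t]mulrC.
Qed.

Lemma vpoly_shift u : vpoly u -> vpoly (fun t => t *: u t).
Proof. by move=> [s uE]; exists (0 :: s) => t; rewrite /= add0r uE. Qed.

Lemma vpoly_map (f : V -> V) u : linear f -> vpoly u -> vpoly (f \o u).
Proof.
move=> fL [s uE]; exists (map f s) => t; rewrite /= uE.
have f0 : f 0 = 0.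
  by apply: (addIr (f 0)); have := fL 1 0 0; rewrite !scale1r !addr0 add0r.
elim: s {uE} => [|x s /= <-] //=.
by rewrite addrC fL addrC.
Qed.

(** A polynomial function on an infinite field determines its coefficients. *)
Lemma vhorner_eq0 s : [pchar F] =i pred0 ->
  (forall t, vhorner s t = 0) -> forall i, s`_i = 0.
Proof.
move=> F0 s0 i; rewrite [s`_i](coord_vbasis (memvf _)) big1 // => j _.
pose l (x : V) : F := coord (vbasis {:V}) j x; rewrite -/(l _).
have pE t : (Poly (map l s)).[t] = l (vhorner s t).
  rewrite horner_Poly; elim: (s) => [|x r /= ->]; rewrite /l /= ?linear0 //.
  by rewrite linearD linearZ /= addrC mulrC.
suff p0 : Poly (map l s) = 0.
  have := coef_Poly (map l s) i; rewrite p0 coef0.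
  have [si|si] := ltnP i (size s); last first.
    by rewrite [s`_i](nth_default _ si) /l linear0 scale0r.
  by rewrite (nth_map 0) // => <-; rewrite scale0r.
apply/eqP; apply: contraT => /max_poly_roots max.
pose r := [seq n%:R : F | n <- iota 0 (size (Poly (map l s)))].
have : (size r < size (Poly (map l s)))%N.
  apply: max; first by apply/allP => x _; rewrite rootE pE s0 /l linear0.
  rewrite map_inj_in_uniq ?iota_uniq // => m n _ _ /eqP.
  wlog lemn : m n / (m <= n)%N => [wl|].
    have [|/ltnW] := leqP m n; first exact: wl.
    by move=> nm; rewrite eq_sym => mn; rewrite (wl n m).
  rewrite eq_sym -subr_eq0 -natrB // (proj1 (pcharf0P F) F0) subn_eq0 => nm.
  by apply/eqP; rewrite eqn_leq lemn.
by rewrite size_map size_iota ltnn.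
Qed.

End VectorPolynomials.

Section MrhoMembership.
Context (F : fieldType) (F0 : [pchar F] =i pred0) (gT : finGroupType).
Context (tau : group_involution gT) (V : vectType F) (A : gstar_alg tau V).
Local Notation R := (unitz A).

(** With [x = a * x * b] of degree [g], the elements [a], [b], [t *: x] and
    [t *: ustar x] multiply as the basis of [Mrho_alg] up to [t ^+ 2]; letting
    [t] vary over the infinite field isolates the terms of degree at most 1. *)
Lemma Mrho_in_var g (a b x : R) :
    ghom 1%g a -> ghom 1%g b -> ghom g x ->
    ustar a = a -> ustar b = b ->
    a * a = a -> b * b = b -> a * b = 0 -> b * a = 0 ->
    a * x = x -> x * b = x -> x != 0 ->
  in_gstar_var A (Mrho_alg F tau g).
Proof.
move=> ha hb hx sa sb aa bb ab ba ax xb x0.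
have xa : x * a = 0 by rewrite -xb -mulrA ba mulr0.
have bx : b * x = 0 by rewrite -ax mulrA ba mul0r.
pose y := ustar x.
have ya : y * a = y by rewrite /y -[in RHS]ax ustarM sa.
have byE : b * y = y by rewrite /y -[in RHS]xb ustarM sb.
have ay : a * y = 0 by rewrite /y -[X in X * _]sa -ustarM xa linear0.
have yb : y * b = 0 by rewrite /y -[X in _ * X]sb -ustarM bx linear0.
have hy : ghom (tau g) y by apply: ghom_star.
pose c i j (u : subvs_of (Mrho_space F tau g)) : F :=
  vsval u (inord i : 'I_4) (inord j : 'I_4).
pose p0 u := c 0%N 0%N u *: a + c 1%N 1%N u *: b.
pose p1 u := c 0%N 1%N u *: x + c 2%N 3%N u *: y.
pose psi t u := p0 u + t *: p1 u.
have cE u (al be ga de : F) : vsval u = Mmx al be ga de ->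
    [/\ c 0%N 0%N u = al, c 1%N 1%N u = be, c 0%N 1%N u = ga & c 2%N 3%N u =
      de].
  by rewrite /c => ->; rewrite !MmxE /= !inordK.
have cL i j : scalar (c i j).
  by move=> d u v; rewrite /c vsval_MrhoZD !mxE.
have p0L : linear p0.
  move=> d u v; rewrite /p0 !cL !scalerDl -!scalerA scalerDr.
  by rewrite addrACA.
have p1L : linear p1.
  move=> d u v; rewrite /p1 !cL !scalerDl -!scalerA scalerDr.
  by rewrite addrACA.
have pM u v : [/\ p0 (Mrho_mul u v) = p0 u * p0 v &
    p1 (Mrho_mul u v) = p0 u * p1 v + p1 u * p0 v].
  have [a1 [b1 [c1 [d1 uE]]]] := vsval_Mrho u.
  have [a2 [b2 [c2 [d2 vE]]]] := vsval_Mrho v.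
  have uvE := vsval_Mrho_mul u v; rewrite uE vE MmxM in uvE.
  have [u1 u2 u3 u4] := cE _ _ _ _ _ uE; have [v1 v2 v3 v4] := cE _ _ _ _ _ vE.
  have [w1 w2 w3 w4] := cE _ _ _ _ _ uvE.
  rewrite /p0 /p1 u1 u2 u3 u4 v1 v2 v3 v4 w1 w2 w3 w4 !mulrDl !mulrDr.
  rewrite -!scalerAl -!scalerAr !scalerA aa bb ab ba ax xb xa bx ya byE ay yb.
  rewrite !scaler0 !addr0 !add0r !scalerDl; split=> //.
  by rewrite addrACA.
have p0S u : p0 (Mrho_star u) = ustar (p0 u).
  have [a1 [b1 [c1 [d1 uE]]]] := vsval_Mrho u.
  have suE := vsval_Mrho_star u; rewrite uE refl_Mmx in suE.
  have [u1 u2 _ _] := cE _ _ _ _ _ uE; have [v1 v2 _ _] := cE _ _ _ _ _ suE.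
  by rewrite /p0 u1 u2 v1 v2 linearP linearZ /= sa sb.
have p1S u : p1 (Mrho_star u) = ustar (p1 u).
  have [a1 [b1 [c1 [d1 uE]]]] := vsval_Mrho u.
  have suE := vsval_Mrho_star u; rewrite uE refl_Mmx in suE.
  have [_ _ u1 u2] := cE _ _ _ _ _ uE; have [_ _ v1 v2] := cE _ _ _ _ _ suE.
  by rewrite /p1 u1 u2 v1 v2 linearP linearZ /= ustarK addrC.
pose N (u : F -> R) := exists2 w, vpoly w & forall t, u t = t ^+ 2 *: w t.
have mulL z : linear (fun r : R => z * r).
  by move=> d r r'; rewrite mulrDr scalerAr.
have mulR z : linear (fun r : R => r * z).
  by move=> d r r'; rewrite mulrDl scalerAl.
apply: (@in_gstar_var_family _ _ _ _ A _ _ F psi N).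
- move=> t d u v; rewrite /psi p0L p1L.
  move: (p0 u) (p0 v) (p1 u) (p1 v) => q0 r0 q1 r1.
  by rewrite !scalerDr addrACA !scalerA [t * d]mulrC.
- move=> t k u; have [a1 [b1 [c1 [d1 uE]]]] := vsval_Mrho u.
  have [u1 u2 u3 u4] := cE _ _ _ _ _ uE.
  move=> /(Mrho_compE _ uE) [Pab Pc Pd].
  have hz (z : R) h e : ghom h z -> (h != k -> e = 0) -> ghom k (e *: z).
    move=> hz'; case: eqVneq => [<- _|_ /(_ isT) ->]; first exact: ghomZ.
    by rewrite scale0r; apply: ghom0.
  rewrite /psi /p0 /p1 u1 u2 u3 u4; apply: ghomD; last apply: ghomZ;
    apply: ghomD; [apply: hz ha _ | apply: hz hb _ | apply: hz hx _ | apply: hz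
      hy _] => //.
    by move=> /Pab [].
  by move=> /Pab [].
- by move=> u v uv [w wp uw]; exists w => // t; rewrite -uv.
- exists (fun=> 0); first by exists [::].
  by move=> t; rewrite scaler0.
- move=> d u v [w wp uw] [w' wp' vw]; exists (fun t => d *: w t + w' t).
    exact: vpolyD.
  by move=> t; rewrite uw vw scalerDr !scalerA mulrC.
- move=> u q [w wp uw]; exists (fun t => 1 *: (p0 q * w t) + t *: (p1 q * w t)).
    apply: vpolyD; first exact: vpoly_map (mulL _) wp.
    exact/vpoly_shift/(vpoly_map (mulL _) wp).
  by move=> t; rewrite uw /psi scale1r -scalerAr mulrDl scalerAl.
- move=> u q [w wp uw]; exists (fun t => 1 *: (w t * p0 q) + t *: (w t * p1 q)).
    apply: vpolyD; first exact: vpoly_map (mulR _) wp.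
    exact/vpoly_shift/(vpoly_map (mulR _) wp).
  by move=> t; rewrite uw /psi scale1r -scalerAl mulrDr scalerAr.
- move=> u [w wp uw]; exists (fun t => ustar (w t)).
    exact: vpoly_map (@ustar_linear _ _ _ _ A) wp.
  by move=> t; rewrite uw linearZ.
- move=> u v; exists (fun=> - (p1 u * p1 v)).
    by exists [:: - (p1 u * p1 v)] => t; rewrite /= scaler0 addr0.
  move=> t; have [e0 e1] := pM u v;
    rewrite /psi [gmul _ _ _]/(Mrho_mul u v) e0 e1.
  move: (p0 u) (p0 v) (p1 u) (p1 v) => z0 y0 x1 y1.
  have -> : (z0 + t *: x1) * (y0 + t *: y1) =
      z0 * y0 + t *: (z0 * y1 + x1 * y0) + t ^+ 2 *: (x1 * y1).
    rewrite mulrDl !mulrDr -!scalerAl -!scalerAr scalerA -expr2 scalerDr.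
    by rewrite !addrA.
  by rewrite opprD addrA subrr sub0r scalerN.
- move=> u; exists (fun=> 0); first by exists [::].
  move=> t; rewrite /psi [gstar _ _]/(Mrho_star u) p0S p1S.
  by move: (p0 u) (p1 u) => z0 z1; rewrite linearD linearZ /= subrr scaler0.
- move=> u [w [s wE] uw]; have [a1 [b1 [c1 [d1 uE]]]] := vsval_Mrho u.
  have H : forall i, (p0 u :: p1 u :: map -%R s)`_i = 0.
    apply: vhorner_eq0 => // t /=.
    have -> : vhorner (map -%R s) t = - vhorner s t.
      elim: (s) => [|z r /= ->]; rewrite /= ?oppr0 //.
      by rewrite opprD scalerN.
    have := uw t; rewrite wE /psi; move: (p0 u) (p1 u) => z0 z1 zE.
    by rewrite scalerDr addrA zE scalerN scalerN scalerA -expr2 subrr.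
  have := H 0%N; have := H 1%N; rewrite /= /p0 /p1.
  have [-> -> -> ->] := cE _ _ _ _ _ uE => e1 e0.
  have a0 : a != 0 by apply: contra_neq x0 => a0; rewrite -ax a0 mul0r.
  have b0 : b != 0 by apply: contra_neq x0 => b0; rewrite -xb b0 mulr0.
  have y0 : y != 0.
    by apply: contra_neq x0 => y0; rewrite -[x]ustarK -/y y0 linear0.
  have z0 (d : F) (z : R) : z != 0 -> d *: z = 0 -> d = 0.
    by move=> zn /eqP; rewrite scaler_eq0 (negbTE zn) orbF => /eqP.
  apply: vsval_Mrho_inj; rewrite uE linear0.
  have -> : a1 = 0.
    apply: (z0 _ a) => //; have := congr1 ( *%R^~ a) e0.
    by rewrite mulrDl -!scalerAl aa ba scaler0 addr0 mul0r.
  have -> : b1 = 0.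
    apply: (z0 _ b) => //; have := congr1 ( *%R^~ b) e0.
    by rewrite mulrDl -!scalerAl bb ab scaler0 add0r mul0r.
  have -> : c1 = 0.
    apply: (z0 _ x) => //; have := congr1 ( *%R^~ b) e1.
    by rewrite mulrDl -!scalerAl xb yb scaler0 addr0 mul0r.
  have -> : d1 = 0.
    apply: (z0 _ y) => //; have := congr1 ( *%R^~ a) e1.
    by rewrite mulrDl -!scalerAl ya xa scaler0 add0r mul0r.
  by rewrite /Mmx !scale0r !addr0.
Qed.

End MrhoMembership.

(** * Orthogonal symmetric idempotents modulo the radical *)

Section RadicalCongruence.
Context (F : closedFieldType) (gT : finGroupType) (tau : group_involution gT).
Context (V : vectType F) (A : gstar_alg tau V).
Local Notation R := (unitz A).
Implicit Types (x y z : R).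

Definition eqr x y : Prop := in_rad (x - y).

Lemma eqr_refl x : eqr x x.
Proof. by rewrite /eqr subrr; apply: in_rad0. Qed.

Lemma eqrZD c x x' y y' : eqr x x' -> eqr y y' -> eqr (c *: x + y) (c *: x' +
  y').
Proof.
move=> rx ry; rewrite /eqr opprD addrACA -scalerBr; exact: in_radZD.
Qed.

Lemma eqrD x x' y y' : eqr x x' -> eqr y y' -> eqr (x + y) (x' + y').
Proof. by move=> rx ry; rewrite -[x]scale1r -[x']scale1r; apply: eqrZD. Qed.

Lemma eqrZ c x x' : eqr x x' -> eqr (c *: x) (c *: x').
Proof.
move=> rx; rewrite -[_ *: x]addr0 -[_ *: x']addr0.
by apply: eqrZD => //; apply: eqr_refl.
Qed.

Lemma eqr_sym x y : eqr x y -> eqr y x.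
Proof.
move=> /(eqrZ (-1)); rewrite !scaleN1r => /(eqrD (eqr_refl (x + y))).
by rewrite addrC addKr addrK.
Qed.

Lemma eqr_trans y x z : eqr x y -> eqr y z -> eqr x z.
Proof.
move=> xy yz; rewrite /eqr -(subrKA y x (- z)) -[x - y]scale1r; exact: in_radZD.
Qed.

Lemma eqrM x x' y y' : eqr x x' -> eqr y y' -> eqr (x * y) (x' * y').
Proof.
move=> rx ry; apply: (@eqr_trans (x * y')).
  by rewrite /eqr -mulrBr; apply: in_radMl.
by rewrite /eqr -mulrBl; apply: in_radMr.
Qed.

Lemma eqrX x x' n : eqr x x' -> eqr (x ^+ n) (x' ^+ n).
Proof.
move=> rx; elim: n => [|n IHn]; first exact: eqr_refl.
by rewrite !exprS; apply: eqrM.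
Qed.

Lemma eqr_star x x' : eqr x x' -> eqr (ustar x) (ustar x').
Proof. by rewrite /eqr -linearB; apply: in_rad_star. Qed.

Lemma eqr_sum (I : finType) (u v : I -> R) :
  (forall i, eqr (u i) (v i)) -> eqr (\sum_i u i) (\sum_i v i).
Proof.
move=> uv; elim/big_ind2: _ => [|x x' y y' xx' yy'|i _] //;
  first exact: eqr_refl.
exact: eqrD.
Qed.

Lemma eqr_atr x y : eqr x y -> atr x = atr y.
Proof.
by move=> /in_rad_atr; rewrite linearB => /eqP; rewrite subr_eq0 => /eqP.
Qed.

Lemma eqr0 x : eqr x 0 <-> in_rad x.
Proof. by rewrite /eqr subr0. Qed.

End RadicalCongruence.

Section HornerAlg.
Context (F : fieldType) (R : falgType F).

Lemma horner_alg_ind (a : R) (P : R -> Prop) : P 0 ->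
    (forall c x, P x -> P (c *: 1 + x * a)) -> forall p, P (horner_alg a p).
Proof.
move=> P0 PS; elim/poly_ind => [|p c Pp]; first by rewrite rmorph0.
by rewrite rmorphD rmorphM /= horner_algX horner_algC addrC; apply: PS.
Qed.

Lemma horner_alg_comm (a : R) p : a * horner_alg a p = horner_alg a p * a.
Proof.
elim/horner_alg_ind: (horner_alg a p) => [|c x IHx];
  first by rewrite mulr0 mul0r.
by rewrite mulrDr mulrDl mulrA IHx -scalerAr -scalerAl mulr1 mul1r.
Qed.

End HornerAlg.

(** A product of factors [s - c] kills [e]; apply the factors to [e] one by one,
    and stop before the first one that gives 0. *)
Lemma eigenvector_in_corner (F : closedFieldType) (R : falgType F) (e s : R) :
    e * e = e -> e != 0 -> e * s = s ->
  exists c v, [/\ v != 0, e * v = v & s * v = c *: v].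
Proof.
move=> ee e0 es.
have [m m0 ms] := exists_annihilator s.
have [r rE] := closed_field_poly_normal m.
have : horner_alg s (\prod_(z <- r) ('X - z%:P)) * e = 0.
  move: ms; rewrite rE linearZ /= => /eqP;
    rewrite mulr_algl scaler_eq0 lead_coef_eq0.
  by rewrite (negPf m0) => /eqP ->; rewrite mul0r.
suff key v : e * v = v -> v != 0 ->
    horner_alg s (\prod_(z <- r) ('X - z%:P)) * v = 0 ->
    exists c v, [/\ v != 0, e * v = v & s * v = c *: v].
  exact: key.
elim: r {rE} v => [|c r IHr] v ev v0.
  by rewrite big_nil rmorph1 mul1r => /eqP; rewrite (negPf v0).
rewrite big_cons [_ * \prod_(z <- r) _]mulrC rmorphM rmorphB /= horner_algX.
rewrite horner_algC -mulrA; set w := _ * v.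
have wE : w = s * v - c *: v by rewrite /w mulrBl mulr_algl.
have [w0 _|w0] := eqVneq w 0.
  by exists c, v; split=> //; apply/eqP; rewrite -subr_eq0 -wE w0.
by apply: IHr w0; rewrite wE mulrBr mulrA es -scalerAr ev.
Qed.

Section IdempotentSystems.
Context (F : closedFieldType) (F0 : [pchar F] =i pred0) (gT : finGroupType).
Context (tau : group_involution gT) (V : vectType F) (A : gstar_alg tau V).
Local Notation R := (unitz A).
Implicit Types (x y z s : R).

Record idem_sys (I : finType) (e : I -> R) : Prop := IdemSys {
  idem_hom : forall i, ghom 1%g (e i);
  idem_star : forall i, ustar (e i) = e i;
  idem_neq0 : forall i, e i != 0;
  idemM : forall i j, e i * e j = if i == j then e i else 0
}.

Lemma idem_sys_card (I : finType) (e : I -> R) :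
  idem_sys e -> (#|I| <= \dim {:R})%N.
Proof.
case=> _ _ e0 eM; pose X := [tuple e (enum_val i) | i < #|I|].
have XE (i : 'I_#|I|) : X`_i = e (enum_val i) by rewrite -tnth_nth tnth_mktuple.
suff : free X by rewrite /free => /eqP; rewrite size_tuple => <-;
  apply/dimvS/subvf.
apply/freeP => k X0 i; have /(congr1 ( *%R^~ (e (enum_val i)))) := X0.
rewrite mul0r mulr_suml (bigD1 i) //= big1 => [|j ji].
  rewrite XE -scalerAl eM eqxx addr0 => /eqP.
  by rewrite scaler_eq0 (negPf (e0 _)) orbF => /eqP.
rewrite XE -scalerAl eM (inj_eq enum_val_inj) (negPf ji).
by rewrite scaler0.
Qed.

(** Orthogonal idempotents are independent, which bounds their number. *)
Lemma max_idem_sys : exists (I : finType) (e : I -> R), idem_sys e /\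
  forall (I' : finType) (e' : I' -> R), idem_sys e' -> (#|I'| <= #|I|)%N.
Proof.
apply: NNPP => nmax.
have big n : exists (I : finType) (e : I -> R), idem_sys e /\ (n <= #|I|)%N.
  elim: n => [|n [I [e [es nI]]]].
    by exists void, (of_void _); split=> //; split=> -[].
  apply: NNPP => nbig; apply: nmax; exists I, e; split=> // I' e' es'.
  rewrite leqNgt; apply/negP => lt; apply: nbig; exists I', e'; split=> //.
  exact: leq_ltn_trans lt.
have [I [e [/idem_sys_card le]]] := big (\dim {:R}).+1.
by rewrite ltnNge le.
Qed.

Lemma ustar_horner_alg s (p : {poly F}) : ustar s = s ->
  ustar (horner_alg s p) = horner_alg s p.
Proof.
move=> ss; elim/poly_ind: p => [|p c IHp]; first by rewrite !linear0.
rewrite rmorphD rmorphM /= horner_algX horner_algC [LHS]linearD /= ustarM ss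
  IHp.
by rewrite horner_alg_comm linearZ /= ustar1.
Qed.

(** The idempotent of Fitting's lemma is a polynomial in [s] without constant
    term, hence symmetric of degree 1 like [s]. *)
Lemma symmetric_idempotent s :
    ghom 1%g s -> ustar s = s -> (forall k, s ^+ k != 0) ->
  exists f r, (f = s * r /\ f = r * s) /\
    [/\ ghom 1%g f, ustar f = f, f * f = f & f != 0].
Proof.
move=> hs ss s0; have [[k /eqP]|[p [ff f0]]] := fitting_idempotent s.
  by rewrite (negPf (s0 k)).
have sr := horner_alg_comm s p.
exists (s * horner_alg s p), (horner_alg s p); split=> //; split=> //.
  elim/horner_alg_ind: (horner_alg s p) => [|c x IHx].
    by rewrite mulr0; apply: ghom0.
  rewrite mulrDr -scalerAr mulr1 mulrA; apply: ghomZD => //.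
  by rewrite -[1%g]mulg1; apply: ghomM.
by rewrite ustarM ss ustar_horner_alg.
Qed.

Section Maximal.
Context (I : finType) (e : I -> R) (es : idem_sys e).
Hypothesis e_max : forall (I' : finType) (e' : I' -> R),
  idem_sys e' -> (#|I'| <= #|I|)%N.

Lemma idem_sys_extension (I' : finType) (e' : I' -> R) :
  #|I'| = #|I|.+1 -> ~ idem_sys e'.
Proof. by move=> cI /e_max; rewrite cI ltnn. Qed.

(** Such an [f] could be adjoined to the system. *)
Lemma maximal_complement f : ghom 1%g f -> ustar f = f -> f * f = f ->
  (forall i, e i * f = 0) -> f = 0.
Proof.
move=> hf sf ff ef; apply/eqP/negPn/negP => f0.
have [eh est e0 eM] := es.
have fe i : f * e i = 0 by rewrite -sf -(est i) -ustarM ef linear0.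
apply: (@idem_sys_extension (option I) (fun o => oapp e f o)).
  exact: card_option.
split; do ?by case=> [i|] /=; rewrite ?est.
move=> [i|] [j|] //=.
Qed.

(** Otherwise [e i] could be replaced by [f] and [e i - f]. *)
Lemma maximal_corner i f : ghom 1%g f -> ustar f = f -> f * f = f ->
  e i * f = f -> f != 0 -> f = e i.
Proof.
move=> hf sf ff ef f0; apply/eqP; rewrite eq_sym -subr_eq0.
apply/negPn/negP => ef0.
have [eh est e0 eM] := es.
have fe : f * e i = f by rewrite -[LHS]ustarK ustarM est sf ef sf.
have oth j : j != i -> e j * f = 0 /\ f * e j = 0.
  move=> ji; split; first by rewrite -ef mulrA eM (negPf ji) mul0r.
  by rewrite -fe -mulrA eM eq_sym (negPf ji) mulr0.
pose e' j := if j == i then f else e j.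
apply: (@idem_sys_extension (option I) (fun o => oapp e' (e i - f) o)).
  exact: card_option.
split.
- move=> [j|] /=; last exact: ghomB.
  by rewrite /e'; case: eqP.
- move=> [j|] /=; last by rewrite linearB /= est sf.
  by rewrite /e'; case: eqP.
- move=> [j|] //=; by rewrite /e'; case: ifP => _; [exact: f0 | exact: e0].
have eif : (e i - f) * f = 0 by rewrite mulrBl ef ff subrr.
have fie : f * (e i - f) = 0 by rewrite mulrBr fe ff subrr.
move=> [j|] [k|] /=; rewrite /e'.
- rewrite (inj_eq Some_inj); have [->|ji] := eqVneq j i.
    by have [_|ki] := eqVneq k i; rewrite ?(oth k ki).2.
  have [->|ki] := eqVneq k i; first by rewrite (negPf ji) (oth j ji).1.
  by rewrite eM.
- have [_|ji] := eqVneq j i; first by [].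
  by rewrite mulrBr eM (negPf ji) (oth j ji).1 subrr.
- have [_|ki] := eqVneq k i; first by [].
  by rewrite mulrBl eM eq_sym (negPf ki) (oth k ki).2 subrr.
- by rewrite mulrBr eif subr0 mulrBl eM eqxx fe.
Qed.

End Maximal.
End IdempotentSystems.

Section CornersDegreeOne.
Context (F : closedFieldType) (F0 : [pchar F] =i pred0) (gT : finGroupType).
Context (tau : group_involution gT) (V : vectType F) (A : gstar_alg tau V).
Local Notation R := (unitz A).
Implicit Types (x y z s : R).

Lemma two_neq0 : 2 != 0 :> F.
Proof. by rewrite (proj1 (pcharf0P F) F0). Qed.

Lemma char0_addxx_eq0 (a : F) : a + a = 0 -> a = 0.
Proof.
move=> aa; apply/eqP; have : 2 * a == 0 by rewrite mulr_natl mulr2n aa.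
by rewrite mulf_eq0 (negPf two_neq0).
Qed.

(** By invariance of the trace under the involution. *)
Lemma atr_skew x : ustar x = - x -> atr x = 0.
Proof.
move=> sx; apply: char0_addxx_eq0; rewrite -{1}atr_star sx linearN /= addNr //.
Qed.

Lemma atr_symmetrize x : atr (x + ustar x) = 2 * atr x.
Proof. by rewrite linearD /= atr_star mulr_natl mulr2n. Qed.

Lemma ghom_aug x : x.1 = 0 -> x = \sum_g uinj A (gcomps A x.2 g).
Proof.
by case: x => a v /= ->; rewrite -linear_sum -gcomps_sum.
Qed.

Lemma ghom1Ml g x y : ghom 1%g x -> ghom g y -> ghom g (x * y).
Proof. by move=> hx hy; rewrite -[g]mul1g; apply: ghomM. Qed.

Lemma ghom1Mr g x y : ghom g x -> ghom 1%g y -> ghom g (x * y).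
Proof. by move=> hx hy; rewrite -[g]mulg1; apply: ghomM. Qed.

Lemma ghom1_star x : ghom 1%g x -> ghom 1%g (ustar x).
Proof. by move=> /ghom_star; rewrite ginvol1. Qed.

Context (I : finType) (e : I -> R) (es : idem_sys e).
Hypothesis e_max : forall (I' : finType) (e' : I' -> R),
  idem_sys e' -> (#|I'| <= #|I|)%N.

Let eh i : ghom 1%g (e i) := idem_hom es i.
Let est i : ustar (e i) = e i := idem_star es i.
Let e0 i : e i != 0 := idem_neq0 es i.
Let eM i j : e i * e j = if i == j then e i else 0 := idemM es i j.
Let ee i : e i * e i = e i. Proof. by rewrite eM eqxx. Qed.

Definition idem_sum : R := \sum_i e i.
Definition idem_compl : R := 1 - idem_sum.
Local Notation E := idem_sum.
Local Notation e' := idem_compl.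

Lemma idem_sum_hom : ghom 1%g E.
Proof.
by rewrite /E; elim/big_ind: _ => // *; [apply: ghom0 | apply: ghomD].
Qed.

Lemma idem_mul_compl i : e i * e' = 0.
Proof.
rewrite /e' mulrBr mulr1 /E mulr_sumr (bigD1 i) //= ee big1 ?addr0 ?subrr //.
by move=> j ji; rewrite eM eq_sym (negPf ji).
Qed.

Lemma idem_compl_star : ustar e' = e'.
Proof.
rewrite linearB /= ustar1 linear_sum; congr (_ - _).
by apply: eq_bigr => i _; apply: est.
Qed.

Lemma idem_compl_idem : e' * e' = e'.
Proof.
by rewrite {1}/e' mulrBl mul1r /E mulr_suml big1 ?subr0 // => i _;
  apply: idem_mul_compl.
Qed.

Lemma ghom_compl g x : ghom g x -> ghom g (e' * x * e').
Proof.
move=> hx; have hEx : ghom g (e' * x).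
  by rewrite mulrBl mul1r; apply: ghomB => //; apply: ghom1Ml idem_sum_hom hx.
by rewrite mulrBr mulr1; apply: ghomB => //; apply: ghom1Mr idem_sum_hom.
Qed.

(** The corner of the complement contains no symmetric idempotent of degree 1,
    so its symmetric elements of degree 1 are nilpotent; the trace of any other
    element is half the trace of its symmetrization. *)
Lemma atr_compl x : x.1 = 0 -> atr (e' * x * e') = 0.
Proof.
move=> /ghom_aug ->; rewrite mulr_sumr mulr_suml linear_sum big1 //= => g _.
set y := uinj _ _; have hy : ghom g (e' * y * e').
  exact/ghom_compl/ghom_uinj/gcompsP.
have [g1|g1] := eqVneq g 1%g; last exact: atr_ghom hy g1.
rewrite {}g1 in hy; set z := e' * y * e' in hy *.
pose s := z + ustar z.
have hs : ghom 1%g s by apply: ghomD => //; apply: ghom1_star.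
have ss : ustar s = s by rewrite linearD /= ustarK addrC.
have es0 i : e i * s = 0.
  rewrite mulrDr /z !ustarM idem_compl_star !mulrA idem_mul_compl.
  by rewrite !mul0r addr0.
have : atr s = 0.
  have [[k /atr_nilpotent //]|nn] := classic (exists k, s ^+ k = 0).
  have [|f [r [[fs fs'] [hf sf ff f0]]]] := symmetric_idempotent hs ss.
    by move=> k; apply/eqP => sk; apply: nn; exists k.
  case/eqP: f0; apply: (maximal_complement es e_max) => // i.
  by rewrite fs mulrA es0 mul0r.
rewrite atr_symmetrize => /eqP; rewrite mulf_eq0 (negPf two_neq0).
by move=> /eqP.
Qed.

Lemma aug_mul x y : x.1 = 0 -> (x * y).1 = 0.
Proof. by move=> /= ->; rewrite mul0r. Qed.

Lemma aug_mulr x y : x.1 = 0 -> (y * x).1 = 0.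
Proof. by move=> /= ->; rewrite mulr0. Qed.

(** By cyclicity of the trace, [e' * y] has the trace of [e' * y * e']. *)
Lemma compl_mul_in_rad x : x.1 = 0 -> in_rad (e' * x).
Proof.
move=> x0 b; rewrite -mulrA -idem_compl_idem -mulrA atrC.
by apply: atr_compl; apply: aug_mul.
Qed.

Lemma mul_compl_in_rad x : x.1 = 0 -> in_rad (x * e').
Proof.
move=> x0 b; rewrite -mulrA atrC -mulrA.
exact: in_rad_atr (compl_mul_in_rad (aug_mulr b x0)).
Qed.

End CornersDegreeOne.

(** * Corners of primitive idempotents *)

Lemma exists_root (F : closedFieldType) n (a : F) :
  (0 < n)%N -> exists d, d ^+ n = a.
Proof.
case: n => // n _.
have [d dE] := @solve_monicpoly F n.+1 (fun i => if i == 0%N then a else 0) isT.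
exists d; rewrite dE big_ord_recl /= expr0 mulr1 big1 ?addr0 // => i _.
by rewrite mul0r.
Qed.

Lemma ginvolX (gT : finGroupType) (tau : group_involution gT) h i :
  tau (h ^+ i)%g = (tau h ^+ i)%g.
Proof.
elim: i => [|i IHi]; first by rewrite !expg0 ginvol1.
by rewrite expgS ginvolM IHi -expgSr.
Qed.

Section PrimitiveCorner.
Context (F : closedFieldType) (F0 : [pchar F] =i pred0) (gT : finGroupType).
Context (tau : group_involution gT) (V : vectType F) (A : gstar_alg tau V).
Local Notation R := (unitz A).
Implicit Types (x y z s k : R).

Context (e : R) (eh : ghom 1%g e) (est : ustar e = e) (ee : e * e = e).
Context (e0 : e != 0).
Hypothesis e_prim : forall f, ghom 1%g f -> ustar f = f -> f * f = f ->
  e * f = f -> f != 0 -> f = e.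

Definition corner g x : Prop := [/\ ghom g x, e * x = x & x * e = x].

Let atr_e : atr e != 0. Proof. exact: atr_idempotent. Qed.

Lemma corner_e : corner 1%g e. Proof. by []. Qed.

Lemma cornerZD g c x y : corner g x -> corner g y -> corner g (c *: x + y).
Proof.
move=> [hx ex xe] [hy ey ye]; split; first exact: ghomZD.
  by rewrite mulrDr -scalerAr ex ey.
by rewrite mulrDl -scalerAl xe ye.
Qed.

Lemma cornerD g x y : corner g x -> corner g y -> corner g (x + y).
Proof. by rewrite -[x in x + y]scale1r; apply: cornerZD. Qed.

Lemma cornerB g x y : corner g x -> corner g y -> corner g (x - y).
Proof. by move=> cx cy; rewrite addrC -scaleN1r; apply: cornerZD. Qed.

Lemma cornerZ g c x : corner g x -> corner g (c *: x).
Proof.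
move=> [hx ex xe]; split; first exact: ghomZ.
  by rewrite -scalerAr ex.
by rewrite -scalerAl xe.
Qed.

Lemma cornerM g h x y : corner g x -> corner h y -> corner (g * h)%g (x * y).
Proof.
move=> [hx ex xe] [hy ey ye]; split; first exact: ghomM.
  by rewrite mulrA ex.
by rewrite -mulrA ye.
Qed.

Lemma corner1M x y : corner 1%g x -> corner 1%g y -> corner 1%g (x * y).
Proof. by move=> cx cy; rewrite -[1%g]mulg1; apply: cornerM. Qed.

Lemma cornerX g x n : corner g x -> corner (g ^+ n.+1)%g (x ^+ n.+1).
Proof.
move=> cx; elim: n => [|n IHn]; first by rewrite expr1 expg1.
by rewrite expgS exprS; apply: cornerM.
Qed.

Lemma corner_star g x : corner g x -> corner (tau g) (ustar x).
Proof.
move=> [hx ex xe]; split; first exact: ghom_star.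
  by rewrite -{2}xe ustarM est.
by rewrite -{2}ex ustarM est.
Qed.

Lemma corner1_star x : corner 1%g x -> corner 1%g (ustar x).
Proof. by move=> /corner_star; rewrite ginvol1. Qed.

Lemma corner_proj g x : ghom g x -> corner g (e * x * e).
Proof.
move=> hx; split; first by apply: ghom1Mr => //; apply: ghom1Ml.
  by rewrite !mulrA ee.
by rewrite -mulrA ee.
Qed.

Lemma atr_corner x y g : corner g x -> atr (x * y) = atr (x * (e * y * e)).
Proof.
by move=> [_ ex xe]; rewrite !mulrA xe [in RHS]atrC !mulrA ex.
Qed.

(** As [x = e * x * e], only [e * y * e] matters in [atr (x * y)]. *)
Lemma corner_in_rad g x : corner g x -> atr x = 0 ->
  (forall y, corner g^-1 y -> atr (x * y) = 0) -> in_rad x.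
Proof.
move=> cx x0 xy; have [hx _ _] := cx; apply: in_rad_ghom hx x0 _ => y hy.
by rewrite (atr_corner _ cx); apply: xy; apply: corner_proj.
Qed.

(** For an eigenvalue [c] of [s] on [e * R], the element [s - c *: e] is not
    invertible in the corner, so [e], the only idempotent that it could have
    among its polynomials, is excluded. *)
Lemma symmetric_scalar_nilpotent s : corner 1%g s -> ustar s = s ->
  exists c n, (s - c *: e) ^+ n = 0.
Proof.
move=> cs ss; have [hs es se] := cs.
have [c [v [v0 ev sv]]] := eigenvector_in_corner ee e0 es.
exists c; set a := s - c *: e; apply: NNPP => nn.
have [ha ea ae] : corner 1%g a.
  by apply: cornerB => //; apply: cornerZ; apply: corner_e.
have sa : ustar a = a by rewrite linearB linearZ /= ss est.
have [|f [r [[fa fa'] [hf sf ff f0]]]] := symmetric_idempotent ha sa.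
  by move=> n; apply/eqP => an; apply: nn; exists n.
have fe : f = e by apply: e_prim => //; rewrite fa mulrA ea.
have av : a * v = 0 by rewrite mulrBl sv -scalerAl ev subrr.
by case/eqP: v0; rewrite -ev -fe fa' -mulrA av mulr0.
Qed.

Lemma symmetric_traceless_nilpotent s :
  corner 1%g s -> ustar s = s -> atr s = 0 -> exists n, s ^+ n = 0.
Proof.
move=> cs ss s0; have [c [n cn]] := symmetric_scalar_nilpotent cs ss.
have := atr_nilpotent cn; rewrite linearB linearZ /= s0 sub0r => /eqP.
rewrite oppr_eq0 mulf_eq0 (negPf atr_e) orbF => /eqP c0.
by exists n; rewrite -cn c0 scale0r subr0.
Qed.

(** Squares of [s], [s'] and [s + s'] are nilpotent; polarize. *)
Lemma atr_mul_symmetric s s' : corner 1%g s -> ustar s = s -> atr s = 0 ->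
  corner 1%g s' -> ustar s' = s' -> atr s' = 0 -> atr (s * s') = 0.
Proof.
have sq z : corner 1%g z -> ustar z = z -> atr z = 0 -> atr (z * z) = 0.
  move=> cz sz z0; have [n zn] := symmetric_traceless_nilpotent cz sz z0.
  by apply: (@atr_nilpotent _ _ _ n); rewrite exprMn_comm // zn mulr0.
move=> cs ss s0 cs' ss' s0'; apply: (char0_addxx_eq0 F0).
have := sq (s + s') (cornerD cs cs'); rewrite !linearD /= ss ss' s0 s0' addr0.
move=> /(_ erefl erefl); rewrite mulrDl !mulrDr !linearD /=.
by rewrite (sq s) // (sq s') // add0r addr0 [atr (s' * s)]atrC.
Qed.

Lemma atr_mul_symmetric_skew s k : ustar s = s -> ustar k = - k ->
  atr (s * k) = 0.
Proof.
move=> ss sk; apply: (char0_addxx_eq0 F0).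
by rewrite -{1}atr_star ustarM ss sk mulNr linearN /= atrC addNr.
Qed.

(** The symmetric part is freed from its trace by a multiple of [e]. *)
Lemma corner_split y : corner 1%g y -> exists c s k,
  [/\ y = c *: e + s + k, corner 1%g s /\ corner 1%g k, ustar s = s,
      atr s = 0 & ustar k = - k].
Proof.
move=> cy; have cy' := corner1_star cy.
have h2 := two_neq0 F0.
pose t := 2^-1 *: (y + ustar y); pose c := atr t / atr e.
have st : ustar t = t by rewrite linearZ linearD /= ustarK addrC.
exists c, (t - c *: e), (2^-1 *: (y - ustar y)); split.
- rewrite [c *: e + _]addrC subrK -scalerDr addrACA subrr addr0 -mulr2n.
  by rewrite -scaler_nat scalerA mulVf // scale1r.
- split; last by apply/cornerZ/cornerB.
  by apply: cornerB; [apply/cornerZ/cornerD | apply/cornerZ/corner_e].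
- by rewrite linearB /= st linearZ /= est.
- by rewrite linearB [X in _ - X]linearZ /= divfK ?subrr.
- by rewrite linearZ linearB /= ustarK -scalerN opprB.
Qed.

Lemma symmetric_traceless_in_rad s :
  corner 1%g s -> ustar s = s -> atr s = 0 -> in_rad s.
Proof.
move=> cs ss s0; apply: (corner_in_rad cs s0) => y.
rewrite invg1 => /corner_split [c [s' [k [-> [cs' ck] ss' s0' sk]]]].
have [_ _ se] := cs.
rewrite !mulrDr -scalerAr se !linearD linearZ /= s0 mulr0 add0r.
by rewrite atr_mul_symmetric // atr_mul_symmetric_skew // addr0.
Qed.

Hypothesis no_FC2_star : ~ in_gstar_var A (FC2_star F tau).

(** A skew [k] with [k * k] congruent to a nonzero multiple of [e] would span
    with [e] a copy of [FC2_star]. *)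
Lemma atr_skew_square k : corner 1%g k -> ustar k = - k -> atr (k * k) = 0.
Proof.
move=> ck sk; pose c := atr (k * k) / atr e.
have cE : atr (k * k) = c * atr e by rewrite divfK.
have kk : eqr (k * k) (c *: e).
  apply: symmetric_traceless_in_rad.
  - by apply: cornerB; [apply: corner1M | apply/cornerZ/corner_e].
  - by rewrite linearB linearZ /= ustarM sk mulrNN est.
  - by rewrite linearB linearZ /= -cE subrr.
rewrite cE; have [->|c0] := eqVneq c 0; first by rewrite mul0r.
case: no_FC2_star.
have [d dE] := exists_root c^-1 (isT : (0 < 2)%N).
pose u := d *: k; have uu : eqr (u * u) e.
  rewrite /u -scalerAl -scalerAr scalerA -expr2 dE -[X in eqr _ X]scale1r.
  by rewrite -(mulVf c0) -scalerA; apply: eqrZ.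
have su : ustar u = - u by rewrite linearZ /= sk scalerN.
have [_ eu ue] : corner 1%g u by apply: cornerZ.
pose U (y : 'Z_2) := if y == 1%g then e else u.
apply: (@galg_in_var _ _ _ _ A _ _ _ _ _ U).
- move=> y; rewrite /U; case: ifP => _ //.
  by apply: ghomZ; have [] := ck.
- have Z2 (y : 'Z_2) : y != 1%g -> y = Zp1 by case: y => [[|[|//]] ?] // _;
  apply: val_inj.
  move=> y z; rewrite /U.
  have [->|/Z2 ->] := eqVneq y 1%g; first by rewrite mul1g; case: ifP => _;
    rewrite ?ee ?eu subrr; apply: in_rad0.
  have [->|/Z2 ->] := eqVneq z 1%g; first by rewrite mulg1 /= ue subrr;
    apply: in_rad0.
  by apply: eqr_sym.
- move=> y; rewrite /U /sgn2; case: ifP => _.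
    by rewrite est scale1r subrr; apply: in_rad0.
  by rewrite su scaleN1r subrr; apply: in_rad0.
- by move=> y y1; rewrite /U (negPf y1); apply: atr_skew.
- by rewrite /U eqxx.
Qed.

(** Polarize again, now with the squares of skew elements. *)
Lemma skew_in_rad k : corner 1%g k -> ustar k = - k -> in_rad k.
Proof.
move=> ck sk; have k0 := atr_skew F0 sk; apply: (corner_in_rad ck k0) => y.
rewrite invg1 => /corner_split [c [s [k' [-> [cs ck'] ss s0 sk']]]].
have [_ _ ke] := ck.
rewrite !mulrDr -scalerAr ke !linearD linearZ /= k0 mulr0 add0r.
rewrite [atr (k * s)]atrC (atr_mul_symmetric_skew ss sk) add0r;
  apply: (char0_addxx_eq0 F0).
have := @atr_skew_square (k + k') (cornerD ck ck').
rewrite linearD /= sk sk' opprD => /(_ erefl).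
rewrite mulrDl !mulrDr !linearD /= !atr_skew_square // add0r addr0.
by rewrite [atr (k' * k)]atrC.
Qed.

Lemma corner1_scalar x : corner 1%g x -> exists c, eqr x (c *: e).
Proof.
move=> /corner_split [c [s [k [-> [cs ck] ss s0 sk]]]]; exists c.
rewrite /eqr -[_ + s + k]addrA [_ + (s + k)]addrC addrK -[s]scale1r;
  apply: in_radZD.
  exact: symmetric_traceless_in_rad.
exact: skew_in_rad.
Qed.

(** Multiples of the order of [h] can be dropped from both exponents. *)
Lemma corner_expg_eqr h u i j : corner h u -> eqr (u ^+ #[h]%g) e ->
  (h ^+ i = h ^+ j)%g -> eqr (e * u ^+ i) (e * u ^+ j).
Proof.
move=> [_ eu ue] up.
have red m : eqr (e * u ^+ m) (e * u ^+ (m %% #[h]%g)).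
  have pow q : eqr (e * u ^+ (q * #[h]%g)) e.
    elim: q => [|q IHq]; first by rewrite mulr1; apply: eqr_refl.
    by rewrite mulSnr exprD mulrA -[X in eqr _ X]ee; apply: eqrM.
  rewrite {1}(divn_eq m #[h]%g) exprD mulrA.
  by apply: eqrM; [apply: pow | apply: eqr_refl].
move=> /eqP; rewrite eq_expg_mod_order => /eqP ij.
by apply: eqr_trans (red i) _; rewrite ij; apply/eqr_sym/red.
Qed.

Lemma corner_expr_comm h u i : corner h u -> u ^+ i * e = e * u ^+ i.
Proof.
move=> [_ eu ue]; elim: i => [|i IHi]; first by rewrite mulr1 mul1r.
by rewrite exprSr -mulrA ue mulrA -IHi -mulrA eu.
Qed.

(** The products [e * u ^+ i] are used instead of [u ^+ i] because the power of
    exponent 0 has to be [e]. *)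
Lemma cyclic_galg_in_var h u theta chi
    (D : galg_data tau (sgval : subg_of <[h]>%G -> gT) theta chi) :
    corner h u -> eqr (u ^+ #[h]%g) e ->
    (forall (y : subg_of <[h]>%G) i, sgval y = (h ^+ i)%g -> exists j,
      sgval (theta y) = (h ^+ j)%g /\
      eqr (chi y *: (e * u ^+ j)) (ustar (e * u ^+ i))) ->
  in_gstar_var A (galg D).
Proof.
move=> cu up su.
have [lg lgE] := fin_all_exists (fun z : subg_of <[h]>%G =>
  elimT (@cycleP gT _ _) (subgP z)).
have uE (y : subg_of <[h]>%G) i : sgval y = (h ^+ i)%g -> eqr (e * u ^+ lg y)
  (e * u ^+ i).
  by rewrite lgE; apply: corner_expg_eqr.
apply: (@galg_in_var _ _ _ _ A _ _ _ _ D (fun t => e * u ^+ lg t)).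
- move=> y; rewrite (lgE y); case: (lg y) => [|i].
    by rewrite expg0 mulr1.
  by apply: ghom1Ml => //; have [] := cornerX i cu.
- move=> y z; apply: (@eqr_trans _ _ _ _ _ (e * u ^+ (lg y + lg z))).
    by apply: uE; rewrite sgvalM // expgD -!lgE.
  rewrite exprD -!mulrA [u ^+ lg y * (e * _)]mulrA (corner_expr_comm _ cu).
  by rewrite !mulrA ee; apply: eqr_refl.
- move=> y; have [j [tE sE]] := su y _ (lgE y).
  by apply: eqr_trans sE; apply/eqrZ/uE.
- move=> y y1; have [n yn] : exists n, lg y = n.+1.
    case E: (lg y) => [|n]; last by exists n.
    by case/eqP: y1; apply: val_inj; rewrite /= lgE E.
  apply: (@atr_ghom _ _ _ _ A (sgval y)); last first.
    by apply: contra_neq y1 => y1; apply: val_inj.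
  by rewrite lgE yn; apply: ghom1Ml => //; have [] := cornerX n cu.
- have /eqr_atr -> := uE 1%g 0%N (erefl _); by rewrite mulr1.
Qed.

(** A right invertible homogeneous element is, modulo the radical, a root of a
    nonzero scalar: its power of degree 1 is a scalar, and it cannot be
    nilpotent. *)
Lemma corner_root_of_scalar g z w : corner g z -> e * w = w ->
  eqr (z * w) e -> exists2 c, c != 0 & eqr (z ^+ #[g]%g) (c *: e).
Proof.
move=> cz ew zw; have [_ ez ze] := cz.
have zwn n : eqr (z ^+ n.+1 * w ^+ n.+1) e.
  elim: n => [|n IHn]; first by rewrite !expr1.
  apply: eqr_trans IHn;
    rewrite exprSr [w ^+ n.+2]exprS -!mulrA [z * (w * _)]mulrA.
  apply: eqrM; first exact: eqr_refl.
  apply: (@eqr_trans _ _ _ _ _ (e * w ^+ n.+1)).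
    by apply: eqrM => //; apply: eqr_refl.
  by rewrite exprS mulrA ew; apply: eqr_refl.
have := order_gt0 g; case E: #[g]%g => [//|n] _.
have [|c zc] := @corner1_scalar (z ^+ n.+1).
  by have := cornerX n cz; rewrite -E expg_order.
exists c => //; apply/eqP => c0; move: zc; rewrite c0 scale0r => /eqr0 rz.
have := eqr_atr (zwn n); rewrite (in_rad_atr (in_radMr _ rz)) => /eqP.
by rewrite eq_sym (negPf atr_e).
Qed.

(** Passing to a power makes the degree of prime order, and an extraction of
    roots in [F] normalizes the scalar. *)
Lemma corner_prime_root g z c : corner g z -> c != 0 -> g != 1%g ->
  eqr (z ^+ #[g]%g) (c *: e) -> exists m d,
    let h := (g ^+ m.+1)%g in let u := d *: z ^+ m.+1 in
    [/\ prime #[h]%g, corner h u & eqr (u ^+ #[h]%g) e].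
Proof.
move=> cz c0 g1 zc; pose p := pdiv #[g]%g.
have p_pr : prime p by rewrite pdiv_prime // order_gt1.
have /dvdnP [m mE] := pdiv_dvd #[g]%g; rewrite -/p in mE.
case: m mE => [|m] mE; first by have := order_gt0 g; rewrite mE.
have [d dp] := exists_root c^-1 (prime_gt0 p_pr).
have hp : #[(g ^+ m.+1)%g]%g = p.
  by rewrite orderXdiv mE ?dvdn_mulr // mulKn.
exists m, d => /=; rewrite hp; split=> //; first exact/cornerZ/cornerX.
rewrite exprZn dp -exprM -mE -[X in eqr _ X]scale1r -(mulVf c0) -scalerA.
exact: eqrZ.
Qed.

Hypothesis no_FC_tau : forall h (th : tau h = h \/ tau h = h^-1%g),
  prime #[h]%g -> ~ in_gstar_var A (FC_tau F th).
Hypothesis no_FC2_star_s : forall h (oh : #[h]%g = 2%N) (th : tau h = h),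
  ~ in_gstar_var A (FC2_star_s F oh th).

Lemma FC_theta_expg h (th : tau h = h \/ tau h = h^-1%g)
    (t : subg_of <[h]>%G) i :
  sgval t = (h ^+ i)%g -> sgval (FC_theta tau t) = (tau h ^+ i)%g.
Proof.
move=> tE; rewrite subgK; first by rewrite tE ginvolX.
by apply: (ginvol_cycle th); apply: subgP.
Qed.

(** Powers of [z] stay symmetric, so they span some [FC_tau] with trivial
    action of [tau]. *)
Lemma no_symmetric_root g z c : corner g z -> ustar z = z -> tau g = g ->
  g != 1%g -> c != 0 -> ~ eqr (z ^+ #[g]%g) (c *: e).
Proof.
move=> cz sz tg g1 c0 zc;
  have [m [d [h_pr cu up]]] := corner_prime_root cz c0 g1 zc.
set h := (g ^+ m.+1)%g in h_pr cu up; set u := d *: _ in cu up.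
have th : tau h = h by rewrite ginvolX tg.
have su : ustar u = u by rewrite linearZ /= ustarX sz.
apply: (@no_FC_tau h (or_introl th) h_pr).
apply: (cyclic_galg_in_var (FC_tau_data F (or_introl th)) cu up) => t i ti;
  exists i; split.
  by rewrite (FC_theta_expg (or_introl th) ti) th.
by rewrite scale1r ustarM ustarX su est (corner_expr_comm _ cu);
  apply: eqr_refl.
Qed.

(** Here [ustar u] is a scalar multiple [mu *: u^-1] modulo the radical, with
    [mu ^+ p = 1]; rescaling [u] by a [p]-th root of unity multiplies [mu] by a
    square, which makes [mu] equal to 1 unless [p = 2] and [mu = -1]. *)
Lemma no_unitary_root g z c : corner g z -> tau g = g^-1%g ->
  g != 1%g -> c != 0 -> ~ eqr (z ^+ #[g]%g) (c *: e).
Proof.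
move=> cz tg g1 c0 zc;
  have [m [d [h_pr cu up]]] := corner_prime_root cz c0 g1 zc.
set h := (g ^+ m.+1)%g in h_pr cu up; set u := d *: _ in cu up.
set p := #[h]%g in h_pr up; have p_gt0 := prime_gt0 h_pr.
have th : tau h = h^-1%g by rewrite ginvolX tg expVgn.
have hp : (h^-1 = h ^+ p.-1)%g.
  by apply: (mulgI h); rewrite mulgV -expgS prednK // expg_order.
have [hu eu ue] := cu; have [hv ev ve] := corner_star cu.
have upe : eqr (ustar u ^+ p) e by rewrite -ustarX -est; apply: eqr_star.
have [mu muE] : exists mu, eqr (ustar u * u) (mu *: e).
  apply: corner1_scalar; have := cornerM (corner_star cu) cu.
  by rewrite th mulVg.
have upS : u * u ^+ p.-1 = u ^+ p by rewrite -exprS prednK.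
have [n pn] : exists n, p.-1 = n.+1.
  by exists p.-2; move: (prime_gt1 h_pr); case: (p) => [|[]].
have eup : e * u ^+ p.-1 = u ^+ p.-1 by rewrite pn exprS mulrA eu.
have en : e ^+ p.-1 = e by rewrite pn; elim: (n) => [|q IHq] //;
  rewrite exprS IHq.
have su : eqr (ustar u) (mu *: u ^+ p.-1).
  apply: (@eqr_trans _ _ _ _ _ (ustar u * u ^+ p)).
    by rewrite -{1}ve; apply: eqrM; [apply: eqr_refl | apply: eqr_sym].
  rewrite -upS mulrA -{2}eup scalerAl; apply: eqrM => //; exact: eqr_refl.
have mup : mu ^+ p = 1.
  have : eqr e (mu ^+ p *: e).
    apply: eqr_trans (eqr_sym upe) _; apply: eqr_trans (eqrX p su) _.
    rewrite exprZn; apply: eqrZ; rewrite exprAC; apply: eqr_trans (eqrX _ up) _.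
    by rewrite en; apply: eqr_refl.
  move=> /eqr_atr; rewrite linearZ /= => /(congr1 (fun a => a / atr e)).
  by rewrite mulfK // divff.
have mu0 : mu != 0.
  apply: contra_eqN mup => /eqP ->.
  by rewrite expr0n gtn_eqF // eq_sym oner_eq0.
(* r *: u satisfies the relations of FC_tau if r compensates mu *)
have scaled r : r ^+ p = 1 -> r * mu = r ^+ p.-1 -> False.
  move=> rp rmu; pose v := r *: u.
  have cv : corner h v by apply: cornerZ.
  have vp : eqr (v ^+ p) e by rewrite exprZn rp scale1r.
  apply: (@no_FC_tau h (or_intror th) h_pr).
  apply: (cyclic_galg_in_var (FC_tau_data F (or_intror th)) cv vp) => t i ti;
    exists (p.-1 * i)%N; split.
    by rewrite (FC_theta_expg (or_intror th) ti) th hp expgM.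
  rewrite scale1r ustarM ustarX est -(corner_expr_comm _ cv) exprM.
  apply: eqrM; last exact: eqr_refl.
  apply/eqr_sym/eqrX; rewrite linearZ /=; apply: eqr_trans (eqrZ r su) _.
  by rewrite scalerA rmu -exprZn; apply: eqr_refl.
have [p2|p_odd] := even_prime h_pr; last first.
  apply: (scaled (mu ^+ p.-1./2)).
    by rewrite exprAC mup expr1n.
  have r2 : mu ^+ p.-1./2 * mu ^+ p.-1./2 = mu ^+ p.-1.
    by rewrite -exprD addnn -[in RHS](odd_double_half p.-1) -subn1 oddB //
      p_odd.
  apply: (mulfI (expf_neq0 (p.-1./2) mu0)).
  rewrite mulrA r2 -exprS -exprSr prednK // mup exprAC mup expr1n //.
have /eqP : mu ^+ 2 = 1 by rewrite -p2.
rewrite sqrf_eq1 => /orP [/eqP mu1|/eqP mu1].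
  by apply: (scaled 1); rewrite ?expr1n // mu1 mulr1.
have oh : #[h]%g = 2%N := p2.
have th' : tau h = h by rewrite th hp p2 expg1.
apply: (@no_FC2_star_s h oh th').
apply: (cyclic_galg_in_var (FC2_star_s_data F oh th') cu up) => t i ti;
  exists i; split=> //.
have -> : sgn2 F t = (-1) ^+ i.
  rewrite /sgn2 -signr_odd -[t == _]val_eqE /= ti.
  by rewrite -order_dvdn oh dvdn2; case: odd.
rewrite ustarM ustarX est -(corner_expr_comm _ cu) scalerAl.
apply: eqrM; last exact: eqr_refl.
have := eqrX i su; rewrite mu1 p2 expr1 exprZn; exact: eqr_sym.
Qed.

(** Otherwise [x] has an inverse [w] modulo the radical, and [x^* * x], which is
    symmetric of degree [tau g * g], has the inverse [w * w^*].  Either this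
    degree is nontrivial and fixed by [tau], or [tau g = g^-1]. *)
Lemma corner_neq1_in_rad g x : corner g x -> g != 1%g -> in_rad x.
Proof.
move=> cx g1; apply: NNPP => nrx; have [hx ex xe] := cx.
have [y [cy xy0]] : exists y, corner g^-1 y /\ atr (x * y) != 0.
  apply: NNPP => ny; apply: nrx; apply: (corner_in_rad cx (atr_ghom hx g1)).
  by move=> y cy; apply/eqP/negPn/negP => xy0; apply: ny; exists y.
have [c xyc] : exists c, eqr (x * y) (c *: e).
  by apply: corner1_scalar; have := cornerM cx cy; rewrite mulgV.
have c0 : c != 0.
  apply: contra_neq xy0 => c0; have := eqr_atr xyc.
  by rewrite c0 scale0r linear0.
have [d d0 xd] : exists2 d, d != 0 & eqr (x ^+ #[g]%g) (d *: e).
  apply: (corner_root_of_scalar cx (w := c^-1 *: y)).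
    by have [_ ey _] := cy; rewrite -scalerAr ey.
  rewrite -scalerAr -[X in eqr _ X]scale1r -(mulVf c0) -scalerA; exact: eqrZ.
have [tg|tg] := eqVneq (tau g * g)%g 1%g.
  apply: (no_unitary_root cx _ g1 d0 xd).
  by apply: (mulIg g); rewrite tg mulVg.
pose w := d^-1 *: (e * x ^+ (#[g]%g).-1).
have xw : eqr (x * w) e.
  rewrite -scalerAr mulrA xe -exprS prednK ?order_gt0 //.
  by rewrite -[X in eqr _ X]scale1r -(mulVf d0) -scalerA; apply: eqrZ.
have wx : eqr (w * x) e.
  rewrite -scalerAl -mulrA -exprSr prednK ?order_gt0 //.
  rewrite -[X in eqr _ X]scale1r -(mulVf d0) -scalerA; apply: eqrZ.
  by case: #[g]%g (order_gt0 g) xd => // n _; rewrite exprS mulrA ex.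
have ew : e * w = w by rewrite -scalerAr mulrA ee.
have cz := cornerM (corner_star cx) cx.
have [c' c'0 zc] : exists2 c', c' != 0 &
    eqr ((ustar x * x) ^+ #[(tau g * g)%g]%g) (c' *: e).
  apply: (corner_root_of_scalar cz (w := w * ustar w));
    first by rewrite mulrA ew.
  rewrite -mulrA [x * _]mulrA;
    apply: (@eqr_trans _ _ _ _ _ (ustar x * (e * ustar w))).
    apply: eqrM; first exact: eqr_refl.
    by apply: eqrM => //; apply: eqr_refl.
  have [_ _ sxe] := corner_star cx.
  by rewrite mulrA sxe -ustarM -[X in eqr _ X]est; apply: eqr_star.
apply: (no_symmetric_root cz _ _ tg c'0 zc).
  by rewrite ustarM ustarK.
by rewrite ginvolM ginvolK.
Qed.

End PrimitiveCorner.

Section Structure.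
Context (F : closedFieldType) (F0 : [pchar F] =i pred0) (gT : finGroupType).
Context (tau : group_involution gT) (V : vectType F) (A : gstar_alg tau V).
Local Notation R := (unitz A).

(** For a maximal system [e], the complement of [\sum_i e i] is radical, so [x]
    is congruent to the sum of the [e i * x * e j]; those with [i != j] vanish,
    and the others were computed in the corners. *)
Lemma excluded_free_structure :
    (forall (W : lmodType F) (Q : gstar_alg tau W),
      excluded_alg Q -> ~ in_gstar_var A Q) ->
  exists (I : finType) (e : I -> R), [/\ idem_sys e,
    forall i j x, i != j -> e i * x * e j = 0 &
    forall g x, ghom g x -> exists c : I -> F, eqr x (\sum_i c i *: e i) /\
      (g != 1%g -> forall i, c i = 0)].
Proof.
move=> noQ; have [I [e [es e_max]]] := max_idem_sys A.
exists I, e; have [eh est e0 eM] := es.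
have ee i : e i * e i = e i by rewrite eM eqxx.
have off i j x : i != j -> e i * x * e j = 0.
  move=> ij; rewrite (_ : x = x.1 *: 1 + uinj A x.2); last first.
    case: x => c v; congr (_, _) => /=; last by rewrite scaler0 add0r.
    by rewrite addr0; apply/esym/mulr1.
  rewrite mulrDr mulrDl -scalerAr mulr1 -scalerAl eM (negPf ij) scaler0 add0r.
  rewrite [x.2](gcomps_sum A) linear_sum mulr_sumr mulr_suml big1 //= => g _.
  apply: NNPP => y0; set y := e i * _ * e j in y0.
  have hy : ghom g y.
    by apply: ghom1Mr => //; apply: ghom1Ml => //; apply/ghom_uinj/gcompsP.
  apply: (noQ _ _ (Excl_Mrho F tau g)).
  apply: (Mrho_in_var F0 (eh i) (eh j) hy) => //.
  - by rewrite eM (negPf ij).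
  - by rewrite eM eq_sym (negPf ij).
  - by rewrite /y !mulrA ee.
  - by rewrite /y -mulrA ee.
  - exact/eqP.
split=> // g x hx; have x0 : x.1 = 0 by case: hx.
have corner_mod i : exists c, eqr (e i * x * e i) (c *: e i) /\
    (g != 1%g -> c = 0).
  have prim f : ghom 1%g f -> ustar f = f -> f * f = f -> e i * f = f ->
      f != 0 -> f = e i.
    exact: maximal_corner es e_max i f.
  have cx := corner_proj (eh i) (ee i) hx.
  have noC := noQ _ _ (Excl_FC2_star F tau).
  have [g1|g1] := eqVneq g 1%g.
    rewrite g1 in cx.
    by have [c cE] := corner1_scalar F0 (eh i) (est i) (ee i) (e0 i) prim noC
      cx; exists c.
  exists 0; split=> //; rewrite scale0r; apply/eqr0.
  apply: (corner_neq1_in_rad F0 (eh i) (est i) (ee i) (e0 i) prim noC _ _ cx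
    g1).
    move=> h th h_pr; apply: noQ.
    by apply: Excl_FC_tau h_pr _ erefl th; apply: order_dvdG; rewrite inE.
  move=> h oh th; apply: noQ; apply: Excl_FC2_star_s.
  by rewrite -dvdn2 -oh; apply: order_dvdG; rewrite inE.
have [c cE] := fin_all_exists corner_mod.
exists c; split; last by move=> g1 i; apply: (cE i).2.
pose E := idem_sum e; pose e' := idem_compl e.
have EE : E * x * E = \sum_i e i * x * e i.
  rewrite /E /idem_sum mulr_suml mulr_suml; apply: eq_bigr => i _.
  rewrite mulr_sumr (bigD1 i) //= big1 ?addr0 // => j ji.
  by rewrite off // eq_sym.
apply: (@eqr_trans _ _ _ _ _ (E * x * E)); last first.
  by rewrite EE; apply: eqr_sum => i; apply: (cE i).1.
have Ee' : E = 1 - e' by rewrite /e' /idem_compl subKr.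
rewrite /eqr Ee' mulrBr mulr1 mulrBl mul1r opprB opprB addrA addrAC.
rewrite [x + _]addrC subrK -[e' * x]scale1r; apply: in_radZD.
  exact: (compl_mul_in_rad F0 es e_max x0).
apply: (mul_compl_in_rad F0 es e_max).
by rewrite scale1r /= x0 mulr0 subrr.
Qed.

End Structure.

(** * Codimensions and spaces of linear forms *)

Section MultilinearEvaluation.
Context (F : fieldType) (gT : finGroupType) (tau : group_involution gT).
Context (W : lmodType F) (Q : gstar_alg tau W).

Lemma mlin_monomE n (s : 'S_n) (g : {ffun 'I_n -> gT}) (e : {ffun 'I_n ->
  bool}) :
  mlin_monom s g e = [seq ((s i : nat), g i, e i) | i <- index_enum 'I_n]
    :> seq (gvar gT).
Proof.
rewrite /mlin_monom; elim: (index_enum _) => [|i r IHr].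
  by rewrite big_nil fm1.
by rewrite big_cons fmM fmU IHr.
Qed.

Lemma mlin_monom_neq_nil n (s : 'S_n) (g : {ffun 'I_n -> gT})
    (e : {ffun 'I_n -> bool}) :
  (0 < n)%N -> (mlin_monom s g e : seq (gvar gT)) != [::].
Proof.
move=> n0; rewrite mlin_monomE -size_eq0 size_map [size _](_ : _ = #|'I_n|).
  by rewrite card_ord -lt0n.
by rewrite cardT enumT.
Qed.

Lemma geval_monom phi (w : {fmonom gvar gT}) :
  geval Q phi << w >> = gword_eval Q phi w.
Proof. by rewrite /geval msuppU1 big_seq_fset1 mcoeffUU scale1r. Qed.

Lemma geval_sum phi (X : finType) (c : X -> F) (f : X -> free_alg F gT) :
  geval Q phi (\sum_x c x *: f x) = \sum_x c x *: geval Q phi (f x).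
Proof.
have ev0 : geval Q phi 0 = 0.
  by rewrite /geval msupp0 big_seq_fset0.
elim: (index_enum X) => [|x r IHr]; first by rewrite !big_nil ev0.
by rewrite !big_cons geval_lin IHr.
Qed.

Lemma mlin_monom_in n (s : 'S_n) (g : {ffun 'I_n -> gT})
    (e : {ffun 'I_n -> bool}) :
  @mlin F gT n << mlin_monom s g e >>.
Proof.
exists (fun m => (m == (s, g, e))%:R);
  rewrite (bigD1 (s, g, e)) //= eqxx scale1r.
by rewrite big1 ?addr0 // => m /negPf ->; rewrite scale0r.
Qed.

Lemma mlin_mone n (f : free_alg F gT) : (0 < n)%N -> mlin n f -> f@_mone = 0.
Proof.
move=> n0 [c ->]; rewrite raddf_sum big1 //= => m _.
rewrite mcoeffZ mcoeffU1; case: eqP => [m1|]; last by rewrite mulr0.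
by have := mlin_monom_neq_nil m.1.1 m.1.2 m.2 n0; rewrite m1 fm1.
Qed.

End MultilinearEvaluation.

Section CodimensionBounds.
Context (F : fieldType) (gT : finGroupType) (tau : group_involution gT).
Context (V : lmodType F) (A : gstar_alg tau V).

(** If the vanishing of [L] makes a multilinear polynomial an identity, then [L]
    is injective modulo the identities. *)
Lemma gstar_codim_le n (U : vectType F) (L : free_alg F gT -> U) :
    linear L -> (forall f, mlin n f -> L f = 0 -> gstar_id A f) ->
  (gstar_codim A n <= \dim {:U})%N.
Proof.
move=> Llin LI; have [b [bP bU]] := gstar_codimP A n.
have L0 : L 0 = 0.
  by apply: (addIr (L 0)); have := Llin 1 0 0; rewrite !scale1r !addr0 add0r.
have Lsum r (c : 'I_(gstar_codim A n) -> F) :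
    L (\sum_(i <- r) c i *: b i) = \sum_(i <- r) c i *: L (b i).
  by elim: r => [|i r IHr]; rewrite ?big_nil // !big_cons Llin IHr.
rewrite leqNgt; apply/negP => lt.
have [|c [c0 [i ci]]] := @dependent_family _ U 'I_(gstar_codim A n) (L \o b).
  by rewrite card_ord.
have ml0 : @mlin F gT n 0.
  by exists (fun=> 0); rewrite big1 // => m _; rewrite scale0r.
have mlZD a u v : @mlin F gT n u -> @mlin F gT n v -> mlin n (a *: u + v).
  move=> [x ->] [y ->]; exists (fun m => a * x m + y m).
  rewrite scaler_sumr -big_split; apply: eq_bigr => m _ /=.
  by rewrite scalerA scalerDl.
have [c' [_ c'U]] := bU 0 ml0.
have e1 : c' = [ffun=> 0].
  apply: c'U; rewrite big1 ?subr0; first exact: gstar_id0.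
  by move=> j _; rewrite ffunE scale0r.
have e2 : c' = [ffun j => - c j].
  apply: c'U; under eq_bigr do rewrite ffunE scaleNr.
  rewrite sumrN opprK add0r; apply: LI; last by rewrite Lsum.
  by elim/big_rec: _ => // j y _ yP; apply: mlZD.
case/eqP: ci; have /ffunP /(_ i) := etrans (esym e1) e2.
by rewrite !ffunE => /esym/eqP; rewrite oppr_eq0 => /eqP.
Qed.

Lemma gstar_codim_ge n (X : finType) (f : X -> free_alg F gT) :
    (forall x, mlin n (f x)) ->
    (forall c, gstar_id A (\sum_x c x *: f x) -> forall x, c x = 0) ->
  (#|X| <= gstar_codim A n)%N.
Proof.
move=> fP find; have [b [bP bU]] := gstar_codimP A n.
set d := gstar_codim A n in b bP bU *.
have fE x : exists c : {ffun 'I_d -> F}, gstar_id A (f x - \sum_i c i *: b i).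
  by have [c [cI _]] := bU _ (fP x); exists c.
have [C CE] := fin_all_exists fE.
rewrite leqNgt; apply/negP => lt.
have [|c [c0 [x cx]]] := @dependent_family F 'rV[F]_d X (fun x => \row_i C x i).
  by rewrite dimvf /dim /= mul1n.
case/eqP: cx; apply: find.
suff -> : \sum_x c x *: f x = \sum_x c x *: (f x - \sum_i C x i *: b i).
  elim/big_rec: _ => [|y z _ zI]; first exact: gstar_id0.
  exact: gstar_idZD.
under [RHS]eq_bigr do rewrite scalerBr scaler_sumr.
rewrite sumrB [X in _ = _ - X](_ : _ = 0) ?subr0 //.
rewrite exchange_big big1 //= => i _.
under eq_bigr do rewrite scalerA.
rewrite -scaler_suml [X in X *: _](_ : _ = (\sum_x c x *: (\row_i C x i)) 0 i).
  by rewrite c0 mxE scale0r.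
by rewrite summxE; apply: eq_bigr => y _; rewrite !mxE.
Qed.

(** Evaluating a linear relation at the valuation of [y] isolates the
    coefficient of [y]. *)
Lemma gstar_codim_ge_delta (W : lmodType F) (Q : gstar_alg tau W) n
    (X : finType) (m : X -> 'S_n * {ffun 'I_n -> gT} * {ffun 'I_n -> bool}) :
    in_gstar_var A Q ->
    (forall y, exists phi, exists2 l : W -> F,
      scalar l /\ (forall k g, gcomp Q g (phi k g)) &
      forall x, l (gword_eval Q phi (mlin_monom (m x).1.1 (m x).1.2 (m x).2)) =
        (x == y)%:R) ->
  (#|X| <= gstar_codim A n)%N.
Proof.
move=> AQ H; apply: (gstar_codim_ge
  (f := fun x => << mlin_monom (m x).1.1 (m x).1.2 (m x).2 >>)).
  by move=> x; apply: mlin_monom_in.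
move=> c /AQ [_ cQ] y; have [phi [l [lL phiH] lE]] := H y.
have l0 : l 0 = 0.
  by apply: (addIr (l 0)); have := lL 1 0 0; rewrite scale1r mul1r !addr0 add0r.
have := congr1 l (cQ phi phiH); rewrite geval_sum l0.
have -> : l (\sum_x c x *: geval Q phi << mlin_monom (m x).1.1 (m x).1.2 (m
  x).2 >>)
    = \sum_x c x * (x == y)%:R.
  elim: (index_enum X) => [|x r IHr]; first by rewrite !big_nil l0.
  by rewrite !big_cons lL IHr geval_monom lE.
rewrite (bigD1 y) //= eqxx mulr1 big1 ?addr0 // => x /negPf ->.
by rewrite mulr0.
Qed.

End CodimensionBounds.

(** * Exponential growth of the excluded algebras *)

Section GroupAlgebraGrowth.
Context (F : closedFieldType) (gT : finGroupType) (tau : group_involution gT).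
Context (V : lmodType F) (A : gstar_alg tau V).
Context (H : finGroupType) (deg : H -> gT) (theta : H -> H) (chi : H -> F).
Context (D : galg_data tau deg theta chi).

(** The augmentation of a group algebra: being multiplicative, it evaluates a
    word letter by letter. *)
Definition galg_aug (a : {ffun H -> F^o}) : F := \sum_y a y.

Lemma galg_aug_scalar : scalar galg_aug.
Proof.
move=> c a b; rewrite /galg_aug mulr_sumr -big_split.
by apply: eq_bigr => y _; rewrite /= !ffunE.
Qed.

Lemma galg_augM a b : galg_aug (galg_mul a b) = galg_aug a * galg_aug b.
Proof.
rewrite /galg_aug mulr_suml; under eq_bigr do rewrite ffunE.
rewrite exchange_big; apply: eq_bigr => y _ /=.
by rewrite (reindex_inj (mulgI y)) mulr_sumr; apply: eq_bigr => z _;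
  rewrite mulKg.
Qed.

Lemma galg_aug_word phi (w : seq (gvar gT)) : w != [::] ->
  galg_aug (gword_eval (galg D) phi w) =
  \prod_(x <- w) galg_aug (gvar_eval (galg D) phi x).
Proof.
case: w => [//|x w] _ /=; rewrite big_cons.
elim: w (gvar_eval _ phi x) => [|y w IHw] a; first by rewrite big_nil mulr1.
by rewrite /= IHw galg_augM big_cons mulrA.
Qed.

(** Variables are numbered by natural numbers, so the bits [y] have to be
    extended beyond their range. *)
Definition delta_choice n (y : {ffun 'I_n.+1 -> bool}) (k : nat) : bool :=
  y (inord k).

Lemma prod_delta n (x y : {ffun 'I_n -> bool}) :
  \prod_(i < n) (x i == y i)%:R = (x == y)%:R :> F.
Proof.
have [->|xy] := eqVneq x y; first by rewrite big1 // => i _; rewrite eqxx.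
have [i xyi] : exists i, x i != y i.
  apply: NNPP => nxy; case/eqP: xy; apply/ffunP => i; apply/eqP.
  by apply: contra_notT nxy => xyi; exists i.
by rewrite (bigD1 i) //= (negPf xyi) mul0r.
Qed.

(** One bit per variable can be stored in the degrees if they are nontrivial. *)
Lemma graded_galg_growth h n : deg h != 1%g -> in_gstar_var A (galg D) ->
  (2 ^ n.+1 <= gstar_codim A n.+1)%N.
Proof.
move=> h1 AQ; have [dM _ _ _ _ _ _] := D.
have d1 : deg 1%g = 1%g by apply: (mulgI (deg 1%g)); rewrite -dM !mulg1.
pose u (b : bool) : H := if b then h else 1%g.
pose basis z : {ffun H -> F^o} := [ffun y => (y == z)%:R].
have aug_basis z : galg_aug (basis z) = 1.
  rewrite /galg_aug (bigD1 z) //= ffunE eqxx big1 ?addr0 // => y /negPf yz.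
  by rewrite ffunE yz.
have <- : #|{ffun 'I_n.+1 -> bool}| = (2 ^ n.+1)%N.
  by rewrite card_ffun card_bool card_ord.
apply: (@gstar_codim_ge_delta _ _ _ _ A _ (galg D) n.+1 {ffun 'I_n.+1 -> bool}
  (fun x => (1%g, [ffun i => deg (u (x i))], [ffun=> false])) AQ) => y.
pose phi k g := if deg (u (delta_choice y k)) == g then basis (u (delta_choice
  y k))
  else 0.
exists phi, galg_aug.
  split=> [|k g]; first exact: galg_aug_scalar.
  rewrite /phi; case: eqP => [<-|_]; last exact: galg_comp0.
  by move=> z; rewrite ffunE; case: (eqVneq z _) => [->|//]; rewrite eqxx.
move=> x; rewrite galg_aug_word ?mlin_monom_neq_nil // mlin_monomE big_map.
rewrite -prod_delta; apply: eq_bigr => i _.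
rewrite /gvar_eval /= !ffunE perm1 /phi /delta_choice inord_val.
have deg_inj b b' : (deg (u b) == deg (u b')) = (b == b').
  by case: b b' => [] [] //=; rewrite ?eqxx // d1 ?[1%g == _]eq_sym (negPf h1).
rewrite deg_inj eq_sym; case: eqP => _; first exact: aug_basis.
by rewrite /galg_aug big1 // => z _; rewrite ffunE.
Qed.

End GroupAlgebraGrowth.

(** One bit per variable can be stored in the stars. *)
Lemma FC2_star_growth (F : closedFieldType) (F0 : [pchar F] =i pred0)
    (gT : finGroupType) (tau : group_involution gT) (V : lmodType F)
    (A : gstar_alg tau V) n :
  in_gstar_var A (FC2_star F tau) -> (2 ^ n.+1 <= gstar_codim A n.+1)%N.
Proof.
move=> AQ.
(* the orthogonal idempotents of the group algebra, exchanged by the star *)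
pose idem (b : bool) : {ffun 'Z_2 -> F^o} :=
  [ffun y => 2^-1 * (if b then sgn2 F y else 1)].
have h2 : 2^-1 + 2^-1 = 1 :> F.
  by rewrite -[2^-1]mul1r -mulrDl -(natrD _ 1 1) divff // (proj1 (pcharf0P F)
    F0).
have aug_idem b : galg_aug (idem b) = (~~ b)%:R.
  rewrite /galg_aug big_ord_recl big_ord1 /= !ffunE /sgn2 /=.
  by case: b; rewrite ?mulr1 ?mulrN1 ?subrr ?h2.
have star_idem b : galg_star id (@sgn2 F 'Z_2) (idem b) = idem (~~ b).
  apply/ffunP => y; rewrite !ffunE /= /sgn2; case: b; case: eqP => _ /=;
  by rewrite ?mulr1 ?mul1r ?mulrN1 ?mulNr ?mul1r ?opprK.
have <- : #|{ffun 'I_n.+1 -> bool}| = (2 ^ n.+1)%N.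
  by rewrite card_ffun card_bool card_ord.
apply: (@gstar_codim_ge_delta _ _ _ _ A _ (FC2_star F tau) n.+1
  {ffun 'I_n.+1 -> bool} (fun x => (1%g, [ffun=> 1%g], x)) AQ) => y.
pose phi k g := if g == 1%g :> gT then idem (delta_choice y k) else 0.
exists phi, (@galg_aug F 'Z_2).
  split=> [|k g]; first exact: galg_aug_scalar.
  rewrite /phi; case: eqP => [->|_]; last exact: galg_comp0.
  by move=> z; rewrite eqxx.
move=> x; rewrite galg_aug_word ?mlin_monom_neq_nil // mlin_monomE big_map.
rewrite -prod_delta; apply: eq_bigr => i _.
rewrite /gvar_eval /= !ffunE perm1 /phi eqxx /delta_choice inord_val.
by case: (x i); rewrite ?star_idem aug_idem; case: (y i).
Qed.

Lemma perm_of_uniq n (t : seq 'I_n) : uniq t -> size t = n ->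
  exists s : 'S_n, [seq s i | i <- index_enum 'I_n] = t.
Proof.
move=> ut /eqP st; have /tuple_uniqP ti : uniq (Tuple st) by [].
exists (perm ti); rewrite (eq_map (fun i => permE ti i)).
by have := map_tnth_enum (Tuple st); rewrite enumT.
Qed.

Section MrhoGrowth.
Context (F : closedFieldType) (gT : finGroupType) (tau : group_involution gT).
Context (V : lmodType F) (A : gstar_alg tau V) (g : gT).
Local Notation Q := (Mrho_alg F tau g).
Local Notation M := (subvs_of (Mrho_space F tau g)).

Lemma Mrho_word phi (w : seq (gvar gT)) : w != [::] ->
  vsval (gword_eval Q phi w) = \prod_(x <- w) vsval (gvar_eval Q phi x).
Proof.
case: w => [//|x w] _ /=; rewrite big_cons.
elim: w (gvar_eval _ phi x) => [|y w IHw] a; first by rewrite big_nil mulr1.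
by rewrite /= IHw vsval_Mrho_mul big_cons mulrA.
Qed.

Lemma Mmx_mulr (a b c d a' b' c' d' : F) : Mmx a b c d * Mmx a' b' c' d' =
  Mmx (a * a') (b * b') (a * c' + c * b') (b * d' + d * a').
Proof. exact: MmxM. Qed.

Lemma Mmx_prod (T : Type) (al be : T -> F) r :
  \prod_(i <- r) Mmx (al i) (be i) 0 0 =
  Mmx (\prod_(i <- r) al i) (\prod_(i <- r) be i) 0 0.
Proof.
elim: r => [|i r IHr].
  rewrite !big_nil; apply/matrixP => i j; rewrite MmxE !mxE.
  by case: i j => [[|[|[|[|//]]]] ?] [[|[|[|[|//]]]] ?].
by rewrite !big_cons IHr Mmx_mulr !mulr0 !mul0r addr0.
Qed.

Definition Mrho_elt (a b c d : F) : M := vsproj _ (Mmx a b c d).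

Lemma Mrho_eltE a b c d : vsval (Mrho_elt a b c d) = Mmx a b c d.
Proof. by rewrite vsprojK // Mmx_mem. Qed.

(** One bit per variable of degree 1 can be stored in its side of the one
    variable of degree [g]. *)
Lemma Mrho_growth n : in_gstar_var A Q -> (2 ^ n <= gstar_codim A n.+1)%N.
Proof.
move=> AQ; pose wd := widen_ord (leqnSn n).
have wd_max i : (wd i == ord_max) = false.
  by apply/eqP => /(congr1 val) /= /eqP; rewrite ltn_eqF.
have wd_inj : injective wd by move=> i j /(congr1 val) /= ij; apply: val_inj.
(* the variables whose bit is set stand to the left of the last variable *)
pose t (x : {ffun 'I_n -> bool}) : seq 'I_n.+1 :=
  [seq wd i | i <- enum 'I_n & x i] ++
  ord_max :: [seq wd i | i <- enum 'I_n & ~~ x i].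
have max_notin (r : seq 'I_n) : ord_max \notin [seq wd i | i <- r].
  by apply/mapP => -[i _ /esym/eqP]; rewrite wd_max.
have t_uniq x : uniq (t x).
  have eu : uniq (enum 'I_n) := enum_uniq _.
  rewrite cat_uniq /= max_notin !(map_inj_uniq wd_inj) !(filter_uniq _ eu) /=.
  rewrite negb_or max_notin /= andbT -all_predC; apply/allP => _ /mapP [i + ->].
  rewrite mem_filter => /andP [xi _] /=; rewrite (mem_map wd_inj) mem_filter.
  by rewrite (negPf xi).
have t_size x : size (t x) = n.+1.
  rewrite size_cat /= !size_map addnS -size_cat; congr _.+1.
  by rewrite size_cat !size_filter count_predC size_enum_ord.
have [s sE] := fin_all_exists (fun x => perm_of_uniq (t_uniq x) (t_size x)).
pose dg (v : 'I_n.+1) := if v == ord_max then g else 1%g.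
have <- : #|{ffun 'I_n -> bool}| = (2 ^ n)%N.
  by rewrite card_ffun card_bool card_ord.
apply: (@gstar_codim_ge_delta _ _ _ _ A _ Q n.+1 {ffun 'I_n -> bool}
  (fun x => (s x, [ffun i => dg (s x i)], [ffun=> false])) AQ) => y.
pose bit k := if insub k is Some i then y i else false.
pose phi k h : M :=
  if k == n then if h == g then Mrho_elt 0 0 1 0 else 0
  else if h == 1%g then Mrho_elt (bit k)%:R (~~ bit k)%:R 0 0 else 0.
exists phi, (fun u : M => vsval u (inord 0) (inord 1)).
  split=> [c u v|k h]; first by rewrite vsval_MrhoZD !mxE.
  rewrite /phi; case: ifP => _; case: eqP => [->|_];
    try exact: Mrho_comp0; apply/(Mrho_compE _ (Mrho_eltE _ _ _ _)).
    by split=> //; rewrite eqxx.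
  by split=> //; rewrite eqxx.
move=> x; rewrite Mrho_word ?mlin_monom_neq_nil // mlin_monomE.
have -> : [seq (nat_of_ord (s x i), [ffun i => dg (s x i)] i, [ffun=> false] i)
      | i <- index_enum 'I_n.+1] = [seq (nat_of_ord v, dg v, false) | v <- t x].
  by rewrite -sE -map_comp; apply: eq_map => i /=; rewrite !ffunE.
have phi_wd i : vsval (phi (wd i) (dg (wd i))) = Mmx (y i)%:R (~~ y i)%:R 0 0.
  rewrite /phi /dg wd_max eqxx ltn_eqF /=; last exact: ltn_ord.
  by rewrite Mrho_eltE /bit valK.
rewrite big_map big_cat big_cons /= !big_map /gvar_eval /=.
rewrite 2!(eq_bigr _ (fun i _ => phi_wd i)) !Mmx_prod.
have -> : vsval (phi n (dg ord_max)) = Mmx 0 0 1 0.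
  by rewrite /phi /dg !eqxx Mrho_eltE.
rewrite !Mmx_mulr MmxE /= !inordK // !(mulr0, mul0r, mul1r, addr0, add0r).
rewrite -prod_delta [RHS](bigID x) /= !big_filter !big_enum_cond /=.
congr (_ * _); apply: eq_bigr => i.
  by move=> ->; case: (y i).
by move=> /negPf ->; case: (y i).
Qed.

End MrhoGrowth.

Lemma excluded_growth (F : closedFieldType) (F0 : [pchar F] =i pred0)
    (gT : finGroupType) (tau : group_involution gT) (V W : lmodType F)
    (A : gstar_alg tau V) (Q : gstar_alg tau W) n :
  excluded_alg Q -> in_gstar_var A Q -> (2 ^ n <= gstar_codim A n.+1)%N.
Proof.
have le : (2 ^ n <= 2 ^ n.+1)%N by rewrite leq_exp2l.
have cyc h (c : nat) : #[h]%g = c -> (1 < c)%N ->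
    sgval (subg <[h]>%G h) != 1%g :> gT.
  by move=> <- c1; rewrite subgK ?cycle_id // -order_gt1.
move=> exQ; case: W Q / exQ.
- by move=> AQ; apply: leq_trans le (FC2_star_growth F0 n AQ).
- by move=> g AQ; apply: Mrho_growth AQ.
- move=> p h p_pr _ oh th AQ; apply: leq_trans le _.
  exact: graded_galg_growth (cyc h p oh (prime_gt1 p_pr)) AQ.
- move=> s _ os ts AQ; apply: leq_trans le _.
  exact: graded_galg_growth (cyc s 2%N os isT) AQ.
Qed.

Section GrowthBounds.
Context (F : fieldType) (gT : finGroupType) (tau : group_involution gT).
Context (V : lmodType F) (A : gstar_alg tau V).

Lemma polynomial_growth_of_bound (K q : nat) :
  (forall n, (0 < n)%N -> (gstar_codim A n <= K * n ^ q)%N) ->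
  polynomial_growth A.
Proof.
move=> bound; exists (INR K), (INR q); split; [exact: pos_INR|split].
  exact: pos_INR.
move=> n n0; rewrite Rpower_pow; last by apply: lt_0_INR; apply/ltP.
rewrite -pow_INR -mult_INR; apply: le_INR; apply/leP.
suff -> : Nat.pow n q = (n ^ q)%N by exact: bound.
by elim: q {bound} => [|q /= ->] //; rewrite expnS.
Qed.

(** Along [n = 2 ^ k] the exponent [2 ^ k - 1] outgrows every [a + k * T]. *)
Lemma exponential_not_polynomial :
  (forall n, (2 ^ n <= gstar_codim A n.+1)%N) -> ~ polynomial_growth A.
Proof.
move=> big [al [t [al0 [t0 bound]]]].
have [T tT] := INR_unbounded t; have [a ala] := INR_unbounded al.
have bnd n : (2 ^ n <= a * n.+1 ^ T)%N.
  apply: leq_trans (big n) _; apply/leP/INR_le; rewrite mult_INR.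
  have -> : INR (n.+1 ^ T) = Rpower (INR n.+1) (INR T).
    rewrite Rpower_pow; last by apply: lt_0_INR; apply/ltP.
    by elim: (T) => [|q IHq]; rewrite ?expn0 // expnS mult_INR IHq.
  apply: Rle_trans (bound n.+1 isT) _.
  have p0 : Rle 0 (Rpower (INR n.+1) t) by apply/Rlt_le/exp_pos.
  have pT : Rle (Rpower (INR n.+1) t) (Rpower (INR n.+1) (INR T)).
    have n1 : Rle (INR 1) (INR n.+1) by apply/le_INR/leP.
    have [lt1|<-] := Rle_lt_or_eq_dec _ _ n1.
      by apply: Rle_Rpower; [exact: n1 | lra].
    by rewrite /Rpower ln_1 !Rmult_0_r; apply: Rle_refl.
  apply: Rmult_le_compat => //; lra.
have bnd2 k : (2 ^ k <= a + k * T + 1)%N.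
  have := bnd (2 ^ k).-1; rewrite prednK ?expn_gt0 // -expnM => le.
  have {}le : (2 ^ (2 ^ k).-1 <= 2 ^ (a + k * T))%N.
    apply: leq_trans le _; rewrite expnD leq_mul2r ltnW ?orbT //.
    exact: ltn_expl.
  rewrite leq_exp2l // in le.
  by rewrite -(@prednK (2 ^ k)) ?expn_gt0 // addn1 ltnS.
pose m := (a + 2 * T + 1)%N.
have m2 : (m < 2 ^ m)%N by apply: ltn_expl.
have := bnd2 (m * 2)%N; rewrite expnM leqNgt => /negP; apply.
apply: (@leq_trans (m.+1 ^ 2)); last by rewrite leq_exp2r.
by rewrite -mulnn /m; nia.
Qed.
End GrowthBounds.

(** * Polynomial growth *)

Section OrthogonalWords.
Context (R : nzRingType) (I : eqType) (e : I -> R).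
Hypothesis off : forall i j x, i != j -> e i * x * e j = 0.
Context (T : Type) (x : T -> R) (lab : T -> option I).
(* evaluating a variable at a letter of another degree gives 0 *)
Hypothesis labE : forall t i, lab t = Some i -> x t = e i \/ x t = 0.

Lemma word_after_idem i j y r : i != j -> has (fun t => lab t == Some j) r ->
  e i * y * \prod_(t <- r) x t = 0.
Proof.
move=> ij; elim: r y => [//|t r IHr] y /=; rewrite big_cons mulrA.
case/orP => [/eqP /labE [->|->]|jr].
- by rewrite off // mul0r.
- by rewrite mulr0 mul0r.
- by rewrite -(mulrA (e i)) IHr.
Qed.

Lemma word_two_idem i j r : i != j -> has (fun t => lab t == Some i) r ->
  has (fun t => lab t == Some j) r -> \prod_(t <- r) x t = 0.
Proof.
move=> ij; elim: r => [//|t r IHr] /=; rewrite big_cons.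
have head k l : lab t = Some k -> k != l -> has (fun t => lab t == Some l) r ->
    x t * \prod_(t <- r) x t = 0.
  move=> tk kl lr; have [->|->] := labE tk; last by rewrite mul0r.
  by rewrite -[e k]mulr1 (word_after_idem _ kl).
case/orP => [/eqP ti|ir]; case/orP => [/eqP tj|jr].
- by move: ij; rewrite ti in tj; case: tj => ->; rewrite eqxx.
- exact: head ti ij jr.
- by apply: head tj _ ir; rewrite eq_sym.
- by rewrite IHr ?mulr0.
Qed.

End OrthogonalWords.

Section UpperBound.
Context (F : closedFieldType) (F0 : [pchar F] =i pred0) (gT : finGroupType).
Context (tau : group_involution gT) (V : vectType F) (A : gstar_alg tau V).
Local Notation R := (unitz A).
Context (I : finType) (e : I -> R) (es : idem_sys e).
Hypothesis off : forall i j x, i != j -> e i * x * e j = 0.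
Hypothesis scalar_mod_rad : forall g x, ghom g x ->
  exists c : I -> F, eqr x (\sum_i c i *: e i) /\
    (g != 1%g -> forall i, c i = 0).

(** An index of an idempotent, or a degree with a place in a basis of the
    radical part of that degree.  All these bases share the index bound
    [\dim {:V}]; the shorter ones are padded with 0. *)
Definition letter := (I + gT * 'I_(\dim {:V}))%type.

Lemma letters_exist : exists b : letter -> V,
  [/\ forall i, uinj A (b (inl i)) = e i,
      forall p, gcomp A p.1 (b (inr p)) /\ in_rad (uinj A (b (inr p))) &
      forall g v, gcomp A g v -> exists c : letter -> F,
        v = \sum_t c t *: (if (if t is inr p then p.1 else 1%g) == g
                           then b t else 0)].
Proof.
have [eh est _ _] := es.
have exU g : exists U : {vspace V}, forall v, v \in U <->
    gcomp A g v /\ in_rad (uinj A v).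
  apply: vspace_of_closed.
    by split; [apply: gcomp0 | rewrite linear0; apply: in_rad0].
  move=> c u v [gu ru] [gv rv]; split; first exact: gcompZD.
  by rewrite linearP; apply: in_radZD.
have [U UE] := fin_all_exists exU.
pose b (t : letter) : V :=
  match t with inl i => (e i).2 | inr p => (vbasis (U p.1))`_p.2 end.
have bI i : uinj A (b (inl i)) = e i by rewrite /b -(ghomE (eh i)).
exists b; split=> [//|[g j]|g v gv] /=.
  apply/UE; have [lt|le] := ltnP j (\dim (U g)).
    by apply/vbasis_mem/mem_nth; rewrite size_tuple.
  by rewrite nth_default ?mem0v // size_tuple.
have [c [vc cg]] := scalar_mod_rad (ghom_uinj gv).
pose w := v - \sum_i c i *: b (inl i).
have wU : w \in U g.
  apply/UE; split.
    rewrite /w addrC -scaleN1r; apply: gcompZD => //.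
    elim/big_rec: _ => [|i u _ gu]; first exact: gcomp0.
    have [g1|/cg ->] := eqVneq g 1%g; last by rewrite scale0r add0r.
    by apply: gcompZD => //; have [] := eh i; rewrite g1.
  rewrite /w linearB linear_sum /=.
  by under eq_bigr do rewrite linearZ /= bI.
pose d (t : letter) : F := match t with inl i => c i
  | inr p => if p.1 == g then
      if insub (val p.2) is Some k then coord (vbasis (U g)) k w else 0 else 0
        end.
exists d; rewrite big_sumType /=.
have -> : v = \sum_i c i *: b (inl i) + w by rewrite /w addrC subrK.
congr (_ + _).
  apply: eq_bigr => i _; case: eqP => // /eqP; rewrite eq_sym => /cg ->.
  by rewrite !scale0r.
pose G (j : nat) : V := (if insub j is Some k then coord (vbasis (U g)) k w
  else 0) *: (vbasis (U g))`_j.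
rewrite -(pair_bigA _ (fun h (j : 'I_(\dim {:V})) =>
  d (inr (h, j)) *: (if h == g then b (inr (h, j)) else 0))) /=.
rewrite (bigD1 g) //= eqxx [X in _ = _ + X]big1 ?addr0 => [|h /negPf ->];
  last first.
  by rewrite big1 // => j _; rewrite scaler0.
have GE (j : 'I_(\dim {:V})) : ~~ (j < \dim (U g))%N -> G j = 0.
  by move=> jU; rewrite /G insubF ?scale0r //; apply: negPf.
rewrite {1}(coord_vbasis wU).
transitivity (\sum_(k < \dim (U g)) G k).
  by apply: eq_bigr => k _; rewrite /G valK.
rewrite (big_ord_widen _ G (dimvS (subvf (U g)))) big_mkcond /=.
by apply: eq_bigr => j _; case: ifPn => [//|/GE].
Qed.

Definition in_rad_letter (t : letter) : bool := if t is inr _ then true else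
  false.

(** A constant word overwritten at [q] places, which may be repeated. *)
Definition decode n q (c : {ffun 'I_q -> 'I_n * letter} * letter) (k : 'I_n) :
    letter :=
  if [pick j | (c.1 j).1 == k] is Some j then (c.1 j).2 else c.2.

Lemma decode_surj n q (w : 'I_n.+1 -> letter) :
    (#|[set k | in_rad_letter (w k)]| <= q)%N ->
    (forall k l i j, w k = inl i -> w l = inl j -> i = j) ->
  exists c, decode (n := n.+1) (q := q) c =1 w.
Proof.
set Y := [set k | _] => Yq same.
pose t0 := if [pick k | ~~ in_rad_letter (w k)] is Some k then w k else w ord0.
pose at_ (j : nat) := nth ord0 (enum Y) j.
exists ([ffun j : 'I_q => (at_ j, w (at_ j))], t0) => k; rewrite /decode /=.
case: pickP => [j|none]; first by rewrite !ffunE /= => /eqP ->.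
have kY : ~~ in_rad_letter (w k).
  apply/negP => kY; have kE : k \in enum Y by rewrite mem_enum inE.
  have lt : (index k (enum Y) < q)%N.
    by apply: leq_trans Yq; rewrite cardE index_mem.
  by have := none (Ordinal lt); rewrite ffunE /= /at_ nth_index ?eqxx.
rewrite /t0; case: pickP => [l|/(_ k)]; last by rewrite kY.
case El: (w l) => [i|//] _; case Ek: (w k) kY => [j|//] _.
by rewrite (same _ _ _ _ El Ek).
Qed.

(** Multilinear polynomials need only be evaluated at words in the letters that
    are not annihilated for trivial reasons.  Fewer than [q] letters of such a
    word are radical and the others are equal, so these words are parametrized
    by [n ^ q] choices of places, up to a constant factor. *)
Lemma polynomial_codim_bound : exists K q,
  forall n, (0 < n)%N -> (gstar_codim A n <= K * n ^ q)%N.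
Proof.
have [b [bI bJ bspan]] := letters_exist.
have [eh est _ _] := es.
have [q radq] := in_rad_prod F0 (unitz A).
exists (#|{: letter}| ^ q * #|{: letter}| * \dim {:V})%N, q => -[//|n] _.
pose deg (t : letter) := if t is inr p then p.1 else 1%g.
pose val_ t g := if deg t == g then b t else 0.
pose phi_ (w : 'I_n.+1 -> letter) k g := val_ (w (inord k)) g.
have uS phi k g ep : uinj A (gvar_eval A phi (k, g, ep)) =
    if ep then ustar (uinj A (phi k g)) else uinj A (phi k g).
  by rewrite /gvar_eval /=; case: ep.
have vanish (w : 'I_n.+1 -> letter) : ~ (exists c, decode (n := n.+1) (q := q)
  c =1 w) ->
    forall s g ep, gword_eval A (phi_ w) (@mlin_monom gT n.+1 s g ep) = 0.
  move=> nw s g ep; apply: (@uinj_inj _ _ _ _ A); rewrite linear0.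
  rewrite gword_eval_prod ?mlin_monom_neq_nil // mlin_monomE big_map.
  have xE i : uinj A (gvar_eval A (phi_ w) (s i : nat, g i, ep i)) =
      if ep i then ustar (uinj A (val_ (w (s i)) (g i)))
      else uinj A (val_ (w (s i)) (g i)).
    by rewrite uS /phi_ inord_val.
  have [le|lt] := leqP q #|[set k | in_rad_letter (w k)]|.
    apply: (radq _ _ (fun i => in_rad_letter (w (s i)))).
      move=> i wi; have rv : in_rad (uinj A (val_ (w (s i)) (g i))).
        case: (w (s i)) wi => // p _; rewrite /val_; case: eqP => _.
          by have [] := bJ p.
        by rewrite linear0; apply: in_rad0.
      by rewrite xE; case: (ep i) => //; apply: in_rad_star.
    rewrite -sum1_count (leq_trans le) // -sum1_card.
    rewrite [X in (_ <= X)%N](reindex_inj (@perm_inj _ s^-1%g)) /=.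
    rewrite leq_eqVlt; apply/orP; left; apply/eqP; apply: eq_bigl => k.
    by rewrite inE permKV.
  have [same|nsame] := classic (forall k l i j, w k = inl i -> w l = inl j -> i
    = j).
    by case: nw; apply: decode_surj (ltnW lt) same.
  have [k [l [i [j [wk wl ij]]]]] : exists k l i j,
      [/\ w k = inl i, w l = inl j & i != j].
    apply: NNPP => none; apply: nsame => k l i j wk wl; apply/eqP.
    by apply: contra_notT none => ij; exists k, l, i, j.
  pose lab p := if w (s p) is inl m then Some m else None.
  have at_ p m : w p = inl m -> has (fun p => lab p == Some m) (index_enum
    'I_n.+1).
    move=> wp; apply/hasP; exists ((s^-1)%g p); first exact: mem_index_enum.
    by rewrite /lab permKV wp.
  apply: (@word_two_idem _ _ e off _ _ lab _ _ _ _ ij (at_ _ _ wk) (at_ _ _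
    wl)).
  move=> p m; rewrite /lab xE; case: (w (s p)) => // m' [->].
  rewrite /val_; case: eqP => _; last by right; rewrite linear0; case: (ep p);
    rewrite ?linear0.
  by left; rewrite bI est; case: ifP.
(* by linearity in each variable, with coefficients common to all monomials *)
have expand phi : (forall k g, gcomp A g (phi k g)) ->
    exists C : {ffun 'I_n.+1 -> letter} -> F, forall s g ep,
      gword_eval A phi (@mlin_monom gT n.+1 s g ep) =
      \sum_w C w *: gword_eval A (phi_ w) (mlin_monom s g ep).
  move=> phiH.
  have [c cE] := fin_all_exists (fun p : 'I_n.+1 * gT => bspan _ _ (phiH p.1
    p.2)).
  pose C k t := c (k, deg t) t.
  have phiE (k : 'I_n.+1) g : phi k g = \sum_t C k t *: val_ t g.
    rewrite (cE (k, g)) /=; apply: eq_bigr => t _; rewrite /val_ /C /deg.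
    by case: eqP => [->//|_]; rewrite !scaler0.
  exists (fun w => \prod_k C k (w k)) => s g ep; apply: (@uinj_inj _ _ _ _ A).
  rewrite gword_eval_prod ?mlin_monom_neq_nil // mlin_monomE big_map.
  pose Z i t := if ep i then ustar (uinj A (val_ t (g i))) else uinj A (val_ t
    (g i)).
  rewrite (eq_bigr (fun i => \sum_t C (s i) t *: Z i t)); last first.
    move=> i _; rewrite uS phiE /Z; case: (ep i); rewrite !linear_sum /=;
      by apply: eq_bigr => t _; rewrite !linearZ.
  rewrite bigA_distr_bigA linear_sum /=.
  rewrite (reindex_onto (fun w : {ffun 'I_n.+1 -> letter} => [ffun i => w (s
    i)])
    (fun w => [ffun k => w ((s^-1)%g k)])) /=; last first.
    by move=> w _; apply/ffunP => i; rewrite !ffunE permK.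
  rewrite (eq_bigl xpredT) => [|w]; last first.
    by apply/eqP/ffunP => i; rewrite !ffunE permKV.
  apply: eq_bigr => w _; rewrite scaler_prod linearZ /=; congr (_ *: _).
    rewrite [RHS](reindex_inj (@perm_inj _ s)).
    by apply: eq_bigr => i _; rewrite ffunE.
  have wne := mlin_monom_neq_nil s g ep (ltn0Sn n); rewrite mlin_monomE in wne.
  rewrite gword_eval_prod // big_map.
  by apply: eq_bigr => i _; rewrite uS /phi_ inord_val ffunE.
pose X := ({ffun 'I_q -> 'I_n.+1 * letter} * letter)%type.
pose L f := [ffun c : X => geval A (phi_ [ffun k => decode c k]) f].
have -> : (#|{: letter}| ^ q * #|{: letter}| * \dim {:V} * n.+1 ^ q)%N =
    \dim {:{ffun X -> V}}.
  rewrite [in RHS]dimvf [dim _]/(#|{: X}| * dim V)%N card_prod card_ffun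
    card_prod.
  by rewrite !card_ord -dimvf expnMn [LHS]mulnC !mulnA.
apply: (gstar_codim_le (L := L)).
  by move=> a f h; apply/ffunP => c; rewrite !ffunE geval_lin.
move=> f mf L0; split; first exact: mlin_mone mf.
move=> phi /expand [C CE]; have [d fE] := mf.
have ev psi : geval A psi f =
    \sum_m d m *: gword_eval A psi (mlin_monom m.1.1 m.1.2 m.2).
  by rewrite fE geval_sum; apply: eq_bigr => m _; rewrite geval_monom.
have evw (w : {ffun 'I_n.+1 -> letter}) : geval A (phi_ w) f = 0.
  have [[c cw]|/vanish nw] := classic (exists c, decode (n := n.+1) (q := q) c
    =1 w).
    have <- : [ffun k => decode c k] = w by apply/ffunP => k; rewrite ffunE.
    by have /ffunP /(_ c) := L0; rewrite !ffunE.
  by rewrite ev big1 // => m _; rewrite nw scaler0.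
rewrite ev (eq_bigr (fun m => \sum_w C w *:
  (d m *: gword_eval A (phi_ w) (mlin_monom m.1.1 m.1.2 m.2)))).
  by rewrite exchange_big big1 //= => w _; rewrite -scaler_sumr -ev evw scaler0.
move=> m _; rewrite CE scaler_sumr; apply: eq_bigr => w _.
by rewrite !scalerA mulrC.
Qed.

End UpperBound.

Theorem theorem3p6 (F : closedFieldType) (F_char0 : [pchar F] =i pred0)
    (gT : finGroupType) (tau : group_involution gT)
    (V : vectType F) (A : gstar_alg tau V) :
  polynomial_growth A <->
  forall (W : lmodType F) (Q : gstar_alg tau W),
    excluded_alg Q -> ~ in_gstar_var A Q.
Proof.
split=> [poly W Q exQ AQ|noQ].
  apply: exponential_not_polynomial poly => n.
  exact: excluded_growth exQ AQ.
have [I [e [es off smr]]] := excluded_free_structure F_char0 noQ.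
have [K [q bound]] := polynomial_codim_bound F_char0 es off smr.
exact: polynomial_growth_of_bound bound.
Qed.
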